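(* Let $G$ be a 2-connected graph that does not contain a propeller as an induced subgraph. Then either $G$ is a chordless cycle or $G$ has a flat pair.
   Context: All graphs are finite, simple and undirected. A propeller $(C,x)$ is a graph consisting of a chordless cycle $C$ (the rim) and a node $x\notin V(C)$ (the center) that has at least two neighbors on $C$. The connectivity of $G$ is the minimum size of a node set $S$ such that $G\setminus S$ is disconnected or has only one node; $G$ is 2-connected if its connectivity is at least 2. A flat edge is an edge both of whose endnodes have degree 2. A flat pair is a pair of distinct flat edges $e=uv$, $f=xy$ such that $G[\{u,v,x,y\}]$ has exactly two edges, namely $e$ and $f$. *)

(* Defs.v *)
From mathcomp Require Import all_boot.

Set Implicit Arguments.
Unset Strict Implicit.
Unset Printing Implicit Defensive.

Record sgraph := SGraph {
  vertex :> finType;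
  adj : rel vertex;
  adj_sym : symmetric adj;
  adj_irrefl : irreflexive adj
}.

Section Induced.
Variables (G : sgraph) (S : {set G}).

Definition induced_adj : rel {x : G | x \in S} :=
  fun u v => adj (val u) (val v).

Lemma induced_adj_sym : symmetric induced_adj.
Proof. by move=> u v; apply: adj_sym. Qed.

Lemma induced_adj_irrefl : irreflexive induced_adj.
Proof. by move=> u; apply: adj_irrefl. Qed.

Definition induced : sgraph := SGraph induced_adj_sym induced_adj_irrefl.

Definition induced_val (u : induced) : G := val u.

End Induced.

Section Notions.
Variable G : sgraph.

(* The graph with no vertex is not disconnected. *)
Definition disconnected : bool :=
  [exists x : G, exists y : G, ~~ connect (@adj G) x y].

Definition degree (x : G) : nat := #|[set y : G | adj x y]|.

Definition edges : {set {set G}} :=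
  [set [set p.1; p.2] | p : G * G & adj p.1 p.2].

(* A cycle is the sequence of its vertices, in cyclic order. Triangles are
   allowed, and every edge of G between vertices of c is an edge of c. *)
Definition chordless_cycle (c : seq G) : Prop :=
  [/\ 2 < size c,
      ucycle (@adj G) c &
      forall x y, x \in c -> y \in c -> adj x y ->
        y = next c x \/ x = next c y].

Definition is_chordless_cycle : Prop :=
  exists c : seq G, chordless_cycle c /\ forall x : G, x \in c.

Definition is_propeller : Prop :=
  exists (c : seq G) (x : G),
    [/\ chordless_cycle c,
        x \notin c,
        2 <= #|[set y in c | adj x y]| &
        forall z : G, z = x \/ z \in c].

End Notions.

(* When G has a vertex x, the set ~: [set x] is among the sets S below and has
   fewer than #|G| elements, so the default value #|G| does not affect the
   minimum. When G has no vertex, no set S qualifies and the value is 0. *)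
Definition connectivity (G : sgraph) : nat :=
  \big[minn/#|G|]_(S : {set G} | disconnected (induced (~: S))
                                 || (#|induced (~: S)| == 1)) #|S|.

Definition two_connected (G : sgraph) : Prop := 2 <= connectivity G.

Definition propeller_free (G : sgraph) : Prop :=
  forall S : {set G}, ~ is_propeller (induced S).

Definition flat_edge (G : sgraph) (e : {set G}) : Prop :=
  e \in edges G /\ forall u : G, u \in e -> degree u = 2.

(* The edges of the induced subgraph are sets of elements of a sigma type;
   they are compared with e and f after projection to G. *)
Definition flat_pair (G : sgraph) (e f : {set G}) : Prop :=
  [/\ e <> f, flat_edge e, flat_edge f &
      [set [set induced_val u | u in (g : {set _})]
        | g in edges (induced (e :|: f))]
      = [set e; f]].

(* Main.v *)
Require Import Defs.
From mathcomp Require Import all_boot zify.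

(** Idea. In a propeller-free graph, a vertex outside a hole has at most one
    neighbour on it. Work with vertex sets of [G] and prove, by induction on
    [#|X|], that a 2-connected [X] either has all degrees 2 or has two flat
    edges that are not joined by a path of degree-2 vertices. In a minimal
    counterexample, replacing one side of a 2-cutset by an induced path through
    it shows that one of the two sides consists of degree-2 vertices only; as a
    consequence, there is a vertex [x] of degree 2 whose two neighbours [s] and
    [t] have degree at least 3, and [X \ x] is 2-connected. The vertices [s] and
    [t] are on no common hole of [X \ x], since [x] would be the center of a
    propeller. Then some edge [y y'] separates [s] from [t] in [X \ x]:
    otherwise take two disjoint [s]-[t] paths with as few chords as possible
    between them; a path linking the two ends around the first chord gives
    a propeller, or a rerouting with fewer chords. Finally choose such
    [x], [y], [y'] so that the component of [s] has no flat edge and is as small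
    as possible. The induction hypothesis yields a flat edge [s m] after [x] is
    deleted, and the cutset obtained from [m] has a strictly smaller component. *)

Set Implicit Arguments.
Unset Strict Implicit.
Unset Printing Implicit Defensive.

(** * Connectivity, induced paths and holes *)

Section Links.
Variable G : sgraph.
Implicit Types (X Y A B C : {set G}) (a b c d u v w x y z : G).

(** A flat pair alone would not survive the exchange of a side for a path, because both of its edges
    could lie on the new path. Asking that no path of degree-2 vertices joins the two edges repairs
    this: the new path is itself connected and consists of degree-2 vertices, so at least one of the
    two edges lies on the side that was kept.

    Every use of propeller-freeness needs a chordless cycle, while the natural constructions only
    give closed walks that may have further edges. So no cycle is written down. A hole is taken
    inside a prescribed vertex set by means of a shortest path, and a vertex is shown to lie on it
    because it is the only exit from some part of that set.

    Pairs of disjoint paths are compared by the number of vertices of degree at least 3 first, since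
    a rerouting may be much longer than the piece that it replaces. *)

Definition nbr X v : {set G} := [set z in X | adj v z].
Definition rin X : rel G := [rel a b | [&& a \in X, b \in X & adj a b]].
(** Reflexive even at vertices outside [X], hence the membership hypothesis of [link_in]. *)
Definition link X a b := connect (rin X) a b.
Definition conn X := forall a b, a \in X -> b \in X -> link X a b.
(* A hole is the vertex set of a chordless cycle; triangles are included. *)
Definition hole C := [/\ C != set0, conn C & forall v, v \in C -> #|nbr C v| = 2].
Definition twoconn X := 2 < #|X| /\ forall v, conn (X :\ v).
Definition deg2 X : {set G} := [set v in X | #|nbr X v| == 2].

Lemma adjC a b : adj a b = adj b a. Proof. exact: adj_sym. Qed.
Lemma adj_neq a b : adj a b -> a != b.
Proof. by apply: contraTneq => ->; rewrite adj_irrefl. Qed.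
Lemma adjxx a : adj a a = false. Proof. exact: adj_irrefl. Qed.

Lemma in_nbr X v z : (z \in nbr X v) = (z \in X) && adj v z.
Proof. by rewrite inE. Qed.

Lemma nbrS X Y v : X \subset Y -> nbr X v \subset nbr Y v.
Proof. by move=> sXY; apply/subsetP=> z; rewrite !in_nbr => /andP[/(subsetP sXY)-> ->]. Qed.

Lemma rin_sym X : symmetric (rin X).
Proof. by move=> a b; rewrite /rin /= adjC andbCA. Qed.

Lemma link_sym X a b : link X a b = link X b a.
Proof. exact/sym_connect_sym/rin_sym. Qed.

Lemma link0 X a : link X a a. Proof. exact: connect0. Qed.

Lemma link_trans X b a c : link X a b -> link X b c -> link X a c.
Proof. exact: connect_trans. Qed.

Lemma link1 X a b : a \in X -> b \in X -> adj a b -> link X a b.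
Proof. by move=> aX bX ab; apply: connect1; rewrite /rin /= aX bX. Qed.

Lemma linkS X Y a b : X \subset Y -> link X a b -> link Y a b.
Proof.
move=> sXY; apply: connect_sub => u v /and3P[uX vX uv].
by apply: link1; rewrite // (subsetP sXY).
Qed.

(** The crossing edge is the first one along the walk, so the part before it stays in [X :&: A]. *)
Lemma link_exit X A a b : link X a b -> a \in A -> b \notin A ->
  exists c d, [/\ c \in A, d \notin A, c \in X, d \in X & adj c d /\ link (X :&: A) a c].
Proof.
move=> /connectP[p]; elim: p a => [|c p IH] a /= => [_ -> -> //|].
move=> /andP[/and3P[aX cX ac] pc] eb aA bA.
have [cA|cA] := boolP (c \in A); last by exists a, c; split=> //; split=> //; apply: link0.
have [u [v [uA vA uX vX [uv luv]]]] := IH c pc eb cA bA.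
exists u, v; split=> //; split=> //; apply: link_trans luv.
by apply: link1; rewrite ?inE ?aX ?aA ?cX ?cA.
Qed.

Lemma link_closed X A a b : (forall c d, c \in A -> c \in X -> d \in X -> adj c d -> d \in A) ->
  link X a b -> a \in A -> b \in A.
Proof.
move=> clA lab aA; apply: contraT => bA.
have [c [d [cA dA cX dX [cd _]]]] := link_exit lab aA bA.
by rewrite (clA c d) in dA.
Qed.

Lemma link_in X a b : link X a b -> a \in X -> b \in X.
Proof. by apply: link_closed. Qed.

Definition component X a : {set G} := [set z | link X a z].

Lemma in_comp X a z : (z \in component X a) = link X a z. Proof. by rewrite inE. Qed.

Lemma comp_closed X a c d : c \in component X a -> c \in X -> d \in X -> adj c d -> d \in component X a.
Proof. by rewrite !in_comp => lac cX dX cd; apply: link_trans lac _; apply: link1. Qed.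

Lemma compS X a : a \in X -> component X a \subset X.
Proof. by move=> aX; apply/subsetP=> z; rewrite in_comp => /link_in; apply. Qed.

Lemma conn_hub X a : (forall z, z \in X -> link X a z) -> conn X.
Proof. by move=> h u v /h lu /h lv; apply: link_trans lv; rewrite link_sym. Qed.

Lemma not_conn_part X : ~ conn X ->
  exists A B, [/\ A != set0, B != set0, A :|: B = X, [disjoint A & B] &
    forall c d, c \in A -> d \in B -> ~~ adj c d].
Proof.
move=> nc.
have: [exists a in X, [exists b in X, ~~ link X a b]].
  apply: contraT => ne; case: nc => a b aX bX; apply: contraT => nl.
  by case/negP: ne; apply/existsP; exists a; rewrite aX; apply/existsP; exists b; rewrite bX.
case/existsP=> a /andP[aX /existsP[b /andP[bX nl]]].
exists (component X a), (X :\: component X a); split.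
- by apply/set0Pn; exists a; rewrite in_comp link0.
- by apply/set0Pn; exists b; rewrite inE in_comp nl.
- apply/setP=> z; rewrite in_setU in_setD in_comp.
  by case: (boolP (link X a z)) => //= /link_in->.
- by rewrite -setI_eq0; apply/eqP/setP=> z; rewrite in_setI in_setD in_comp inE; case: (link X a z).
- move=> c d cA; rewrite inE => /andP[dA dX]; apply: contra dA => cd.
  by apply: comp_closed cd => //; move: cA; rewrite in_comp => /link_in; apply.
Qed.

Lemma conn_two X a b : conn X -> a \in X -> b \in X -> a != b ->
  exists2 c, c \in X & adj a c.
Proof.
move=> cX aX bX ab; have := cX _ _ aX bX.
case/(@link_exit _ [set a]); rewrite ?inE // 1?eq_sym // => c [d [/set1P-> _ _ dX [ad _]]].
by exists d.
Qed.

Lemma card_ge3 (T : finType) (S : {set T}) (a b c : T) : a \in S -> b \in S -> c \in S ->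
  a != b -> a != c -> b != c -> 2 < #|S|.
Proof.
move=> aS bS cS ab ac bc.
have <- : #|[set a; b; c]| = 3 by rewrite -setUA cardsU1 cards2 !inE negb_or ab ac bc.
by apply: subset_leq_card; apply/subsetP=> z; rewrite !inE => /orP[/orP[]|] /eqP->.
Qed.

Lemma card_ge2 (T : finType) (S : {set T}) (a b : T) : a \in S -> b \in S -> a != b -> 1 < #|S|.
Proof.
move=> aS bS ab; have <- : #|[set a; b]| = 2 by rewrite cards2 ab.
by apply: subset_leq_card; apply/subsetP=> z; rewrite !inE => /orP[] /eqP->.
Qed.

Lemma card_other (T : finType) (S : {set T}) (a b : T) : 2 < #|S| -> exists c : T, [/\ c \in S, c != a & c != b].
Proof.
move=> h; have: S :\: [set a; b] != set0.
  apply: contraL h; rewrite setD_eq0 -leqNgt => /subset_leq_card/leq_trans; apply.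
  by rewrite cards2; case: (a != b).
by case/set0Pn=> c; rewrite !inE negb_or => /andP[/andP[]]; exists c.
Qed.

Lemma twoconn_conn X : twoconn X -> conn X.
Proof.
move=> [c3 h] a b aX bX; have [c [cX ca cb]] := card_other a b c3.
by apply: (linkS (subsetDl X [set c])); apply: h; rewrite !inE ?aX ?bX eq_sym ?ca ?cb.
Qed.

Lemma twoconn_nbr2 X a b : twoconn X -> a \in X -> exists c, [/\ c \in X, adj a c & c != b].
Proof.
move=> X2 aX; have [c3 h] := X2; have [e [eX ea eb]] := card_other a b c3.
have [<-|ab] := eqVneq a b.
  have [|c cX ac] := conn_two (twoconn_conn X2) aX eX; first by rewrite eq_sym.
  by exists c; rewrite eq_sym (adj_neq ac).
have aXb : a \in X :\ b by rewrite !inE ab.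
have eXb : e \in X :\ b by rewrite !inE eb.
rewrite eq_sym in ea; have [c] := conn_two (h b) aXb eXb ea.
by rewrite !inE => /andP[cb cX] ac; exists c.
Qed.

Lemma twoconn_deg X a : twoconn X -> a \in X -> 1 < #|nbr X a|.
Proof.
move=> X2 aX; have [c [cX ac _]] := twoconn_nbr2 a X2 aX.
have [d [dX ad dc]] := twoconn_nbr2 c X2 aX.
by apply: (@card_ge2 _ _ d c) => //; rewrite in_nbr ?cX ?dX.
Qed.

(** * Walks and induced paths *)

Definition walk a b (p : seq G) :=
  if p is x :: p' then [&& x == a, path (@adj G) a p' & last a p' == b] else false.

(** No edge jumps forward by more than one position; jumps backward are covered by exchanging [u]
    and [v]. *)
Definition ipath a b (p : seq G) :=
  [/\ walk a b p, uniq p &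
    forall u v, u \in p -> v \in p -> adj u v -> index v p <= (index u p).+1].

(** As a walk lists both of its ends, walks are joined by an edge and cut by [take] and [drop]
    without special care for the first vertex. *)
Lemma walk_cat a b c d p q : walk a c p -> walk d b q -> adj c d -> walk a b (p ++ q).
Proof.
case: p q => // x p [|y q] //= /and3P[/eqP-> pp /eqP<-] /and3P[/eqP-> pq /eqP<-] cd.
by rewrite eqxx cat_path pp last_cat /= cd pq eqxx.
Qed.

Lemma walk_catI a b z p q : walk a b (p ++ z :: q) -> walk a z (rcons p z) /\ walk z b (z :: q).
Proof.
case: p => [|x p] /=; first by move=> /and3P[/eqP-> -> ->]; rewrite !eqxx.
rewrite cat_path last_cat /= rcons_path last_rcons !eqxx => /andP[-> /andP[/and3P[-> -> ->] ->]].
by [].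
Qed.

Lemma walk_take a b p z : walk a b p -> z \in p -> walk a z (take (index z p).+1 p).
Proof.
move=> wp zp; have [p1 [p2 [e ne]]] : exists p1 p2, p = p1 ++ z :: p2 /\ z \notin p1.
  exists (take (index z p) p), (drop (index z p).+1 p).
  have := cat_take_drop (index z p) p; rewrite (drop_nth z) ?index_mem // nth_index // => ->.
  by rewrite in_take // ltnn.
move: wp; rewrite e => /walk_catI[+ _].
have -> : index z (p1 ++ z :: p2) = size p1 by rewrite index_cat (negPf ne) /= eqxx addn0.
by rewrite -cat_rcons take_size_cat // size_rcons.
Qed.

Lemma walk_drop a b p z : walk a b p -> z \in p -> walk z b (drop (index z p) p).
Proof.
move=> wp zp; have [p1 [p2 [e ne]]] : exists p1 p2, p = p1 ++ z :: p2 /\ z \notin p1.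
  exists (take (index z p) p), (drop (index z p).+1 p).
  have := cat_take_drop (index z p) p; rewrite (drop_nth z) ?index_mem // nth_index // => ->.
  by rewrite in_take // ltnn.
move: wp; rewrite e => /walk_catI[_].
have -> : index z (p1 ++ z :: p2) = size p1 by rewrite index_cat (negPf ne) /= eqxx addn0.
by rewrite drop_size_cat.
Qed.

Lemma in_drop_uniq (p : seq G) i z : uniq p -> (z \in drop i p) = (z \in p) && (i <= index z p).
Proof.
move=> up; have [zp|] := boolP (z \in p); last by apply: contraNF => /mem_drop.
have := up; rewrite -{1}(cat_take_drop i p) cat_uniq => /and3P[_ h _].
rewrite leqNgt -in_take //.
have: (z \in take i p) || (z \in drop i p) by rewrite -mem_cat cat_take_drop.
case: (boolP (z \in take i p)) => [zt _|_ /= ->] //.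
by apply/negbTE; apply: contra h => zd; apply/hasP; exists z.
Qed.

Lemma index_lt (p : seq G) z : z \in p -> index z p < size p.
Proof. by rewrite index_mem. Qed.

Lemma walk_first a b p : walk a b p -> a \in p /\ index a p = 0.
Proof. by case: p => // x p /and3P[/eqP-> _ _]; rewrite mem_head /= eqxx. Qed.

Lemma walk_last a b p : walk a b p -> uniq p -> b \in p /\ (index b p).+1 = size p.
Proof. by case: p => // x p /and3P[/eqP-> _ /eqP<-] up; rewrite mem_last index_last. Qed.

Lemma walk_adj a b p i : walk a b p -> i.+1 < size p -> adj (nth a p i) (nth a p i.+1).
Proof. by case: p => // x p /and3P[/eqP-> pp _] /= h; apply: (pathP _ pp). Qed.

Lemma walk_next a b p z : walk a b p -> uniq p -> z \in p -> z != b ->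
  exists2 z', z' \in p & index z' p = (index z p).+1 /\ adj z z'.
Proof.
move=> wp up zp zb; have [bp ib] := walk_last wp up.
have lt : (index z p).+1 < size p.
  rewrite -ib ltnS ltn_neqAle -ltnS ib index_mem zp andbT.
  by apply: contra zb => /eqP h; rewrite -(nth_index a zp) h nth_index.
exists (nth a p (index z p).+1); rewrite ?mem_nth // index_uniq //; split=> //.
by rewrite -{1}(nth_index a zp); apply: walk_adj wp _.
Qed.

Lemma walk_prev a b p z : walk a b p -> uniq p -> z \in p -> z != a ->
  exists2 z', z' \in p & (index z' p).+1 = index z p /\ adj z z'.
Proof.
move=> wp up zp za; have [ap ia] := walk_first wp.
have lt := zp; rewrite -index_mem in lt.
have gt : 0 < index z p.
  rewrite lt0n; apply: contra za => /eqP h.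
  by rewrite -(nth_index a zp) h -ia nth_index.
exists (nth a p (index z p).-1); first by rewrite mem_nth //; lia.
rewrite index_uniq //; last lia; split; first lia.
by have := @walk_adj a b p (index z p).-1 wp; rewrite prednK // nth_index // adjC; apply.
Qed.

Lemma index_inj_in (p : seq G) u v : u \in p -> index u p = index v p -> u = v.
Proof.
move=> up e; have vp : v \in p by rewrite -index_mem -e index_mem.
by rewrite -(nth_index u up) e nth_index.
Qed.

Lemma walk_link a b p X z : walk a b p -> {subset p <= X} -> z \in p -> link X a z.
Proof.
case: p => // x p /and3P[/eqP-> pp _]; elim: p a pp => {x} [|y p IH] a /=.
  by move=> _ _; rewrite inE => /eqP->; rewrite link0.
move=> /andP[xy pp] sX; rewrite inE => /predU1P[->|zp]; first by rewrite link0.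
apply: link_trans (IH y pp _ zp); last by move=> u up; apply: sX; rewrite inE up orbT.
by apply: link1; rewrite ?sX ?inE ?eqxx ?orbT.
Qed.

(** Induction on the length of a walk from [U] to [V]: a further vertex of [U] or [V] cuts off a
    piece at one end, and an edge that skips vertices gives a shortcut. A walk that allows none of
    this is as required. *)
Lemma ipath_shortest X (U V : {set G}) a b : link X a b -> a \in X -> a \in U -> b \in V ->
  exists c d p, [/\ ipath c d p, {subset p <= X}, c \in U, d \in V &
    forall z, z \in p -> (z \in U -> z = c) /\ (z \in V -> z = d)].
Proof.
move=> lab aX aU bV.
have [p [wp up sp]] : exists p, [/\ walk a b p, uniq p & {subset p <= X}].
  move: lab => /connectP[q pq ->]; case/shortenP: pq => q' pq' uq' _.
  exists (a :: q'); split=> //=.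
    rewrite !eqxx /= andbT; apply: sub_path pq' => u v.
    by case/and3P.
  move=> z; rewrite inE => /predU1P[-> //|]; move: pq' {uq'}.
  elim: q' {aX aU} a => //= c q' IH a /andP[/and3P[_ cX _] pq'].
  by rewrite inE => /predU1P[-> //|]; apply: IH pq'.
move: {2}(size p) (leqnn (size p)) => n; elim: n p a b wp up sp aU bV {aX lab} => [|n IH] p a b wp up sp aU bV.
  by case: p wp {up sp}.
move=> sz; have [bp ib] := walk_last wp up; have [ap ia] := walk_first wp.
have [/hasP[z zp /andP[za zU]]|/hasPn hU] := boolP (has (fun z => (z != a) && (z \in U)) p).
  apply: (IH (drop (index z p) p) z b) => //; first exact: walk_drop wp zp.
  - exact: drop_uniq.
  - by move=> y /mem_drop; apply: sp.
  - rewrite size_drop; suff: 0 < index z p by lia.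
    by rewrite lt0n; apply: contra za => /eqP h; rewrite (@index_inj_in p z a) // h ia.
have [/hasP[z zp /andP[zb zV]]|/hasPn hV] := boolP (has (fun z => (z != b) && (z \in V)) p).
  apply: (IH (take (index z p).+1 p) a z) => //; first exact: walk_take wp zp.
  - exact: take_uniq.
  - by move=> y /mem_take; apply: sp.
  - rewrite size_take; case: ifP => [|h]; first lia.
    case/eqP: zb; apply: (@index_inj_in p) => //; have := index_lt zp; move/negbT: h; lia.
have [/hasP[u u_p /hasP[v vp /andP[uv lt]]]|/hasPn hA] := boolP (has (fun u =>
    has (fun v => adj u v && ((index u p).+1 < index v p)) p) p).
  apply: (IH (take (index u p).+1 p ++ drop (index v p) p) a b) => //.
  - exact: walk_cat (walk_take wp u_p) (walk_drop wp vp) uv.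
  - rewrite cat_uniq take_uniq // drop_uniq // andbT /=; apply/hasPn=> z.
    by rewrite in_drop_uniq // => /andP[zp h]; rewrite /= in_take //; lia.
  - by move=> z; rewrite mem_cat => /orP[/mem_take|/mem_drop]; apply: sp.
  - have hv := index_lt vp; have hu := index_lt u_p.
    rewrite size_cat size_take size_drop; case: ifP => [h|/negbT h]; first lia.
    move: lt; lia.
exists a, b, p; split=> //.
  split=> // u v u_p vp uv; rewrite leqNgt; apply/negP=> lt.
  by have /hasPn/(_ v vp) := hA u u_p; rewrite uv lt.
by move=> z zp; split=> h; apply/eqP; [have := hU z zp|have := hV z zp]; rewrite h andbT negbK.
Qed.

Lemma ipath_adj a b p u v : ipath a b p -> u \in p -> v \in p ->
  adj u v = ((index u p).+1 == index v p) || ((index v p).+1 == index u p).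
Proof.
move=> [wp up ip] u_p vp; apply/idP/idP => [uv|].
  have h1 := ip u v u_p vp uv; rewrite adjC in uv; have h2 := ip v u vp u_p uv.
  have h3 : index u p != index v p.
    by apply: contraTneq uv => /(index_inj_in u_p)->; rewrite adjxx.
  by move: h1 h2 h3; lia.
have hu := index_lt u_p; have hv := index_lt vp.
case/orP=> /eqP e.
  rewrite -e in hv; have := walk_adj wp hv; by rewrite e !nth_index.
by rewrite -e in hu; have := walk_adj wp hu; rewrite e !nth_index // adjC.
Qed.

Lemma card_nbr2 X v a b : a \in X -> b \in X -> adj v a -> adj v b -> a != b ->
  (forall z, z \in X -> adj v z -> z = a \/ z = b) -> #|nbr X v| = 2.
Proof.
move=> aX bX va vb ab h; suff -> : nbr X v = [set a; b] by rewrite cards2 ab.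
apply/setP=> z; rewrite in_nbr !inE; apply/andP/orP.
  by case=> zX /(h z zX)[]->; [left|right].
by case=> /eqP->.
Qed.

Lemma nbr2P X v : #|nbr X v| = 2 -> exists a b, [/\ a \in X, b \in X, adj v a, adj v b &
  a != b /\ forall z, z \in X -> adj v z -> z = a \/ z = b].
Proof.
move/eqP/cards2P=> [a [b [ab e]]].
have ha : a \in nbr X v by rewrite e !inE eqxx.
have hb : b \in nbr X v by rewrite e !inE eqxx orbT.
move: ha hb; rewrite !in_nbr => /andP[aX va] /andP[bX vb].
exists a, b; split=> //; split=> // z zX vz.
have: z \in nbr X v by rewrite in_nbr zX.
by rewrite e !inE => /orP[] /eqP; [left|right].
Qed.

Lemma walk_conn a b p : walk a b p -> conn [set z in p].
Proof.
move=> wp; apply: (@conn_hub _ a) => z; rewrite inE => zp.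
by apply: walk_link wp _ zp => u; rewrite inE.
Qed.

Lemma ipath_hole a b p w : ipath a b p -> w \notin p -> a != b -> adj w a -> adj w b ->
  (forall z, z \in p -> adj w z -> z = a \/ z = b) -> hole (w |: [set z in p]).
Proof.
move=> ip wp ab wa wb hw; have [wk up _] := ip.
have [ap ia] := walk_first wk; have [bp ib] := walk_last wk up.
have inC z : (z \in w |: [set z in p]) = (z == w) || (z \in p) by rewrite !inE.
split; first by apply/set0Pn; exists w; rewrite inC eqxx.
  apply: (@conn_hub _ a) => z; rewrite inC => /predU1P[->|zp].
    by apply: link1; rewrite ?inC ?eqxx ?ap ?orbT // adjC.
  by apply: walk_link wk _ zp => u u_p; rewrite inC u_p orbT.
move=> v; rewrite inC => /predU1P[->|vp].
  apply: (@card_nbr2 _ _ a b) => //; rewrite ?inC ?ap ?bp ?orbT // => z.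
  by rewrite inC => /predU1P[->|/hw//]; rewrite adjxx.
have ne z : z \in p -> w != z by move=> zp; apply: contraNneq wp => ->.
have idx z : z \in p -> adj v z -> ((index v p).+1 == index z p) || ((index z p).+1 == index v p).
  by move=> zp; rewrite (ipath_adj ip).
have [va|va] := eqVneq v a.
  have [|c cp [ic vc]] := walk_next wk up vp; first by rewrite va.
  apply: (@card_nbr2 _ _ w c) => //; rewrite ?inC ?eqxx ?cp ?orbT ?ne //; first by rewrite va adjC.
  move=> z; rewrite inC => /predU1P[->|zp] vz; first by left.
  by right; apply: (index_inj_in zp); have := idx z zp vz; rewrite ic va ia; clear; lia.
have [vb|vb] := eqVneq v b.
  have [c cp [ic vc]] := walk_prev wk up vp va.
  apply: (@card_nbr2 _ _ w c) => //; rewrite ?inC ?eqxx ?cp ?orbT ?ne //; first by rewrite vb adjC.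
  move=> z; rewrite inC => /predU1P[->|zp] vz; first by left.
  right; apply: (index_inj_in zp); have := idx z zp vz; have := index_lt zp.
  by move: ic ib; rewrite vb; clear; lia.
have [c cp [ic vc]] := walk_prev wk up vp va; have [d dp [id vd]] := walk_next wk up vp vb.
apply: (@card_nbr2 _ _ c d) => //; rewrite ?inC ?cp ?dp ?orbT //.
  by apply/eqP=> e; move: ic id; rewrite e; clear; lia.
move=> z; rewrite inC => /predU1P[->|zp] vz.
  by move: vz; rewrite adjC => /(hw v vp)[] e; [rewrite e eqxx in va|rewrite e eqxx in vb].
have := idx z zp vz => /orP[] /eqP e; [right|left]; apply: (index_inj_in zp); move: e ic id; clear; lia.
Qed.

(** A shortest path from [a] to [b] in [X] is induced and meets the neighbourhood of [w] in its ends
    only, so [w] closes it. The path is forgotten; only its vertex set [R] is returned, and its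
    connectedness lets [conn_cut] force vertices into it. *)
Lemma hole_through X w a b : w \notin X -> a \in X -> b \in X -> a != b -> adj w a -> adj w b ->
  (forall z, z \in X -> adj w z -> z = a \/ z = b) -> link X a b ->
  exists R : {set G}, [/\ R \subset X, conn R, a \in R, b \in R & hole (w |: R)].
Proof.
move=> wX aX bX ab wa wb hw lab.
have [||c [d [p [ip sp /set1P ec /set1P ed _]]]] :=
  @ipath_shortest X [set a] [set b] a b lab aX; rewrite ?inE //.
subst c d; have [wk up _] := ip.
exists [set z in p]; split; first by apply/subsetP=> z; rewrite inE => /sp.
- exact: walk_conn wk.
- by rewrite inE; case: (walk_first wk).
- by rewrite inE; case: (walk_last wk up).
- apply: ipath_hole ip _ ab wa wb _; first by apply: contra wX => /sp.
  by move=> z /sp; apply: hw.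
Qed.

(* [c] is the only way out of [K] inside [Y], so the connected set [R] has to contain it. *)
Lemma conn_cut (R Y K : {set G}) a b c : conn R -> R \subset Y -> a \in R -> b \in R -> a \in K -> b \notin K ->
  (forall k z, k \in K -> k \in Y -> z \in Y -> z \notin K -> adj k z -> z = c) -> c \in R.
Proof.
move=> cR sRY aR bR aK bK h.
have [k [z [kK zK kR zR [kz _]]]] := link_exit (cR _ _ aR bR) aK bK.
by rewrite -(h k z) // (subsetP sRY).
Qed.

Lemma walk_rev a b p : walk a b p -> walk b a (rev p).
Proof.
elim: p a => // x [|y p] IH a /=; first by move=> /andP[/eqP-> /eqP->]; rewrite !eqxx.
move=> /and3P[/eqP-> /andP[ay pp] la]; rewrite rev_cons -cats1.
apply: (@walk_cat _ _ y a); first by apply: IH; rewrite /= eqxx pp la.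
  by rewrite /= !eqxx.
by rewrite adjC.
Qed.

End Links.

(** * Holes and the definitions of the statement *)

Section Holes.
Variable G : sgraph.
Implicit Types (X Y A B C : {set G}) (a b c d u v w x y z : G).

(** If a path cannot be prolonged at its end [x], all neighbours of [x] lie on it, so they stay
    linked when [x] is removed. *)
Lemma maximal_walk X a : a \in X ->
  exists x y p, [/\ walk x y p, uniq p, {subset p <= X} & forall z, z \in X -> adj x z -> z \in p].
Proof.
move=> aX.
have main n : forall b p, walk b a p -> uniq p -> {subset p <= X} -> #|X| - size p < n ->
    exists x y p, [/\ walk x y p, uniq p, {subset p <= X} & forall z, z \in X -> adj x z -> z \in p].
  elim: n => // n IH b p wp up sp le.
  have [/exists_inP[z zX /andP[az zp]]|/exists_inPn h] :=
    boolP [exists z in X, adj b z && (z \notin p)]; last first.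
    by exists b, a, p; split=> // z zX az; apply: contraT => zp; have := h z zX; rewrite az zp.
  have sp' : {subset z :: p <= X} by move=> u; rewrite inE => /predU1P[->//|]; apply: sp.
  have up' : uniq (z :: p) by rewrite /= zp.
  have wp' : walk z a (z :: p).
    by rewrite -cat1s; apply: (walk_cat (c := z) _ wp); rewrite /= ?eqxx // adjC.
  apply: (IH z (z :: p)) => //.
  have h : size (z :: p) <= #|X| by rewrite -(card_uniqP up'); apply/subset_leq_card/subsetP.
  by move: le h; rewrite /=; clear; lia.
apply: (main (#|X|.+1) a [:: a]) => //; first by rewrite /= eqxx.
- by move=> z; rewrite inE => /eqP->.
- by rewrite ltnS leq_subr.
Qed.

(** The two neighbours of a suitable vertex [x] are linked in [C :\ x]. A shortest path between them
    together with [x] is 2-regular inside the 2-regular [C], hence closed under adjacency in [C],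
    hence all of [C]; the path provides the cyclic order. *)
Lemma hole_cycle C : hole C -> exists2 s : seq G, (forall z, (z \in s) = (z \in C)) & chordless_cycle s.
Proof.
case=> /set0Pn[v0 v0C] cC dC.
have [x [y [p [wp up sp hx]]]] := maximal_walk v0C.
have [xp ix] := walk_first wp; have xC := sp x xp.
have [a [b [aC bC xa xb [ab hab]]]] := nbr2P (dC x xC).
have lab : link (C :\ x) a b.
  have cp : conn [set z in behead p].
    case: (p) wp (hx a aC xa) => // x' [|c q] /=.
      by move=> /andP[/eqP-> _]; rewrite inE => /eqP e; rewrite e adjxx in xa.
    move=> /and3P[/eqP-> /andP[xc pq] lq] _; apply: (@walk_conn _ c y).
    by rewrite /= eqxx pq.
  have inb z : z \in C -> adj x z -> z \in [set z in behead p].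
    move=> zC xz; rewrite inE; have := hx z zC xz; case: (p) wp => // x' q /and3P[/eqP-> _ _] /=.
    by rewrite inE => /predU1P[e|//]; rewrite e adjxx in xz.
  apply: (linkS _ (cp _ _ (inb a aC xa) (inb b bC xb))); apply/subsetP=> z; rewrite !inE.
  move=> zp; rewrite (sp z (mem_behead zp)) andbT.
  by case: (p) wp up zp => // x' q /and3P[/eqP-> _ _] /= /andP[xq _]; apply: contraTneq => ->.
have aCx : a \in C :\ x by rewrite !inE aC andbT eq_sym adj_neq.
have [||c [d [q [iq sq /set1P ec /set1P ed _]]]] :=
  @ipath_shortest _ (C :\ x) [set a] [set b] a b lab aCx; rewrite ?inE //; subst c d.
have {sq} sq z : z \in q -> z != x /\ z \in C by move/sq; rewrite !inE => /andP[].
have [wq uq _] := iq; have [aq ia] := walk_first wq; have [bq ib] := walk_last wq uq.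
have xq : x \notin q by apply/negP=> /sq[]; rewrite eqxx.
have hq : hole (x |: [set z in q]).
  by apply: ipath_hole iq xq ab xa xb _ => z /sq[_]; apply: hab.
have eC : x |: [set z in q] = C.
  have sqC : x |: [set z in q] \subset C.
    by apply/subsetP=> z; rewrite !inE => /predU1P[->//|/sq[]].
  apply/eqP; rewrite eqEsubset sqC; apply/subsetP=> z zC.
  apply: (link_closed _ (cC x z xC zC)); last by rewrite !inE eqxx.
  move=> c d cQ _ dC' cd; case: hq => _ _ /(_ c cQ) hc.
  have e : nbr (x |: [set z in q]) c = nbr C c.
    by apply/eqP; rewrite eqEcard nbrS // hc dC // (subsetP sqC).
  have: d \in nbr C c by rewrite in_nbr dC'.
  by rewrite -e in_nbr => /andP[].
have inC z : (z \in x :: q) = (z \in C) by rewrite -eC !inE.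
exists (x :: q) => //.
have next_q z z' : z \in q -> z' \in q -> index z' q = (index z q).+1 -> z' = next (x :: q) z.
  move=> zq z'q iz; rewrite next_nth inE zq orbT /= ifN_eqC; last by case: (sq z zq).
  by rewrite /= -iz nth_index.
have next_x : next (x :: q) x = a.
  by rewrite next_nth mem_head /= eqxx; case: (q) wq => // a' q' /and3P[/eqP-> _ _].
have next_b : next (x :: q) b = x.
  rewrite next_nth inE bq orbT /= ifN_eqC; last by case: (sq b bq).
  by rewrite /= ib nth_default.
split.
- have := index_lt aq; have := index_lt bq.
  have: index a q != index b q by apply: contra ab => /eqP/(index_inj_in aq)->.
  by rewrite ia /=; clear; lia.
- rewrite /ucycle /= xq uq andbT rcons_path.
  case: (q) wq => // a' q' /and3P[/eqP-> pq /eqP lq] /=; rewrite xa pq lq /=.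
  by rewrite adjC xb.
move=> u v; rewrite !inE => /predU1P[->|uq'] /predU1P[->|vq].
- by rewrite adjxx.
- by move=> xv; case: (hab v (proj2 (sq v vq)) xv) => ->; [left|right].
- by rewrite adjC => xu; case: (hab u (proj2 (sq u uq')) xu) => ->; [right|left].
move=> uv; have := uv; rewrite (ipath_adj iq) // => /orP[] /eqP e; [left|right].
  exact: next_q.
exact: next_q.
Qed.

Lemma lift_seq (S : {set G}) (s : seq G) : {subset s <= S} -> exists s' : seq (induced S), map val s' = s.
Proof.
elim: s => [|x s IH] sS; first by exists [::].
have [|s' e] := IH; first by move=> z zs; apply: sS; rewrite inE zs orbT.
by exists ((Sub x (sS x (mem_head _ _)) : induced S) :: s'); rewrite /= e.
Qed.

Lemma propeller_free_hole C c a b : propeller_free G -> hole C -> c \notin C ->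
  a \in C -> b \in C -> adj c a -> adj c b -> a = b.
Proof.
move=> PF hC cC aC bC ca cb; have [s inC [s3 /andP[cs us] hs]] := hole_cycle hC.
apply/eqP; apply: contraT => ab; case: (PF (c |: C)).
have [|s' es] := @lift_seq (c |: C) s; first by move=> z; rewrite inC !inE orbC => ->.
have cS : c \in c |: C by rewrite !inE eqxx.
pose c' : induced (c |: C) := Sub c cS.
have in_s' (u : induced (c |: C)) : (u \in s') = (val u \in C).
  by rewrite -inC -es mem_map //; apply: val_inj.
have us' : uniq s' by rewrite -(map_inj_uniq val_inj) es.
exists s', c'; split.
- split; first by rewrite -(size_map val) es.
    by rewrite /ucycle us' andbT; move: cs; rewrite -es cycle_map.
  move=> u v us_ vs uv; have := hs (val u) (val v).
  rewrite !inC -!in_s' => /(_ us_ vs uv); rewrite -es !(next_map val_inj us') => -[] /val_inj ->;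
    by [left|right].
- by rewrite in_s'.
- have aS : a \in c |: C by rewrite !inE aC orbT.
  have bS : b \in c |: C by rewrite !inE bC orbT.
  by apply: (@card_ge2 _ _ (Sub a aS : induced _) (Sub b bS)); rewrite ?inE ?in_s' -?val_eqE /= ?aC ?bC.
- move=> z; rewrite in_s'; have := valP z; rewrite !inE => /predU1P[e|->]; [left|by right].
  exact: val_inj.
Qed.

(** * 2-connectivity and flat pairs in terms of vertex sets *)

Lemma connectivity_le (S : {set G}) :
  disconnected (induced (~: S)) || (#|induced (~: S)| == 1) -> connectivity G <= #|S|.
Proof.
move=> PS; rewrite /connectivity.
have: S \in index_enum {set G} by rewrite mem_index_enum.
elim: (index_enum _) => // T r IH; rewrite inE big_cons => /predU1P[<-|/IH le].
  by rewrite PS geq_minl.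
by case: ifP => // _; apply: leq_trans le; apply: geq_minr.
Qed.

(** The bound is the default value of the minimum. It provides a vertex before the complement of a
    singleton can be formed. *)
Lemma connectivity_le_card : connectivity G <= #|G|.
Proof.
rewrite /connectivity; elim: (index_enum _) => [|T r IH]; rewrite ?big_nil // big_cons.
by case: ifP => // _; apply: leq_trans IH; apply: geq_minr.
Qed.

Lemma link_induced (S : {set G}) (u v : induced S) : connect (@adj (induced S)) u v -> link S (val u) (val v).
Proof.
move=> /connectP[p]; elim: p u => [|w p IH] u /=; first by move=> _ ->; rewrite link0.
by move=> /andP[uw pw] e; apply: link_trans (IH w pw e); apply: link1 => //; apply: valP.
Qed.

Lemma two_connected_setT : two_connected G -> twoconn [set: G].
Proof.
move=> G2; have c2 : 2 <= #|G| := leq_trans G2 connectivity_le_card.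
have [x _] : exists x, x \in [set: G] by apply/set0Pn; rewrite -card_gt0 cardsT; apply: leq_trans c2.
split.
  (* Removing [~: [set x]] leaves a single node, so this set takes part in the minimum; its size is
     one less than that of [G]. *)
  have: 2 <= #|~: [set x]|.
    apply: leq_trans G2 _; apply: connectivity_le; apply/orP; right.
    by rewrite card_sig setCK cards1.
  by rewrite cardsC1 cardsT; lia.
move=> v a b aX bX; have: ~~ disconnected (induced (~: [set v])).
  apply/negP=> h; have := connectivity_le (S := [set v]); rewrite h /= cards1 => /(_ isT).
  by rewrite leqNgt G2.
have aS : a \in ~: [set v] by move: aX; rewrite !inE andbT.
have bS : b \in ~: [set v] by move: bX; rewrite !inE andbT.
move=> /existsPn/(_ (Sub a aS))/existsPn/(_ (Sub b bS)); rewrite negbK => /link_induced /=.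
by apply: linkS; apply/subsetP=> z; rewrite !inE andbT.
Qed.

Definition flat2 X := exists a b c d,
  [/\ [&& a \in deg2 X, b \in deg2 X, c \in deg2 X & d \in deg2 X], adj a b, adj c d &
      ~~ link (deg2 X) a c].

Lemma flat2_flat_pair : flat2 [set: G] -> exists e f : {set G}, flat_pair e f.
Proof.
move=> [a [b [c [d [/and4P[aD bD cD dD] ab cd nl]]]]].
(* If an end of one edge were equal or adjacent to an end of the other, [a] and [c] would be linked
   inside [deg2]. *)
have nadj u v : u \in [set a; b] -> v \in [set c; d] -> (u != v) && ~~ adj u v.
  move=> hu hv.
  have [uD lu] : u \in deg2 setT /\ link (deg2 setT) a u.
    by move: hu; rewrite in_set2 => /orP[] /eqP->; [rewrite link0 | split=> //; apply: link1].
  have [vD lv] : v \in deg2 setT /\ link (deg2 setT) c v.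
    by move: hv; rewrite in_set2 => /orP[] /eqP->; [rewrite link0 | split=> //; apply: link1].
  apply/andP; split; apply: contra nl.
    by move=> /eqP e; apply: link_trans lu _; rewrite e link_sym.
  by move=> uv; apply: link_trans lu _; apply: link_trans (link1 uD vD uv) _; rewrite link_sym.
have ae : a \in [set a; b] by rewrite !inE eqxx.
have be : b \in [set a; b] by rewrite !inE eqxx orbT.
have cf : c \in [set c; d] by rewrite !inE eqxx.
have df : d \in [set c; d] by rewrite !inE eqxx orbT.
have edge u v : adj u v -> [set u; v] \in edges G.
  by move=> uv; apply/imsetP; exists (u, v); rewrite ?inE.
have degE u : u \in deg2 setT -> degree u = 2.
  by rewrite inE => /andP[_ /eqP <-]; apply: eq_card => z; rewrite !inE.
have pair u v X : #|X| <= 2 -> u \in X -> v \in X -> adj u v -> [set u; v] = X.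
  move=> cX uX vX uv; apply/eqP; rewrite eqEcard cards2 (adj_neq uv) cX andbT.
  by apply/subsetP=> z; rewrite !inE => /orP[] /eqP->.
have cle u v : #|[set u; v]| <= 2 by rewrite cards2; case: (u != v).
exists [set a; b], [set c; d]; split.
- by move=> e; have h := ae; rewrite e in h; have := nadj a a ae h; rewrite eqxx.
- by split; [exact: edge | move=> u; rewrite !inE => /orP[] /eqP->; apply: degE].
- by split; [exact: edge | move=> u; rewrite !inE => /orP[] /eqP->; apply: degE].
apply/setP=> X; rewrite in_set2; apply/imsetP/idP.
  move=> [g /imsetP[[u v] uv ->] ->]; rewrite inE /= in uv.
  have -> : [set induced_val w | w in [set u; v]] = [set val u; val v].
    by rewrite imsetU1 imset_set1.
  have uv' : adj (val u) (val v) by [].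
  have := valP u; have := valP v; rewrite !(in_setU _ [set a; b]).
  move=> /orP[hv|hv] /orP[hu|hu].
  - by rewrite (pair _ _ _ (cle a b) hu hv uv') eqxx.
  - by have /andP[_] := nadj _ _ hv hu; rewrite adjC uv'.
  - by have /andP[_] := nadj _ _ hu hv; rewrite uv'.
  - by rewrite (pair _ _ _ (cle c d) hu hv uv') eqxx orbT.
have lift u v : u \in [set a; b] :|: [set c; d] -> v \in [set a; b] :|: [set c; d] -> adj u v ->
    exists2 g, g \in edges (induced ([set a; b] :|: [set c; d])) &
      [set u; v] = [set induced_val w | w in (g : {set _})].
  move=> hu hv uv; pose u' : induced _ := Sub u hu; pose v' : induced _ := Sub v hv.
  exists [set u'; v']; first by apply/imsetP; exists (u', v'); rewrite ?inE.
  by rewrite imsetU1 imset_set1.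
by case/orP=> /eqP->; apply: lift; rewrite ?inE ?eqxx ?orbT.
Qed.

End Holes.

Ltac natlia :=
  repeat match goal with
  | H : is_true (leq _ _) |- _ => revert H
  | H : @eq ?T ?a ?b |- _ => unify T nat; change (@eq nat a b) in H; revert H
  | H : is_true (negb (leq _ _)) |- _ => revert H
  end; clear; lia.

(** * An edge separating the neighbours of a degree-2 vertex *)

Section Cut.
Variables (G : sgraph) (J : {set G}) (x s t : G).
Implicit Types (X Y K R C : {set G}) (a b c d u v w y z : G) (h g p : seq G).

Hypothesis PF : forall C c a b, hole C -> c \notin C -> a \in C -> b \in C -> adj c a -> adj c b -> a = b.
Hypothesis xJ : x \notin J.
Hypothesis st : s != t.
Hypothesis nst : ~~ adj s t.
Hypothesis xs : adj x s.
Hypothesis xt : adj x t.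
Hypothesis nx : forall z, z \in J -> adj x z -> z = s \/ z = t.

Lemma walk_segment a b p X c d : walk a b p -> uniq p -> c \in p -> d \in p -> index c p <= index d p ->
  (forall z, z \in p -> index c p <= index z p <= index d p -> z \in X) -> link X c d.
Proof.
move=> wp up; have [n] := ubnP (index d p - index c p).
elim: n c => // n IH c le cp dp cd hX.
have [e|ne] := eqVneq (index c p) (index d p); first by rewrite (index_inj_in cp e) link0.
have cb : c != b.
  apply: contra ne => /eqP ec; have [_ ib] := walk_last wp up; have := index_lt dp.
  by rewrite ec in cd *; move: ib cd; clear; lia.
have [z zp [iz cz]] := walk_next wp up cp cb.
apply: link_trans (IH z _ zp dp _ _).
- apply: link1 => //; apply: hX => //; first by rewrite leqnn.
  by rewrite iz leqnSn /=; move: cd ne; clear; lia.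
- by rewrite iz; move: le cd ne; clear; lia.
- by rewrite iz; move: cd ne; clear; lia.
- by move=> u u_p; rewrite iz => hu; apply: hX => //; move: hu; clear; lia.
Qed.

(* The edge [s t] alone, taken twice, counts as two disjoint paths. *)
Definition twopaths h g := [/\ walk s t h, walk s t g, uniq h, uniq g &
  [/\ {subset h <= J}, {subset g <= J} & forall z, z \in h -> z \in g -> z = s \/ z = t]].
Definition trace h g : {set G} := [set z in h] :|: [set z in g].
Definition big X : {set G} := [set v in X | 2 < #|nbr X v|].
(* Lexicographic order: first the number of vertices of degree at least 3,
   that is, of ends of chords, then the number of vertices. *)
Definition mu X := #|big X| * #|G|.+1 + #|X|.
Definition minimal h g := twopaths h g /\ forall h' g', twopaths h' g' -> mu (trace h g) <= mu (trace h' g').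

Lemma in_trace h g z : (z \in trace h g) = (z \in h) || (z \in g).
Proof. by rewrite !inE. Qed.

Lemma twopaths_sym h g : twopaths h g -> twopaths g h.
Proof. by case=> wh wg uh ug [sh sg d]; split=> //; split=> // z zg zh; apply: d. Qed.

Lemma trace_sym h g : trace h g = trace g h.
Proof. exact: setUC. Qed.

Lemma minimal_sym h g : minimal h g -> minimal g h.
Proof. by case=> /twopaths_sym T M; split=> // h' g' /M; rewrite trace_sym. Qed.

Lemma mu_proper X Y : X \proper Y -> mu X < mu Y.
Proof.
move=> pXY; have := proper_card pXY; have sXY := proper_sub pXY.
have le : #|big X| <= #|big Y|.
  apply/subset_leq_card/subsetP=> z; rewrite !inE => /andP[zX h].
  by rewrite (subsetP sXY) // (leq_trans h) //; apply/subset_leq_card/nbrS.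
by rewrite /mu -addnS => lt; apply: leq_add => //; rewrite leq_mul2r le orbT.
Qed.

(** No set has more than [#|G|] elements, so with the factor [#|G|.+1] a single vertex of degree at
    least 3 outweighs the size. *)
Lemma mu_big X Y : #|big X| < #|big Y| -> mu X < mu Y.
Proof.
move=> lt; apply: (@leq_trans (#|big X|.+1 * #|G|.+1)).
  by rewrite /mu mulSnr -addnS leq_add2l ltnS max_card.
by apply: (@leq_trans (#|big Y| * #|G|.+1)); rewrite ?leq_addr // leq_mul2r lt orbT.
Qed.

Section Paths.
Variables h g : seq G.
Hypothesis T : twopaths h g.

Lemma memh_J z : z \in h -> z \in J. Proof. by case: T => _ _ _ _ [+ _ _]; apply. Qed.
Lemma memh_nx z : z \in h -> z != x.
Proof. by move/memh_J; apply: contraTneq => ->. Qed.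
Lemma s_h : s \in h /\ index s h = 0. Proof. by case: T => wh *; apply: walk_first wh. Qed.
Lemma t_h : t \in h /\ (index t h).+1 = size h. Proof. by case: T => wh _ uh *; apply: walk_last wh uh. Qed.
Lemma uniq_h : uniq h. Proof. by case: T. Qed.
Lemma walk_h : walk s t h. Proof. by case: T. Qed.
Lemma both_ends z : z \in h -> z \in g -> z = s \/ z = t. Proof. by case: T => _ _ _ _ [_ _]; apply. Qed.
Lemma index_le_t z : z \in h -> index z h <= index t h.
Proof. by move/index_lt; case: t_h => _ <-. Qed.
Lemma index_lt_t z : z \in h -> z != t -> index z h < index t h.
Proof.
move=> zh zt; rewrite ltn_neqAle index_le_t // andbT.
by apply: contra zt => /eqP/(index_inj_in zh)->.
Qed.
Lemma index_gt0 z : z \in h -> z != s -> 0 < index z h.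
Proof.
move=> zh zs; rewrite lt0n; apply: contra zs => /eqP e.
by apply/eqP/(index_inj_in zh); rewrite e; case: s_h.
Qed.
End Paths.

Section Minimal.
Variables h g : seq G.
Hypothesis M : minimal h g.

Let T : twopaths h g := proj1 M.

Lemma inner_h z : z \in h -> z != s -> z != t -> z \notin g.
Proof. by move=> zh zs zt; apply/negP=> /(both_ends T zh)[] e; rewrite e eqxx in zs zt. Qed.
Lemma g_inner z : z \notin g -> z != s /\ z != t.
Proof.
move=> zg; have [sg _] := s_h (twopaths_sym T); have [tg _] := t_h (twopaths_sym T).
by split; apply: contraNneq zg => ->.
Qed.

(** A shortcut along an edge that skips vertices of [h] keeps the paths disjoint and drops an inner
    vertex of [h], so the trace shrinks properly. *)
Lemma minimal_induced : ipath s t h.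
Proof.
split; [exact: walk_h T | exact: uniq_h T |] => u v uh vh uv.
rewrite leqNgt; apply/negP=> lt; have [_ min] := M.
have uqh := uniq_h T.
have := min (take (index u h).+1 h ++ drop (index v h) h) g.
have [wh wg uh' ug [sh sg d]] := T.
have sub z : z \in take (index u h).+1 h ++ drop (index v h) h -> z \in h.
  by rewrite mem_cat => /orP[/mem_take|/mem_drop].
rewrite leqNgt mu_proper => [/(_ _)/negP H|].
  apply: H => //; split=> //.
  - exact: walk_cat (walk_take wh uh) (walk_drop wh vh) uv.
  - rewrite cat_uniq take_uniq // drop_uniq // andbT /=; apply/hasPn=> z.
    by rewrite in_drop_uniq // => /andP[zp hz] /=; rewrite in_take // -leqNgt; natlia.
  - by split=> // z /sub; [apply: sh | apply: d].
have us : index u h < index t h.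
  by apply: leq_trans (index_le_t T vh); apply: ltnW.
have ut : u != t by apply: contraTneq us => ->; rewrite ltnn.
have [z zh [iz _]] := walk_next wh uqh uh ut.
apply/properP; split.
  by apply/subsetP=> y; rewrite !in_trace => /orP[/sub->//|->]; rewrite orbT.
exists z; rewrite !in_trace ?zh // negb_or mem_cat in_take // in_drop_uniq // zh iz.
rewrite ltnn -ltnNge lt /=; apply: inner_h => //.
  apply/eqP=> e; have [_ is0] := s_h T; by rewrite e is0 in iz.
apply/eqP=> e; have := index_le_t T vh; rewrite -e iz; natlia.
Qed.

(** [x] sees only [s] and [t] in [J], so it closes each path of a minimal pair to a hole. *)
Lemma hole_h : hole (x |: [set z in h]).
Proof.
apply: ipath_hole minimal_induced _ st xs xt _; first by apply/negP=> /(memh_nx T); rewrite eqxx.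
by move=> z /(memh_J T); apply: nx.
Qed.

Lemma one_h c u v : c \notin h -> c != x -> u \in h -> v \in h -> adj c u -> adj c v -> u = v.
Proof.
move=> ch cx uh vh; apply: (PF hole_h); last by rewrite !inE vh orbT.
  by rewrite !inE negb_or cx.
by rewrite !inE uh orbT.
Qed.

Lemma adj_h u v : u \in h -> v \in h ->
  adj u v = ((index u h).+1 == index v h) || ((index v h).+1 == index u h).
Proof. exact: ipath_adj minimal_induced. Qed.

End Minimal.

(** * Edges between the two paths of a minimal pair *)

Definition chord h g c d := [&& c \in h, c \notin g, d \in g, d \notin h & adj c d].

Lemma chord_sym h g c d : chord h g c d = chord g h d c.
Proof. by rewrite /chord adjC; do !case: (_ \in _); rewrite ?andbF. Qed.

Lemma link_suffix h g X z : twopaths h g -> z \in h ->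
  (forall w, w \in h -> index z h <= index w h -> w \in X) -> link X z t.
Proof.
move=> T zh H; apply: (walk_segment (walk_h T) (uniq_h T)) => //; first by case: (t_h T).
  exact (index_le_t T zh).
by move=> w wh /andP[]; move/(H w wh).
Qed.

Lemma link_prefix h g X z : twopaths h g -> z \in h ->
  (forall w, w \in h -> index w h <= index z h -> w \in X) -> link X s z.
Proof.
move=> T zh H; have [sh is0] := s_h T; apply: (walk_segment (walk_h T) (uniq_h T)) => //.
  by rewrite is0.
by move=> w wh /andP[_]; apply: H.
Qed.

(* Crossing chords can be used to swap the ends of the two paths. The new trace is
   smaller unless the four ends form a 4-cycle, and this gives a propeller. *)
Lemma chord_mono h g u v u' v' : minimal h g -> chord h g u u' -> chord h g v v' ->
  index u h < index v h -> index u' g < index v' g.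
Proof.
move=> M /and5P[uh ug u'g u'h uu'] /and5P[vh vg v'g v'h vv'] iuv.
have T := proj1 M; have M' := minimal_sym M; have T' := proj1 M'.
have uqh := uniq_h T; have uqg := uniq_h T'.
rewrite ltnNge; apply/negP; rewrite leq_eqVlt => /orP[/eqP e|lt].
  have ev : v' = u' by apply: index_inj_in v'g e.
  have euv : u = v.
    by apply: (one_h M u'h (memh_nx T' u'g) uh vh); rewrite adjC // -ev.
  by rewrite euv ltnn in iuv.
have [sh sh0] := s_h T; have [sg sg0] := s_h T'.
have [th _] := t_h T; have [tg _] := t_h T'.
have leth := index_le_t T; have letg := index_le_t T'.
(* Exchange of tails: [h1] changes to [g] along [u u'], and [g1] changes to [h] along [v' v]. Only
   the vertices strictly between [u] and [v] on [h] and between [v'] and [u'] on [g] are lost. *)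
pose h1 := take (index u h).+1 h ++ drop (index u' g) g.
pose g1 := take (index v' g).+1 g ++ drop (index v h) h.
have in_h1 z : (z \in h1) = (z \in h) && (index z h <= index u h) || (z \in g) && (index u' g <= index z g).
  rewrite mem_cat in_drop_uniq //; case: (boolP (z \in h)) => [zh|zh]; first by rewrite in_take // ltnS.
  by rewrite [_ \in take _ _](contraNF _ zh) // => /mem_take.
have in_g1 z : (z \in g1) = (z \in g) && (index z g <= index v' g) || (z \in h) && (index v h <= index z h).
  rewrite mem_cat in_drop_uniq //; case: (boolP (z \in g)) => [zg|zg]; first by rewrite in_take // ltnS.
  by rewrite [_ \in take _ _](contraNF _ zg) // => /mem_take.
have sub1 : trace h1 g1 \subset trace h g.
  apply/subsetP=> z; rewrite !in_trace in_h1 in_g1.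
  by do 2!case: (_ \in _).
have T1 : twopaths h1 g1.
  have common := both_ends T.
  split.
  - exact: walk_cat (walk_take (walk_h T) uh) (walk_drop (walk_h T') u'g) uu'.
  - apply: walk_cat (walk_take (walk_h T') v'g) (walk_drop (walk_h T) vh) _; by rewrite adjC.
  - rewrite cat_uniq take_uniq // drop_uniq // andbT /=; apply/hasPn=> z.
    rewrite in_drop_uniq // => /andP[zg hz] /=; apply/negP=> zt.
    have zh := mem_take zt; move: zt; rewrite in_take // => zt.
    case: (common z zh zg) => e; subst z; first by move: hz lt; rewrite sg0; natlia.
    by have := leth v vh; natlia.
  - rewrite cat_uniq take_uniq // drop_uniq // andbT /=; apply/hasPn=> z.
    rewrite in_drop_uniq // => /andP[zh hz] /=; apply/negP=> zt.
    have zg := mem_take zt; move: zt; rewrite in_take // => zt.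
    case: (common z zh zg) => e; subst z; first by move: hz iuv; rewrite sh0; natlia.
    by have := letg u' u'g; natlia.
  - split.
    + by move=> z; rewrite in_h1 => /orP[] /andP[+ _]; [move=> zz; apply: (memh_J T zz)|move=> zz; apply: (memh_J T' zz)].
    + by move=> z; rewrite in_g1 => /orP[] /andP[+ _]; [move=> zz; apply: (memh_J T' zz)|move=> zz; apply: (memh_J T zz)].
    + move=> z; rewrite in_h1 in_g1 => /orP[] /andP[z1 i1] /orP[] /andP[z2 i2];
        by [apply: common | natlia].
have ltu : u != t by case: (g_inner M ug).
have ltv' : v' != t by case: (g_inner M' v'h).
have [z zh [iz uz]] := walk_next (walk_h T) uqh uh ltu.
have [z' z'g [iz' v'z']] := walk_next (walk_h T') uqg v'g ltv'.
have not_less : ~~ (mu (trace h1 g1) < mu (trace h g)) by rewrite -leqNgt; case: M => _; apply.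
(* The successor [z] of [u] would be lost by the exchange if it came before [v]. So [u] and [v] are
   consecutive on [h], and likewise [v'] and [u'] on [g]. *)
have ev : z = v.
  apply: (index_inj_in zh); rewrite iz; apply/eqP; rewrite eqn_leq iuv /=.
  rewrite leqNgt; apply: contra not_less => lt1; apply: mu_proper.
  apply/properP; split=> //; exists z; rewrite !in_trace ?zh //.
  have zg : z \notin g.
    apply: (inner_h M) => //; apply/eqP=> e; first by rewrite e sh0 in iz.
    by have := leth v vh; rewrite -e; natlia.
  by rewrite in_h1 in_g1 (negPf zg) zh /= !orbF negb_or -!ltnNge iz ltnSn lt1.
have ev' : z' = u'.
  apply: (index_inj_in z'g); rewrite iz'; apply/eqP; rewrite eqn_leq lt /=.
  rewrite leqNgt; apply: contra not_less => lt1; apply: mu_proper.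
  apply/properP; split=> //; exists z'; rewrite !in_trace ?z'g ?orbT //.
  have zh' : z' \notin h.
    apply: (inner_h M') => //; apply/eqP=> e; first by rewrite e sg0 in iz'.
    by have := letg u' u'g; rewrite -e; natlia.
  by rewrite in_h1 in_g1 (negPf zh') z'g /= !orbF negb_or -!ltnNge iz' ltnSn lt1.
subst z z'.
(* The initial parts of both paths, to be closed by [v]. The hole contains [u] and [v'], both
   adjacent to [u'], which lies outside. *)
pose X := [set z in h | index z h <= index u h] :|: [set z in g | index z g <= index v' g].
have inX z : (z \in X) = (z \in h) && (index z h <= index u h) || (z \in g) && (index z g <= index v' g).
  by rewrite !inE.
have [||||||||R [RX _ uR v'R hR]] := @hole_through G X v u v'.
- by rewrite inX (negPf vg) orbF vh -ltnNge.
- by rewrite inX uh leqnn.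
- by rewrite inX v'g leqnn orbT.
- by apply: contraNneq v'h => <-.
- by rewrite adjC.
- by [].
- move=> z; rewrite inX => /orP[/andP[z1 i1]|/andP[z1 i1]] vz.
    left; apply: (index_inj_in z1); move: vz; rewrite (adj_h M) // => /orP[] /eqP; natlia.
  by right; apply: (one_h M' vg (memh_nx T vh)).
- apply: (@link_trans _ _ s).
    rewrite link_sym; apply: (link_prefix T) => // w wh iw; by rewrite inX wh iw.
  by apply: (link_prefix T') => // w wg iw; rewrite inX wg iw orbT.
have e : u = v'.
  apply: (PF hR (c := u')); rewrite ?inE ?uR ?v'R ?orbT //; last by rewrite adjC.
    rewrite negb_or; apply/andP; split; first by apply: contraNneq vg => <-.
    apply: contra (u'h) => /(subsetP RX); rewrite inX => /orP[/andP[]//|/andP[_]].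
    by rewrite leqNgt lt.
  by rewrite adjC.
by rewrite e v'g in ug.
Qed.

Lemma in_h_lt_t h g z : twopaths h g -> z \in h -> z \notin g -> index z h < index t h.
Proof.
move=> T zh zg; apply: (index_lt_t T zh); apply: contraNneq zg => ->.
by case: (t_h (twopaths_sym T)).
Qed.

Lemma in_h_gt0 h g z : twopaths h g -> z \in h -> z \notin g -> 0 < index z h.
Proof.
move=> T zh zg; apply: (index_gt0 T zh); apply: contraNneq zg => ->.
by case: (s_h (twopaths_sym T)).
Qed.

Lemma next_s_not_t h g z : minimal h g -> z \in h -> index z h = 1 -> z != t.
Proof.
move=> M zh iz; apply: contra nst => /eqP e; have [sh s0] := s_h (proj1 M).
by rewrite (adj_h M) -?e // s0 iz.
Qed.

(** A hole through [x] inside the part of [h] up to [c] and the part of [g] from [d] on has to pass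
    [a] before it changes to [g], and [b] after that. So [p] would be a center. *)
Lemma one_trace_chord h g (p : G) a b c d : minimal h g -> p \in J -> p \notin trace h g ->
  adj p a -> adj p b -> a \in h -> a \notin g -> b \in g -> b \notin h ->
  chord h g c d -> index a h <= index c h -> index d g <= index b g -> False.
Proof.
move=> M pJ pW pa pb ah ag bg bh ch iac idb; have /and5P[cH cg dg dh cd] := ch.
have T := proj1 M; have M' := minimal_sym M; have T' := proj1 M'.
have [sh sh0] := s_h T; have [sg sg0] := s_h T'.
have [th _] := t_h T; have [tg _] := t_h T'.
have ct := in_h_lt_t T cH cg; have d0 := in_h_gt0 T' dg dh; have a0 := in_h_gt0 T ah ag.
have bt := in_h_lt_t T' bg bh.
pose X := [set z in h | index z h <= index c h] :|: [set z in g | index d g <= index z g].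
have inX z : (z \in X) = (z \in h) && (index z h <= index c h) || (z \in g) && (index d g <= index z g).
  by rewrite !inE.
have XJ z : z \in X -> z \in J.
  by rewrite inX => /orP[] /andP[+ _]; [move/(memh_J T)|move/(memh_J T')].
have pX : p \notin X.
  by apply: contra pW; rewrite inX in_trace => /orP[] /andP[-> _]; rewrite ?orbT.
have [||||||||R [RX cR sR tR hR]] := @hole_through G X x s t => //.
- by apply: contra xJ => /XJ.
- by rewrite inX sh sh0.
- by rewrite inX tg (index_le_t T') ?orbT.
- by move=> z /XJ; apply: nx.
- apply: (@link_trans _ _ c).
    by apply: (link_prefix T) => // w wh iw; rewrite inX wh iw.
  apply: (@link_trans _ _ d); first by apply: link1; rewrite // inX ?cH ?dg ?leqnn ?orbT.
  by apply: (link_suffix T') => // w wg iw; rewrite inX wg iw orbT.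
(* Every edge between the two parts starts at [c]: an earlier chord would end before [d] by
   [chord_mono]. The common ends of the paths are treated apart. *)
have crossing k z : k \in h -> z \in g -> z \notin h -> adj k z -> index k h <= index c h ->
    index d g <= index z g -> k = c.
  move=> kh zg zh kz ikc idz; have [kg|kg] := boolP (k \in g).
    case: (both_ends T kh kg) => e; last by subst k; natlia.
    subst k; have kz' := kz; move: kz; rewrite (adj_h M') // sg0 => /orP[] /eqP e; last by [].
    have ed : d = z by apply: (index_inj_in dg); natlia.
    by apply: (one_h M dh (memh_nx T' dg)) => //; rewrite adjC // ed.
  apply: (index_inj_in kh); apply/eqP; rewrite eqn_leq ikc leqNgt; apply/negP=> lt.
  have chz : chord h g k z by rewrite /chord kh kg zg zh.
  by have := chord_mono M chz ch lt; natlia.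
have aR : a \in R.
  apply: (@conn_cut _ R X [set z in h | index z h < index a h] s t) => //.
  - by rewrite inE sh sh0.
  - by rewrite inE th /= -leqNgt; have := in_h_lt_t T ah ag; natlia.
  - move=> k z; rewrite inE => /andP[kh ik] _ zX zK kz.
    have [zh|zh] := boolP (z \in h).
      move: kz; rewrite (adj_h M) // => e; apply: (index_inj_in zh).
      by move: zK; rewrite inE zh /= -leqNgt; case/orP: e => /eqP; natlia.
    move: zX; rewrite inX (negPf zh) /= => /andP[zg iz].
    have ek : k = c by apply: crossing kz _ iz => //; natlia.
    by rewrite ek in ik; natlia.
have bR : b \in R.
  apply: (@conn_cut _ R X [set z in g | index b g < index z g] t s) => //.
  - by rewrite inE tg.
  - by rewrite inE sg sg0.
  - move=> k z; rewrite inE => /andP[kg ik] _ zX zK kz.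
    have [zg|zg] := boolP (z \in g).
      move: kz; rewrite (adj_h M') // => e; apply: (index_inj_in zg).
      by move: zK; rewrite inE zg /= -leqNgt; case/orP: e => /eqP; natlia.
    move: zX; rewrite inX (negPf zg) /= orbF => /andP[zh iz].
    have [kh|kh] := boolP (k \in h).
      case: (both_ends T kh kg) => e; subst k; first by natlia.
      have zt := in_h_lt_t T zh zg.
      move: kz; rewrite (adj_h M) // => /orP[] /eqP e; first by natlia.
      have ez : z = c by apply: (index_inj_in zh); natlia.
      have : d = t.
        apply: (one_h M' cg (memh_nx T cH)) => //; rewrite -ez (adj_h M) // e eqxx //.
      by move=> e2; rewrite e2 th in dh.
    have ez : z = c by apply: (crossing z k) => //; [rewrite adjC | natlia].
    have ekd : k = d by apply: (one_h M' cg (memh_nx T cH)) => //; rewrite -ez adjC.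
    by rewrite ekd in ik; natlia.
have e : a = b.
  apply: (PF hR (c := p)); rewrite ?inE ?aR ?bR ?orbT // negb_or (contraNneq _ xJ) => [|<- //].
  by apply: contra pX => /(subsetP RX).
by rewrite e bg in ag.
Qed.

(* Two vertices on different paths are always on a common hole: either one that
   uses [x] and a chord, or one between two consecutive chords. *)
Lemma one_trace h g (p : G) a b : minimal h g -> p \in J -> p \notin trace h g ->
  a \in trace h g -> b \in trace h g -> adj p a -> adj p b -> a = b.
Proof.
wlog ah : h g a b / a \in h.
  move=> W M pJ pW aW bW pa pb; have [ah|ah] := boolP (a \in h); first exact: (W h g a b).
  apply: (W g h a b) => //; rewrite ?(trace_sym g) //; last exact: minimal_sym.
  by move: aW; rewrite in_trace (negPf ah).
move=> M pJ pW aW bW pa pb.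
have T := proj1 M; have M' := minimal_sym M; have T' := proj1 M'.
have px : p != x by apply: contraTneq pJ => ->.
have := pW; rewrite in_trace negb_or => /andP[ph pg].
have [bh|bh] := boolP (b \in h); first exact: (one_h M ph px).
have bg : b \in g by move: bW; rewrite in_trace (negPf bh).
have [ag|ag] := boolP (a \in g); first exact: (one_h M' pg px).
exfalso.
have [sh sh0] := s_h T; have [sg sg0] := s_h T'.
have [th _] := t_h T; have [tg _] := t_h T'.
(* [one_trace_chord], applied with the paths in both orders, leaves only chords with both ends
   before [a] and [b] or both ends behind them. *)
have cmp c d : chord h g c d -> (index c h < index a h) && (index d g < index b g) ||
    (index a h < index c h) && (index b g < index d g).
  move=> ch; have hd : ~~ ((index a h <= index c h) && (index d g <= index b g)).
    by apply/negP=> /andP[]; apply: (one_trace_chord M pJ pW pa pb ah ag bg bh ch).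
  have hd' : ~~ ((index b g <= index d g) && (index c h <= index a h)).
    apply/negP=> /andP[]; apply: (one_trace_chord M' pJ _ pb pa bg bh ah ag (c := d) (d := c)).
      by rewrite trace_sym.
    by rewrite -chord_sym.
  by move: hd hd'; clear; lia.
(* The last chord before [a] and [b]. If there is none, [s] and its successor on [g] take its place,
   which accounts for the clause on [d \in g]. *)
have [d [d' [dh d'g dd' [ida idb d'0 d'h hd]]]] : exists d d', [/\ d \in h, d' \in g, adj d d' &
    [/\ index d h < index a h, index d' g <= index b g, 0 < index d' g, d' \notin h &
     (d \in g -> d = s /\ index d' g = 1) /\ forall c c', chord h g c c' ->
       (index c h <= index d h) && (index c' g <= index d' g) ||
       (index a h < index c h) && (index b g < index c' g)]].
  pose P c := (index c h < index a h) && [exists c', chord h g c c'].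
  have [/existsP[c0 Pc0]|/existsPn none] := boolP [exists c, P c].
    case: (@arg_maxnP _ c0 P (fun c => index c h) Pc0) => d /andP[ida /existsP[d' dd']] max.
    have := cmp _ _ dd'; rewrite ida /= => hb.
    have /and5P[dh dg d'g d'h ad] := dd'; exists d, d'; split=> //; split=> //.
    - by move: hb ida; clear; lia.
    - exact: (in_h_gt0 T' d'g d'h).
    - split=> [|c c' cc']; first by rewrite (negPf dg).
      have /orP[/andP[h1 h2]|->] := cmp _ _ cc'; last by rewrite orbT.
      have le : index c h <= index d h.
        by apply: max; rewrite /P h1; apply/existsP; exists c'.
      rewrite le /=; apply/orP; left; rewrite leq_eqVlt in le; case/orP: le => [/eqP e|lt].
        have /and5P[cH cg c'g c'h ac] := cc'; have ec := index_inj_in cH e; subst c.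
        by rewrite (one_h M' dg (memh_nx T dh) c'g d'g ac ad).
      exact/ltnW/(chord_mono M cc' dd').
  have [d' d'g [id' sd']] := walk_next (walk_h T') (uniq_h T') sg st.
  rewrite sg0 in id'; have d't := next_s_not_t M' d'g id'.
  exists s, d'; rewrite sh0 id'; split=> //; split=> //.
  - exact: (in_h_gt0 T ah ag).
  - exact: (in_h_gt0 T' bg bh).
  - apply: (inner_h M' d'g _ d't); apply/eqP=> e; by rewrite e sg0 in id'.
  - split=> // c c' cc'; have /orP[/andP[h1 _]|->] := cmp _ _ cc'; last by rewrite orbT.
    by have /negP[] := none c; rewrite /P h1; apply/existsP; exists c'.
case: hd => dg hd.
have iat := in_h_lt_t T ah ag; have ibt := in_h_lt_t T' bg bh.
have dt : d != t by apply/eqP=> e; rewrite e in ida; natlia.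
have [d1 d1h [id1 dd1]] := walk_next (walk_h T) (uniq_h T) dh dt.
have d1g : d1 \notin g.
  apply/negP=> d1g; case: (both_ends T d1h d1g) => e; rewrite e ?sh0 in id1; natlia.
(* Forward from [d] along both paths. No chord leaves the parts strictly before [a] and [b], so a
   hole through [d] in this set passes both vertices. *)
pose X := [set z in h | index d h < index z h] :|: [set z in g | index d' g <= index z g].
have inX z : (z \in X) = (z \in h) && (index d h < index z h) || (z \in g) && (index d' g <= index z g).
  by rewrite !inE.
have pX : p \notin X.
  by apply: contra pW; rewrite inX in_trace => /orP[] /andP[-> _]; rewrite ?orbT.
have [||||||||R [RX cR d1R d'R hR]] := @hole_through G X d d1 d' => //.
- rewrite inX ltnn andbF /=; apply/negP=> /andP[dG]; case: (dg dG) => -> ->.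
  by rewrite sg0.
- by rewrite inX d1h id1 leqnn.
- by rewrite inX d'g leqnn orbT.
- by apply: contraNneq d1g => ->.
- move=> z; rewrite inX => /orP[] /andP[zz iz] dz.
    left; apply: (index_inj_in zz); move: dz; rewrite (adj_h M) // => /orP[] /eqP; natlia.
  right; have [dG|dG] := boolP (d \in g); last exact: (one_h M' dG (memh_nx T dh)).
  case: (dg dG) => e1 e2; subst d; apply: (index_inj_in zz); move: dz.
  by rewrite (adj_h M') // sg0 e2 => /orP[] /eqP; natlia.
- apply: (@link_trans _ _ t).
    by apply: (link_suffix T) => // w wh iw; rewrite inX wh /= (leq_trans _ iw) ?id1.
  rewrite link_sym; by apply: (link_suffix T') => // w wg iw; rewrite inX wg iw orbT.
have aR : a \in R.
  have [e|ne] := eqVneq d1 a; first by rewrite -e.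
  apply: (@conn_cut _ R X [set z in h | index d h < index z h < index a h] d1 d') => //.
  - rewrite inE d1h id1 leqnn /= ltn_neqAle -id1 (contra _ ne) => [|/eqP/(index_inj_in d1h)->//].
    by rewrite id1.
  - by rewrite inE (negPf d'h).
  - move=> k z; rewrite inE => /and3P[kh ik1 ik2] _ zX zK kz.
    have [zh|zh] := boolP (z \in h).
      have zi : index d h < index z h.
        move: zX; rewrite inX zh /= => /orP[//|/andP[zg iz]].
        case: (both_ends T zh zg) => e; subst z; last by natlia.
        by rewrite sg0 in iz; natlia.
      move: kz; rewrite (adj_h M) // => e; apply: (index_inj_in zh).
      by move: zK; rewrite inE zh zi /= -leqNgt; case/orP: e => /eqP; natlia.
    move: zX; rewrite inX (negPf zh) /= => /andP[zg iz].
    have kg : k \notin g.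
      by apply/negP=> kg; case: (both_ends T kh kg) => e; subst k; natlia.
    have := hd k z; rewrite /chord kh kg zg zh kz => /(_ isT).
    by move: ik1 ik2; clear; lia.
have bR : b \in R.
  have [e|ne] := eqVneq d' b; first by rewrite -e.
  apply: (@conn_cut _ R X [set z in g | index d' g <= index z g < index b g] d' d1) => //.
  - rewrite inE d'g leqnn /= ltn_neqAle idb andbT.
    by apply: contra ne => /eqP/(index_inj_in d'g)->.
  - by rewrite inE (negPf d1g).
  - move=> k z; rewrite inE => /and3P[kg ik1 ik2] _ zX zK kz.
    have kh : k \notin h.
      by apply/negP=> kh; case: (both_ends T kh kg) => e; subst k; natlia.
    have [zg|zg] := boolP (z \in g).
      move: kz; rewrite (adj_h M') // => e; apply: (index_inj_in zg).
      have [lez|ltz] := leqP (index d' g) (index z g).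
        by move: zK; rewrite inE zg lez /= -leqNgt; case/orP: e => /eqP; natlia.
      have zh : z \in h.
        by move: zX; rewrite inX zg /= => /orP[/andP[]//|]; natlia.
      case: (both_ends T zh zg) => e'; subst z; last by natlia.
      move: zX; rewrite inX sh sh0 ltn0 /= sg0; natlia.
    move: zX; rewrite inX (negPf zg) /= orbF => /andP[zh iz].
    have := hd z k; rewrite /chord kh kg zg zh adjC kz => /(_ isT).
    by move: ik1 ik2 iz; clear; lia.
have e : a = b.
  apply: (PF hR (c := p)); rewrite ?inE ?aR ?bR ?orbT // negb_or.
  rewrite (contraNneq _ ph) => [|-> //].
  by apply: contra pX => /(subsetP RX).
by rewrite e bg in ag.
Qed.

(* For the first chord [y y'], the two parts of the trace around [y] and [y']. *)
Definition before h g y y' c := (c \in h) && (index c h < index y h) || (c \in g) && (index c g < index y' g).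
Definition after h g y y' c := (c \in h) && (index y h < index c h) || (c \in g) && (index y' g < index c g).

(** * Paths outside the trace that bypass the first chord *)

Section Bridge.
Variables (h g p : seq G) (y y' p0 pk u v : G).
Hypothesis M : minimal h g.
Hypothesis ch : chord h g y y'.
Hypothesis first : forall c c', chord h g c c' -> (index y h <= index c h) && (index y' g <= index c' g).
Hypothesis ip : ipath p0 pk p.
Hypothesis pJ : {subset p <= J}.
Hypothesis pW : forall z, z \in p -> z \notin trace h g.
Hypothesis p_before : forall z c, z \in p -> before h g y y' c -> adj z c -> z = p0.
Hypothesis p_after : forall z c, z \in p -> after h g y y' c -> adj z c -> z = pk.
Hypothesis uh : u \in h.
Hypothesis uy : index u h < index y h.
Hypothesis up0 : adj u p0.
Hypothesis vT : after h g y y' v.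
Hypothesis vpk : adj v pk.

Let T : twopaths h g := proj1 M.
Let M' : minimal g h := minimal_sym M.
Let T' : twopaths g h := proj1 M'.

Lemma y_facts : [/\ y \in h, y \notin g, y' \in g, y' \notin h & adj y y'].
Proof. by have /and5P[] := ch. Qed.

Lemma p_facts : [/\ p0 \in p, pk \in p & uniq p].
Proof. by have [wp up _] := ip; have [? _] := walk_first wp; have [? _] := walk_last wp up. Qed.

Lemma p_hg z : z \in p -> (z \notin h) * (z \notin g).
Proof. by move/pW; rewrite in_trace negb_or => /andP[]. Qed.

Lemma h_p z : z \in h -> z \notin p.
Proof. by move=> zh; apply/negP=> /p_hg[]; rewrite zh. Qed.

Lemma g_p z : z \in g -> z \notin p.
Proof. by move=> zg; apply/negP=> /p_hg[_]; rewrite zg. Qed.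

Lemma one_p z a b : z \in p -> a \in trace h g -> b \in trace h g -> adj z a -> adj z b -> a = b.
Proof. by move=> zp; apply: one_trace M (pJ zp) (pW zp). Qed.

Lemma u_before : before h g y y' u. Proof. by rewrite /before uh uy. Qed.
Lemma u_trace : u \in trace h g. Proof. by rewrite in_trace uh. Qed.
Lemma v_trace : v \in trace h g.
Proof. by rewrite in_trace; case/orP: vT => /andP[-> _]; rewrite ?orbT. Qed.

Lemma before_trace c : before h g y y' c -> c \in trace h g.
Proof. by rewrite in_trace => /orP[] /andP[-> _]; rewrite ?orbT. Qed.
Lemma after_trace c : after h g y y' c -> c \in trace h g.
Proof. by rewrite in_trace => /orP[] /andP[-> _]; rewrite ?orbT. Qed.

Lemma p_before_u z c : z \in p -> before h g y y' c -> adj z c -> c = u.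
Proof.
move=> zp cb zc; have ez := p_before zp cb zc; rewrite ez in zc zp.
by apply: one_p zp (before_trace cb) u_trace zc _; rewrite adjC.
Qed.

Lemma p_after_v z c : z \in p -> after h g y y' c -> adj z c -> c = v.
Proof.
move=> zp cb zc; have ez := p_after zp cb zc; rewrite ez in zc zp.
by apply: one_p zp (after_trace cb) v_trace zc _; rewrite adjC.
Qed.

Lemma p_adj z w : z \in p -> w \in p -> adj z w ->
  ((index z p).+1 == index w p) || ((index w p).+1 == index z p).
Proof. by move=> zp wp; rewrite (ipath_adj ip). Qed.

Lemma chord_first c d : c \in h -> d \in g -> adj c d -> c \notin g -> d \notin h ->
  (index y h <= index c h) && (index y' g <= index d g).
Proof. by move=> cH dg cd cg dh; apply: first; rewrite /chord cH cg dg dh. Qed.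

Lemma u_ne_t : u != t.
Proof. by apply: contraTneq uy => ->; have [yh _ _ _ _] := y_facts; rewrite -leqNgt (index_le_t T). Qed.

Lemma u_g : u \in g -> u = s.
Proof. by case/(both_ends T uh) => // e; have := u_ne_t; rewrite e eqxx. Qed.

Lemma index_p0 : index p0 p = 0.
Proof. by have [wp _ _] := ip; case: (walk_first wp). Qed.

Lemma p_le_pk z : z \in p -> index z p <= index pk p.
Proof.
by have [wp up _] := ip; have [_ e] := walk_last wp up; move/index_lt; rewrite -e.
Qed.

Lemma link_p X z : (forall w, w \in p -> w \in X) -> z \in p -> link X p0 z.
Proof. by move=> pX; have [wp _ _] := ip; apply: walk_link wp _. Qed.

(* A hole through [u], [p0] and [y] that avoids [y']; any other neighbour of [y'] on
   it makes [y'] the center of a propeller. *)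
Lemma detour_after : exists R,
  [/\ conn R, R \subset [set z in h | index u h < index z h] :|: [set z in p] :|: [set z in g | index y' g < index z g],
      p0 \in R, y \in R & hole (u |: R) /\ exists2 u1, u1 \in R & u1 \in h].
Proof.
have [yh yg y'g y'h yy'] := y_facts; have [p0p pkp uqp] := p_facts.
have [sh sh0] := s_h T; have [sg sg0] := s_h T'.
have [th _] := t_h T; have [tg _] := t_h T'.
have yt := in_h_lt_t T yh yg; have y't := in_h_lt_t T' y'g y'h.
have y'0 := in_h_gt0 T' y'g y'h.
have [u1 u1h [iu1 uu1]] := walk_next (walk_h T) (uniq_h T) uh u_ne_t.
set X := _ :|: _; have inX z : (z \in X) = [|| (z \in h) && (index u h < index z h), z \in p | (z \in g) && (index y' g < index z g)].
  by rewrite !inE orbA.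
have [||||||||R [RX cR u1R p0R hR]] := @hole_through G X u u1 p0 => //.
- rewrite inX ltnn andbF (negPf (h_p uh)) /=; apply/negP=> /andP[/u_g-> ].
  by rewrite sg0.
- by rewrite inX u1h iu1 leqnn.
- by rewrite inX p0p orbT.
- by apply: contraTneq p0p => <-; apply: h_p.
- move=> z; rewrite inX => /or3P[/andP[zh iz]|zp|/andP[zg iz]] uz.
  + left; apply: (index_inj_in zh); move: uz; rewrite (adj_h M) // => /orP[] /eqP e; natlia.
  + by right; apply: p_before zp u_before _; rewrite adjC.
  + exfalso; have [ug|ug] := boolP (u \in g).
      move: uz; rewrite (u_g ug) (adj_h M') // sg0 => /orP[] /eqP e; natlia.
    have [zh|zh] := boolP (z \in h).
      case: (both_ends T zh zg) => e; subst z; first by natlia.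
      by move: uz; rewrite (adj_h M) // => /orP[] /eqP e; natlia.
    by have /andP[le _] := chord_first uh zg uz ug zh; natlia.
(* From the successor of [u] along [h] to [t], back to [v] along the path that contains it, and
   along [p] to [p0]. *)
- apply: (@link_trans _ _ t).
    by apply: (link_suffix T) => // w wh iw; rewrite inX wh /= (leq_trans _ iw) ?iu1.
  apply: (@link_trans _ _ v).
    rewrite link_sym; case/orP: vT => /andP[vv iv].
      apply: (link_suffix T) => // w wh iw; rewrite inX wh /=; apply/orP; left; natlia.
    apply: (link_suffix T') => // w wg iw; rewrite inX wg /=; apply/orP; right; apply/orP; right; natlia.
  apply: (@link_trans _ _ pk).
    apply: link1 => //; rewrite inX ?pkp ?orbT //.
    case/orP: vT => /andP[-> iv]; rewrite ?iv ?orbT //= (ltn_trans uy iv) //.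
  by rewrite link_sym; apply: link_p => // w wp; rewrite inX wp orbT.
exists R; split=> //; last by split=> //; exists u1.
have [e|ne] := eqVneq u1 y; first by rewrite -e.
apply: (@conn_cut _ R X [set z in h | index u h < index z h < index y h] u1 p0) => //.
- rewrite inE u1h iu1 leqnn /= ltn_neqAle -iu1 (contra _ ne) => [|/eqP/(index_inj_in u1h)->//].
  by rewrite iu1.
- by rewrite inE (negPf (p_hg p0p).1).
move=> k z; rewrite inE => /and3P[kh ik1 ik2] _ zX zK kz.
have kb : before h g y y' k by rewrite /before kh ik2.
have kg : k \notin g.
  by apply/negP=> kg; case: (both_ends T kh kg) => e; subst k; natlia.
have hcase : z \in h -> index u h < index z h -> z = y.
  move=> zh iz; move: kz; rewrite (adj_h M) // => e; apply: (index_inj_in zh).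
  by move: zK; rewrite inE zh iz /= -leqNgt; case/orP: e => /eqP e; natlia.
move: zX; rewrite inX => /or3P[/andP[zh iz]|zp|/andP[zg iz]].
- exact: hcase.
- exfalso; have e : k = u by apply: p_before_u zp kb _; rewrite adjC.
  by rewrite e ltnn in ik1.
- have [zh|zh] := boolP (z \in h).
    apply: hcase => //; case: (both_ends T zh zg) => e; subst z; first by natlia.
    natlia.
  by exfalso; have /andP[le _] := chord_first kh zg kz kg zh; natlia.
Qed.

(** The part of [p] before [q] has no edge to [y], none to the vertices after the chord, and towards
    those before it only edges to [u], which is not in [R]. So [R] contains [q] as well as [y], and
    [y'] is a center. *)
Lemma mark_y' q : q \in p -> adj q y' -> (forall z, z \in p -> index z p < index q p -> ~~ adj z y) -> False.
Proof.
move=> qp qy' hq; have [yh yg y'g y'h yy'] := y_facts; have [p0p pkp uqp] := p_facts.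
have [R [cR RX p0R yR [hR [u1 u1R u1h]]]] := detour_after.
have y'0 := in_h_gt0 T' y'g y'h.
have qR : q \in R.
  have [e|ne] := eqVneq p0 q; first by rewrite -e.
  apply: (conn_cut (K := [set z in p | index z p < index q p]) cR RX p0R u1R).
  - rewrite inE p0p index_p0 lt0n; apply: contra ne => /eqP e.
    by apply/eqP/(index_inj_in p0p); rewrite index_p0 e.
  - by rewrite inE (negPf (h_p u1h)).
  move=> k z; rewrite inE => /andP[kp ik] _ zX zK kz.
  have [zp|zp] := boolP (z \in p).
    have e := p_adj kp zp kz; apply: (index_inj_in zp).
    by move: zK; rewrite inE zp /= -leqNgt; case/orP: e => /eqP e; natlia.
  exfalso; have aft : ~~ after h g y y' z.
    apply/negP=> az; have e := p_after kp az kz; rewrite e in ik; have := p_le_pk qp; natlia.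
  have zh : (z \in h) && (index u h < index z h).
    move: zX; rewrite !inE (negPf zp) orbF => /orP[//|hz].
    by rewrite /after hz orbT in aft.
  case/andP: zh => zh iz; move: aft; rewrite /after zh negb_or /= -leqNgt => /andP[le _].
  move: le; rewrite leq_eqVlt => /orP[/eqP e|lt].
    by have := hq k kp ik; rewrite -(index_inj_in zh e) kz.
  have e : z = u by apply: p_before_u kp _ kz; rewrite /before zh lt.
  by rewrite e ltnn in iz.
have e : y = q.
  apply: (PF hR (c := y')); rewrite ?inE ?yR ?qR ?orbT //; try by rewrite adjC.
  rewrite negb_or; apply/andP; split; first by apply: contraNneq y'h => ->.
  by apply: contra y'h => /(subsetP RX); rewrite !inE (negPf (g_p y'g)) ltnn andbF !orbF => /andP[].
by have := h_p yh; rewrite e qp.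
Qed.

(** As in [mark_y'], but now [R] has to leave all of [p], and [v] is the only exit. *)
Lemma mark_v : v \in g -> v \notin h -> (forall z, z \in p -> ~~ adj z y) -> ~~ adj v y'.
Proof.
move=> vg vh hq; apply/negP=> vy'; have [yh yg y'g y'h yy'] := y_facts; have [p0p pkp uqp] := p_facts.
have [R [cR RX p0R yR [hR [u1 u1R u1h]]]] := detour_after.
have vR : v \in R.
  apply: (conn_cut (K := [set z in p]) cR RX p0R u1R); rewrite ?inE //; first exact: h_p.
  move=> k z; rewrite !inE => kp _ zX zp kz.
  have [az|na] := boolP (after h g y y' z); first exact: p_after_v kp az kz.
  exfalso; have zh : (z \in h) && (index u h < index z h).
    move: zX; rewrite (negPf zp) orbF => /orP[//|hz].
    by rewrite /after hz orbT in na.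
  case/andP: zh => zh iz; move: na; rewrite /after zh negb_or /= -leqNgt => /andP[le _].
  move: le; rewrite leq_eqVlt => /orP[/eqP e|lt].
    by have := hq k kp; rewrite -(index_inj_in zh e) kz.
  have e : z = u by apply: p_before_u kp _ kz; rewrite /before zh lt.
  by rewrite e ltnn in iz.
have e : y = v.
  apply: (PF hR (c := y')); rewrite ?inE ?yR ?vR ?orbT //; try by rewrite adjC.
  rewrite negb_or; apply/andP; split; first by apply: contraNneq y'h => ->.
  by apply: contra y'h => /(subsetP RX); rewrite !inE (negPf (g_p y'g)) ltnn andbF !orbF => /andP[].
by rewrite e vg in yg.
Qed.

(* The counterpart of [detour_after] with [y] as potential center. *)
Lemma detour_before : (exists2 z, z \in p & adj z y') \/ (v \in g /\ v \notin h) -> exists R,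
  [/\ conn R, R \subset [set z in h | index z h < index u h] :|: [set z in p] :|: [set z in g | z \notin h],
      p0 \in R, y' \in R & hole (u |: R) /\ exists2 a, a \in R & a \notin p].
Proof.
move=> back; have [yh yg y'g y'h yy'] := y_facts; have [p0p pkp uqp] := p_facts.
have [sh sh0] := s_h T; have [sg sg0] := s_h T'.
have [th _] := t_h T; have [tg _] := t_h T'.
have yt := in_h_lt_t T yh yg; have y't := in_h_lt_t T' y'g y'h.
have y'0 := in_h_gt0 T' y'g y'h.
set X := _ :|: _; have inX z : (z \in X) = [|| (z \in h) && (index z h < index u h), z \in p | (z \in g) && (z \notin h)].
  by rewrite !inE orbA.
have uX : u \notin X by rewrite inX ltnn andbF (negPf (h_p uh)) uh andbF.
have y'X : y' \in X by rewrite inX y'g y'h !orbT.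
have p0X : p0 \in X by rewrite inX p0p orbT.
have lpX z : z \in p -> link X z p0.
  by move=> zp; rewrite link_sym; apply: link_p => // w wp; rewrite inX wp orbT.
(* The hypothesis [back] supplies the return from [y'] to [p]: by an edge, or along [g] to [v] and
   from there to [pk]. *)
have ly'p : link X y' p0.
  case: back => [[z zp zy']|[vg vh]].
    by apply: link_trans (lpX z zp); apply: link1; rewrite ?inX ?zp ?orbT // -?inX // adjC.
  have iv : index y' g < index v g by case/orP: vT => /andP[//]; rewrite (negPf vh).
  have ivt := in_h_lt_t T' vg vh.
  apply: (@link_trans _ _ v).
    apply: (walk_segment (walk_h T') (uniq_h T') y'g vg (ltnW iv)) => w wg iw.
    rewrite inX wg /=; have [wh|wh] := boolP (w \in h); last by rewrite /= ?orbT.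
    by exfalso; case: (both_ends T wh wg) => e; subst w; move: iw; rewrite ?sg0; natlia.
  apply: link_trans (lpX pk pkp).
  by apply: link1; rewrite ?inX ?vg ?vh ?pkp ?orbT.
pose K := [set z in h | index z h < index u h] :|: [set z in g | (z \notin h) && (index z g < index y' g)].
have inK z : (z \in K) = (z \in h) && (index z h < index u h) || [&& z \in g, z \notin h & index z g < index y' g].
  by rewrite !inE.
(* The second neighbour of [u] on the hole: its predecessor on [h], or the second vertex of [g] if
   [u = s]. *)
have [a [aX ua lay' aK [hua ap]]] : exists a, [/\ a \in X, adj u a, link X a y', (a \in K) \/ a = y' &
    (forall z, z \in X -> adj u z -> z = a \/ z = p0) /\ a \notin p].
  have pc z : z \in p -> adj u z -> z = p0.
    by move=> zp uz; apply: p_before zp u_before _; rewrite adjC.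
  have [us|us] := eqVneq u s.
    have iu0 : index u h = 0 by rewrite us.
    have [a ag [ia sa]] := walk_next (walk_h T') (uniq_h T') sg st.
    rewrite sg0 in ia; have at_ := next_s_not_t M' ag ia.
    have ah : a \notin h.
      by apply: (inner_h M' ag _ at_); apply/eqP=> e; rewrite e sg0 in ia.
    exists a; split.
    + by rewrite inX ag ah !orbT.
    + by rewrite us.
    + apply: (walk_segment (walk_h T') (uniq_h T') ag y'g) => [|w wg iw]; first by rewrite ia.
      rewrite inX wg /=; have [wh|wh] := boolP (w \in h); last by rewrite /= ?orbT.
      by exfalso; case: (both_ends T wh wg) => e; subst w; move: iw; rewrite ?sg0 ?ia; natlia.
    + have [e|ne] := eqVneq a y'; [by right|left].
      rewrite inK ag ah /= ia; apply/orP; right.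
      rewrite ltn_neqAle y'0 andbT; apply: contra ne => /eqP e.
      by apply/eqP/(index_inj_in ag); rewrite ia e.
    + split; last exact: g_p.
      move=> z; rewrite inX iu0 ltn0 andbF /= => /orP[zp|/andP[zg zh]] uz.
        by right; apply: pc.
      left; apply: (index_inj_in zg); rewrite ia; move: uz; rewrite us (adj_h M') // sg0.
      by move=> /orP[/eqP|].
  have [a ah [ia uaa]] := walk_prev (walk_h T) (uniq_h T) uh us.
  have iu0 : 0 < index u h by rewrite -ia.
  have ug : u \notin g by apply: contra us => /u_g->.
  exists a; split=> //.
  + by rewrite inX ah -ia leqnn.
  + apply: (@link_trans _ _ s).
      rewrite link_sym; apply: (link_prefix T) => // w wh iw.
      by rewrite inX wh /=; apply/orP; left; natlia.
    apply: (link_prefix T') => // w wg iw.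
    rewrite inX wg /=; have [wh|wh] := boolP (w \in h); last by rewrite /= ?orbT.
    case: (both_ends T wh wg) => e; subst w; first by rewrite sh0 iu0.
    by exfalso; natlia.
  + by left; rewrite inK ah -ia leqnn.
  + split; last exact: h_p.
    move=> z; rewrite inX => /or3P[/andP[zh iz]|zp|/andP[zg zh]] uz.
    * left; apply: (index_inj_in zh); move: uz; rewrite (adj_h M) // => /orP[] /eqP e; natlia.
    * by right; apply: pc.
    * by exfalso; have /andP[le _] := chord_first uh zg uz ug zh; natlia.
have ap0 : a != p0 by apply: contraNneq ap => ->.
have [R [RX cR aR p0R hR]] := hole_through uX aX p0X ap0 ua up0 hua (link_trans lay' ly'p).
exists R; split=> //; last by split=> //; exists a.
(* Within [X] the only exit of [K] is [y']: chords from this part of [h] would precede the first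
   one, and only [u] among the vertices before the chord sees [p]. *)
case: aK => [aK|<- //].
apply: (conn_cut cR RX aR p0R aK); first by rewrite inK (negPf (p_hg p0p).1) (negPf (p_hg p0p).2).
move=> k z kK _ zX zK kz.
have kb : before h g y y' k.
  move: kK; rewrite inK /before => /orP[/andP[-> ik]|/and3P[-> _ ->]]; rewrite ?orbT //.
  by rewrite (ltn_trans ik uy).
have ku : k != u.
  apply: contraTneq kK => ->; by rewrite inK ltnn uh andbF /= andbF.
move: zX zK; rewrite inX inK => /or3P[->//|zp|/andP[zg zh]] zK.
  by exfalso; move: ku; rewrite (p_before_u zp kb) ?eqxx // adjC.
have iz : index y' g <= index z g by move: zK; rewrite zg zh (negPf zh) /= -leqNgt.
have [kg|kg] := boolP (k \in g); last first.
  have kh : k \in h by move: kK; rewrite inK (negPf kg) orbF => /andP[].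
  exfalso; have /andP[le _] := chord_first kh zg kz kg zh.
  by move: kb; rewrite /before kh (negPf kg) /= orbF; natlia.
apply: (index_inj_in zg); have : index k g < index y' g.
  move: kK; rewrite inK => /orP[/andP[kh ik]|/and3P[]//].
  by case: (both_ends T kh kg) => e; subst k; [rewrite sg0 | exfalso; natlia].
by move: kz; rewrite (adj_h M') // => /orP[] /eqP e ik; natlia.
Qed.

(** Mirror image of [mark_y']: the hole of [detour_before] contains [y'] and is forced through [q],
    and the center is [y]. *)
Lemma mark_y q : (exists2 z, z \in p & adj z y') \/ (v \in g /\ v \notin h) ->
  q \in p -> adj q y -> (forall z, z \in p -> index z p < index q p -> ~~ adj z y') -> False.
Proof.
move=> /detour_before[R [cR RX p0R y'R [hR [a aR ap]]]] qp qy hq.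
have [yh yg y'g y'h yy'] := y_facts; have [p0p pkp uqp] := p_facts.
have qR : q \in R.
  have [e|ne] := eqVneq p0 q; first by rewrite -e.
  apply: (conn_cut (K := [set z in p | index z p < index q p]) cR RX p0R aR).
  - rewrite inE p0p index_p0 lt0n; apply: contra ne => /eqP e.
    by apply/eqP/(index_inj_in p0p); rewrite index_p0 e.
  - by rewrite inE (negPf ap).
  move=> k z; rewrite inE => /andP[kp ik] _ zX zK kz.
  have [zp|zp] := boolP (z \in p).
    have e := p_adj kp zp kz; apply: (index_inj_in zp).
    by move: zK; rewrite inE zp /= -leqNgt; case/orP: e => /eqP e; natlia.
  exfalso; have aft : ~~ after h g y y' z.
    apply/negP=> az; have e := p_after kp az kz; rewrite e in ik; have := p_le_pk qp; natlia.
  have bef : ~~ before h g y y' z.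
    apply/negP=> bz; have e := p_before_u kp bz kz; subst z.
    by move: zX; rewrite !inE ltnn andbF (negPf zp) uh andbF.
  move: zX; rewrite !inE (negPf zp) orbF => /orP[/andP[zh iz]|/andP[zg zh]].
    by move: bef; rewrite /before zh (ltn_trans iz uy).
  move: aft bef; rewrite /after /before zg (negPf zh) /= -!leqNgt => le1 le2.
  have e : z = y' by apply: (index_inj_in zg); apply/eqP; rewrite eqn_leq le1.
  by have := hq k kp ik; rewrite -e kz.
have e : y' = q.
  apply: (PF hR (c := y)); rewrite ?inE ?y'R ?qR ?orbT //; try by rewrite adjC.
  rewrite negb_or; apply/andP; split; first by apply: contraTneq uy => ->; rewrite ltnn.
  apply: contra yg => /(subsetP RX); rewrite !inE (negPf (h_p yh)) yh andbF !orbF /=.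
  by rewrite ltnNge (ltnW uy).
by have := g_p y'g; rewrite e qp.
Qed.

(** The hole of [detour_before] contains both [u] and [y'], so an edge [u y] would make [y] a
    center. *)
Lemma mark_u : v \in g -> v \notin h -> ~~ adj u y.
Proof.
move=> vg vh; apply/negP=> uy_; have [R [cR RX p0R y'R [hR _]]] := detour_before (or_intror (conj vg vh)).
have [yh yg y'g y'h yy'] := y_facts.
have e : y' = u.
  apply: (PF hR (c := y)); rewrite ?inE ?y'R ?eqxx ?orbT //; try by rewrite adjC.
  rewrite negb_or; apply/andP; split; first by apply: contraTneq uy => ->; rewrite ltnn.
  apply: contra yg => /(subsetP RX); rewrite !inE (negPf (h_p yh)) yh andbF !orbF /=.
  by rewrite ltnNge (ltnW uy).
by rewrite e uh in y'h.
Qed.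

Lemma u_ne_v : u != v.
Proof.
apply/eqP=> e; move: vT; rewrite -e /after uh /= => /orP[|/andP[ug]]; first by rewrite ltnNge (ltnW uy).
by rewrite (u_g ug); case: (s_h T') => _ ->.
Qed.

Lemma p0_ne_pk : p0 != pk.
Proof.
have [p0p pkp uqp] := p_facts; apply: contra u_ne_v => /eqP e.
by apply/eqP/(one_p p0p u_trace v_trace); rewrite adjC // e.
Qed.

Lemma card_le2 X z a b : (forall c, c \in X -> adj z c -> c = a \/ c = b) -> #|nbr X z| <= 2.
Proof.
move=> H; apply: (@leq_trans #|[set a; b]|); last by rewrite cards2; case: (a != b).
apply/subset_leq_card/subsetP=> c; rewrite in_nbr in_set2 => /andP[cX zc].
by case: (H c cX zc) => ->; rewrite eqxx ?orbT.
Qed.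

(** On rerouting, [z] loses the neighbour [a] and gains at most the neighbour [b]. *)
Lemma card_exchange X Y z a b : a \in nbr Y z -> (forall c, c \in X -> adj z c -> c = b \/ c \in Y /\ c != a) ->
  #|nbr X z| <= #|nbr Y z|.
Proof.
move=> aY H; apply: (@leq_trans #|b |: (nbr Y z :\ a)|).
  apply/subset_leq_card/subsetP=> c; rewrite in_nbr !inE => /andP[cX zc].
  by case: (H c cX zc) => [->|[-> ->]]; rewrite ?eqxx // zc orbT.
by rewrite [X in _ <= X](cardsD1 a) aY cardsU1 leq_add2r; case: (b \notin _).
Qed.

Lemma big_y : y \in big (trace h g).
Proof.
have [yh yg y'g y'h yy'] := y_facts; rewrite inE in_trace yh /=.
have [yns ynt] := g_inner M yg.
have [a ah [ia ya]] := walk_prev (walk_h T) (uniq_h T) yh yns.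
have [b bh [ib yb]] := walk_next (walk_h T) (uniq_h T) yh ynt.
apply: (@card_ge3 _ _ a b y'); rewrite ?in_nbr ?in_trace ?ah ?bh ?y'g ?orbT //.
- by apply/eqP=> e; subst b; natlia.
- by apply: contraNneq y'h => <-.
- by apply: contraNneq y'h => <-.
Qed.

(* Rerouting along [p] creates no vertex of degree 3, and [y] is no longer one. *)
Lemma reroute_false h' g' a b : twopaths h' g' ->
  (forall z, z \in trace h' g' -> z \in p \/ z \in trace h g) ->
  (forall z c, z \in p -> c \in trace h' g' -> c \in trace h g -> adj z c -> c = u \/ c = v) ->
  a \in trace h g -> adj u a -> a \notin trace h' g' ->
  b \in trace h g -> adj v b -> b \notin trace h' g' ->
  y \notin big (trace h' g') -> False.
Proof.
move=> T1; set W := trace h g; set W' := trace h' g' => sub adjp aW ua aW' bW vb bW' yW'.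
have [p0p pkp uqp] := p_facts; have [wp _ _] := ip.
suff: mu W' < mu W by rewrite ltnNge; case: M => _ /(_ h' g' T1) ->.
(* Vertices of [p] have at most two neighbours in the new trace, [u] and [v] trade [a] and [b] for
   [p0] and [pk], and all other old vertices gain no neighbour. *)
apply: mu_big; apply: (@leq_ltn_trans #|big W :\ y|); last first.
  by rewrite [X in _ < X](cardsD1 y) big_y.
apply/subset_leq_card/subsetP=> z zb; rewrite in_setD1; apply/andP; split.
  by apply: contraNneq yW' => <-.
move: zb; rewrite /big 2!in_set => /andP[zW' gt2].
have [zp|zp] := boolP (z \in p).
  exfalso; move: gt2; apply/negP; rewrite -leqNgt.
  have [z0|z0] := eqVneq z p0.
    have [|c cp [ic _]] := walk_next wp uqp zp; first by rewrite z0 p0_ne_pk.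
    apply: (@card_le2 _ _ u c) => d dW' zd.
    have [dp|dW] := sub d dW'.
      right; apply: (index_inj_in dp); have := p_adj zp dp zd.
      by rewrite ic z0 index_p0 => /orP[] /eqP; natlia.
    case: (adjp z d zp dW' dW zd) => [|e]; first by left.
    exfalso; have := p_after (c := d) zp; rewrite e vT -e zd z0 => /(_ isT isT) e'.
    by have := p0_ne_pk; rewrite e' eqxx.
  have [c cp [ic _]] := walk_prev wp uqp zp z0.
  have dz d : d \in W -> d \in W' -> adj z d -> d = v /\ z = pk.
    move=> dW dW' zd; case: (adjp z d zp dW' dW zd) => e.
      by have := p_before zp u_before; rewrite -e zd => /(_ isT) e'; rewrite e' eqxx in z0.
    by split=> //; apply: (p_after zp vT); rewrite -e.
  have [zk|zk] := eqVneq z pk.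
    apply: (@card_le2 _ _ v c) => d dW' zd; have [dp|dW] := sub d dW'; last by left; case: (dz d).
    right; apply: (index_inj_in dp); have := p_adj zp dp zd; have := p_le_pk dp; rewrite -zk.
    by move=> le /orP[] /eqP e; natlia.
  have [d dp [id_ _]] := walk_next wp uqp zp zk.
  apply: (@card_le2 _ _ c d) => e eW' ze; have [ep|eW] := sub e eW'; last first.
    by case: (dz e eW eW' ze) => _ e'; rewrite e' eqxx in zk.
  by have := p_adj zp ep ze => /orP[] /eqP e'; [right|left]; apply: (index_inj_in ep); natlia.
have zW : z \in W by case: (sub z zW') => // zp'; rewrite zp' in zp.
rewrite zW /= (leq_trans gt2) //.
have [eu|zu] := eqVneq z u.
  rewrite eu; apply: (@card_exchange _ _ _ a p0); first by rewrite in_nbr aW.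
  move=> c cW' uc; have [cp|cW] := sub c cW'.
    by left; apply: (p_before cp u_before); rewrite adjC.
  by right; split=> //; apply: contraNneq aW' => <-.
have [ev|zv] := eqVneq z v.
  rewrite ev; apply: (@card_exchange _ _ _ b pk); first by rewrite in_nbr bW.
  move=> c cW' vc; have [cp|cW] := sub c cW'.
    by left; apply: (p_after cp vT); rewrite adjC.
  by right; split=> //; apply: contraNneq bW' => <-.
apply/subset_leq_card/subsetP=> c; rewrite !in_nbr => /andP[cW' zc]; rewrite zc andbT.
case: (sub c cW') => // cp; rewrite adjC in zc.
by case: (adjp c z cp zW' zW zc) => e; [rewrite e eqxx in zu|rewrite e eqxx in zv].
Qed.

Lemma u_succ : exists a, [/\ a \in h, index a h = (index u h).+1 & adj u a].
Proof. by have [a ah [ia ua]] := walk_next (walk_h T) (uniq_h T) uh u_ne_t; exists a. Qed.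

(** Otherwise let [p] replace the part of [h] between [u] and [v]. This removes [y] from the trace,
    and apart from [u] and [v] the only remaining vertex that [p] could touch is [y']. *)
Lemma reroute_same_side : v \in h -> exists2 z, z \in p & adj z y'.
Proof.
move=> vh; have [/hasP[z zp zy']|/hasPn nm] := boolP (has (fun z => adj z y') p); first by exists z.
exfalso; have [yh yg y'g y'h yy'] := y_facts; have [p0p pkp uqp] := p_facts.
have [sh sh0] := s_h T; have [sg sg0] := s_h T'.
have uqh := uniq_h T; have wh := walk_h T.
have iv : index y h < index v h.
  case/orP: vT => /andP[// vg iv']; case: (both_ends T vh vg) => e.
    by rewrite e sg0 in iv'.
  by rewrite e; apply: (in_h_lt_t T yh yg).
have vs : v != s by apply: contraTneq iv => ->; rewrite sh0.
have [a [ah ia ua]] := u_succ; have [b bh [ib vb]] := walk_prev wh uqh vh vs.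
pose h' := take (index u h).+1 h ++ p ++ drop (index v h) h.
have in_h' z : (z \in h') = [|| (z \in h) && (index z h <= index u h), z \in p | (z \in h) && (index v h <= index z h)].
  rewrite !mem_cat in_drop_uniq //; case: (boolP (z \in h)) => [zh|zh]; first by rewrite in_take // ltnS.
  by rewrite [_ \in take _ _](contraNF _ zh) // => /mem_take.
have gap z : z \in h -> index u h < index z h < index v h -> z \notin trace h' g.
  move=> zh iz; rewrite in_trace in_h' zh (negPf (h_p zh)) /= !negb_or -!ltnNge.
  have /andP[-> ->] := iz; apply/negP=> zg; case: (both_ends T zh zg) => e; subst z.
    by rewrite sh0 in iz.
  by have := index_le_t T vh; move: iz; natlia.
have yW' : y \notin trace h' g by apply: gap; rewrite ?uy.
have T1 : twopaths h' g.
  have [_ wg _ ug [sH sG d]] := T; split=> //.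
  - apply: walk_cat (walk_take wh uh) _ up0.
    by have [wp _ _] := ip; apply: walk_cat wp (walk_drop wh vh) _; rewrite adjC.
  - rewrite !cat_uniq take_uniq // drop_uniq // uqp /= andbT; apply/andP; split; apply/hasPn=> z.
      rewrite mem_cat in_drop_uniq // => /orP[zp|/andP[zh iz]] /=.
        by apply: contra (p_hg zp).1 => /mem_take.
      by rewrite in_take // -leqNgt; natlia.
    by move/mem_drop => zh /=; apply: h_p.
  - split=> // z; rewrite in_h' => /or3P[/andP[+ _]|zp|/andP[+ _]]; try exact: sH; try exact: d.
      exact: pJ.
    by rewrite (negPf (p_hg zp).2).
have aW : a \in trace h g by rewrite in_trace ah.
have bW : b \in trace h g by rewrite in_trace bh.
apply: (@reroute_false h' g a b T1) => //.
- move=> z; rewrite !in_trace in_h' => /orP[/or3P[/andP[-> _]|->|/andP[-> _]]|->]; rewrite ?orbT; by [left|right].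
- move=> z c zp cW' cW zc.
  have [bc|nb] := boolP (before h g y y' c); first by left; apply: p_before_u zp bc zc.
  have [ac|na] := boolP (after h g y y' c); first by right; apply: p_after_v zp ac zc.
  exfalso; move: nb na; rewrite /before /after; move: cW; rewrite in_trace.
  have [ch1|ch1] := boolP (c \in h) => /=.
    move=> _; rewrite !negb_or -!leqNgt => /andP[l1 _] /andP[l2 _].
    have e : c = y by apply: (index_inj_in ch1); apply/eqP; rewrite eqn_leq l2.
    by rewrite e (negPf yW') in cW'.
  move=> cg; rewrite cg /= -!leqNgt => l1 l2.
  have e : c = y' by apply: (index_inj_in cg); apply/eqP; rewrite eqn_leq l2.
  by have := nm z zp; rewrite -e zc.
- by apply: gap; rewrite // ia leqnn /=; natlia.
- by apply: gap => //; rewrite -ib leqnn andbT; natlia.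
- by rewrite inE (negPf yW').
Qed.

(** The paths change over: [h] up to [u], then [p], then [g] from [v]; and [g] up to [y'], then [h]
    from [y]. By [mark_u] and [mark_v] there are vertices strictly between [u] and [y] and strictly
    between [y'] and [v]. They leave the trace and make up for the new neighbours of [u] and [v]. *)
Lemma reroute_other_side : v \in g -> v \notin h -> (forall z, z \in p -> ~~ adj z y) ->
  (forall z, z \in p -> ~~ adj z y') -> False.
Proof.
move=> vg vh ny ny'; have [yh yg y'g y'h yy'] := y_facts; have [p0p pkp uqp] := p_facts.
have nuy := mark_u vg vh; have nvy' := mark_v vg vh ny.
have [sh sh0] := s_h T; have [sg sg0] := s_h T'.
have [th _] := t_h T; have [tg _] := t_h T'.
have uqh := uniq_h T; have wh := walk_h T; have uqg := uniq_h T'; have wg := walk_h T'.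
have iv : index y' g < index v g by case/orP: vT => /andP[//]; rewrite (negPf vh).
have yt := in_h_lt_t T yh yg; have y't := in_h_lt_t T' y'g y'h; have vt := in_h_lt_t T' vg vh.
have vs : v != s by apply: contraTneq iv => ->; rewrite sg0.
have [a [ah ia ua]] := u_succ; have [b bg [ib vb]] := walk_prev wg uqg vg vs.
pose h' := take (index u h).+1 h ++ p ++ drop (index v g) g.
pose g' := take (index y' g).+1 g ++ drop (index y h) h.
have in_h' z : (z \in h') = [|| (z \in h) && (index z h <= index u h), z \in p | (z \in g) && (index v g <= index z g)].
  rewrite !mem_cat in_drop_uniq //; case: (boolP (z \in h)) => [zh|zh]; first by rewrite in_take // ltnS.
  by rewrite [_ \in take _ _](contraNF _ zh) // => /mem_take.
have in_g' z : (z \in g') = (z \in g) && (index z g <= index y' g) || (z \in h) && (index y h <= index z h).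
  rewrite mem_cat in_drop_uniq //; case: (boolP (z \in g)) => [zg|zg]; first by rewrite in_take // ltnS.
  by rewrite [_ \in take _ _](contraNF _ zg) // => /mem_take.
have gap_h z : z \in h -> index u h < index z h < index y h -> z \notin trace h' g'.
  move=> zh iz; have zg : z \notin g.
    apply/negP=> zg; case: (both_ends T zh zg) => e; subst z; first by rewrite sh0 in iz.
    by move: iz; natlia.
  rewrite in_trace in_h' in_g' zh (negPf (h_p zh)) (negPf zg) /= !orbF negb_or -!ltnNge.
  exact: iz.
have gap_g z : z \in g -> index y' g < index z g < index v g -> z \notin trace h' g'.
  move=> zg iz; have zh : z \notin h.
    apply/negP=> zh; case: (both_ends T zh zg) => e; subst z; first by rewrite sg0 in iz.
    by move: iz; natlia.
  rewrite in_trace in_h' in_g' zg (negPf (g_p zg)) (negPf zh) /= !orbF negb_or -!ltnNge andbC.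
  exact: iz.
have T1 : twopaths h' g'.
  have [_ _ _ _ [sH sG d]] := T; split.
  - apply: walk_cat (walk_take wh uh) _ up0.
    by have [wp _ _] := ip; apply: walk_cat wp (walk_drop wg vg) _; rewrite adjC.
  - by apply: walk_cat (walk_take wg y'g) (walk_drop wh yh) _; rewrite adjC.
  - rewrite !cat_uniq take_uniq // drop_uniq // uqp /= andbT; apply/andP; split; apply/hasPn=> z.
      rewrite mem_cat in_drop_uniq // => /orP[zp|/andP[zg iz]] /=.
        by apply: contra (p_hg zp).1 => /mem_take.
      apply/negP=> zt; have zh := mem_take zt; move: zt; rewrite in_take // => zt.
      case: (d z zh zg) => e; subst z; first by rewrite sg0 in iz; natlia.
      by natlia.
    by move/mem_drop => zg /=; apply: g_p.
  - rewrite cat_uniq take_uniq // drop_uniq // andbT /=; apply/hasPn=> z.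
    rewrite in_drop_uniq // => /andP[zh iz] /=; apply/negP=> zt.
    have zg := mem_take zt; move: zt; rewrite in_take // => zt.
    case: (d z zh zg) => e; subst z; first by rewrite sh0 in iz; natlia.
    by natlia.
  - split.
    + move=> z; rewrite in_h' => /or3P[/andP[+ _]|zp|/andP[+ _]]; try exact: sH; try exact: sG.
      exact: pJ.
    + by move=> z; rewrite in_g' => /orP[] /andP[+ _]; [exact: sG|exact: sH].
    + move=> z; rewrite in_h' in_g' => /or3P[/andP[z1 i1]|zp|/andP[z1 i1]] /orP[] /andP[z2 i2];
        try (by apply: d); try (by exfalso; natlia).
      * by rewrite (negPf (p_hg zp).2) in z2.
      * by rewrite (negPf (p_hg zp).1) in z2.
have aW : a \in trace h g by rewrite in_trace ah.
have bW : b \in trace h g by rewrite in_trace bg orbT.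
apply: (@reroute_false h' g' a b T1) => //.
- move=> z; rewrite !in_trace in_h' in_g'.
  case/orP=> [/or3P[/andP[-> _]|->|/andP[-> _]]|/orP[] /andP[-> _]]; rewrite ?orbT; by [left|right].
- move=> z c zp cW' cW zc.
  have [bc|nb] := boolP (before h g y y' c); first by left; apply: p_before_u zp bc zc.
  have [ac|na] := boolP (after h g y y' c); first by right; apply: p_after_v zp ac zc.
  exfalso; move: nb na; rewrite /before /after; move: cW; rewrite in_trace.
  have [ch1|ch1] := boolP (c \in h) => /=.
    move=> _; rewrite !negb_or -!leqNgt => /andP[l1 _] /andP[l2 _].
    have e : c = y by apply: (index_inj_in ch1); apply/eqP; rewrite eqn_leq l2.
    by have := ny z zp; rewrite -e zc.
  move=> cg; rewrite cg /= -!leqNgt => l1 l2.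
  have e : c = y' by apply: (index_inj_in cg); apply/eqP; rewrite eqn_leq l2.
  by have := ny' z zp; rewrite -e zc.
- apply: gap_h; rewrite // ia leqnn /= ltn_neqAle uy andbT.
  by apply: contra nuy => /eqP e; rewrite (adj_h M) // e eqxx.
- apply: gap_g => //; rewrite -ib leqnn andbT.
  have : (index y' g).+1 != index v g by apply: contra nvy' => /eqP e; rewrite (adj_h M') // e eqxx orbT.
  by move: ib iv; clear; lia.
(* In the new trace [y] keeps only [y'] and its successor on [h]: its predecessor is not [u] and has
   been dropped. *)
- rewrite /big in_set negb_and -leqNgt; apply/orP; right.
  have [_ ynt] := g_inner M yg.
  have [c cH [ic yc]] := walk_next wh uqh yh ynt.
  apply: (@card_le2 _ _ c y') => d dW' yd.
  have [dp|dp] := boolP (d \in p); first by have := ny d dp; rewrite adjC yd.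
  have [dg|dg] := boolP (d \in g); first by right; apply: (one_h M' yg (memh_nx T yh)).
  left; have dh : d \in h.
    by move: dW'; rewrite in_trace in_h' in_g' (negPf dp) (negPf dg) /= !orbF => /orP[] /andP[].
  apply: (index_inj_in dh); rewrite ic; have := yd; rewrite (adj_h M) // => /orP[/eqP //|/eqP e].
  exfalso; have [lt|le] := ltnP (index u h) (index d h).
    by have := gap_h d dh; rewrite lt dW' -e ltnSn => /(_ isT).
  have du : d = u by apply: (index_inj_in dh); natlia.
  by rewrite -du adjC yd in nuy.
Qed.

(** If [p] touches [y'], its first neighbour of [y] or [y'] yields a propeller. If not,
    [reroute_same_side] places [v] on [g] only; then a neighbour of [y] on [p] still yields a
    propeller, and without one the paths can be rerouted. *)
Lemma no_bridge : False.
Proof.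
have [yh yg y'g y'h yy'] := y_facts.
have [/hasP[q0 q0p q0y']|/hasPn ny'] := boolP (has (fun z => adj z y') p).
  pose P z := (z \in p) && adj z y'.
  have [|q /andP[qp qy'] min] := @arg_minnP _ q0 P (fun z => index z p); first by rewrite /P q0p.
  have [/hasP[z zp /andP[zy lt]]|/hasPn ny] := boolP (has (fun z => adj z y && (index z p < index q p)) p).
    apply: (mark_y _ zp zy); first by left; exists q.
    move=> w wp iw; apply/negP=> wy'; have := min w; rewrite /P wp wy' => /(_ isT).
    by natlia.
  by apply: (mark_y' qp qy') => z zp lt; have := ny z zp; rewrite lt andbT.
have vh : v \notin h.
  by apply/negP=> /reroute_same_side[z zp zy']; have := ny' z zp; rewrite zy'.
have vg : v \in g by case/orP: vT => /andP[]; rewrite ?(negPf vh).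
have [/hasP[q qp qy]|/hasPn ny] := boolP (has (fun z => adj z y) p).
  by apply: (mark_y _ qp qy); [right | move=> z zp _; apply: ny'].
exact: reroute_other_side.
Qed.

End Bridge.

Definition edge_cut := [exists y, exists y', [&& y \in J, y' \in J, adj y y', y != s & [&& y != t, y' != s, y' != t &
  ~~ link (J :\: [set y; y']) s t]]].

Lemma minimal_edge_cut h g : minimal h g -> edge_cut.
Proof.
move=> M; have T := proj1 M; have M' := minimal_sym M; have T' := proj1 M'.
have [sh sh0] := s_h T; have [sg sg0] := s_h T'.
have [th _] := t_h T; have [tg _] := t_h T'.
(* Without chords, a hole through [s] in the trace has to pass [t], and [x] is a center. *)
have [/existsP[y0 Py0]|/existsPn none] := boolP [exists c, exists d, chord h g c d]; last first.
  exfalso; have [a ah [ia sa]] := walk_next (walk_h T) (uniq_h T) sh st.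
  have [b bg [ib sb]] := walk_next (walk_h T') (uniq_h T') sg st.
  rewrite sh0 in ia; rewrite sg0 in ib.
  have at_ := next_s_not_t M ah ia; have bt := next_s_not_t M' bg ib.
  have as' : a != s by apply/eqP=> e; rewrite e sh0 in ia.
  have ag := inner_h M ah as' at_.
  pose X := trace h g :\ s.
  have inX z : (z \in X) = (z != s) && ((z \in h) || (z \in g)) by rewrite !inE.
  have h_gt0 z : z \in h -> 0 < index z h -> z \in X.
    by move=> zh iz; rewrite inX zh andbT; apply: contraTneq iz => ->; rewrite sh0.
  have g_gt0 z : z \in g -> 0 < index z g -> z \in X.
    by move=> zg iz; rewrite inX zg orbT andbT; apply: contraTneq iz => ->; rewrite sg0.
  have [||||||||R [RX cR aR bR hR]] := @hole_through G X s a b => //.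
  - by rewrite inX eqxx.
  - by apply: h_gt0; rewrite // ia.
  - by apply: g_gt0; rewrite // ib.
  - by apply: contraNneq ag => ->.
  - move=> z; rewrite inX => /andP[_ /orP[zh|zg]] sz.
      left; apply: (index_inj_in zh); rewrite ia; move: sz; rewrite (adj_h M) // sh0.
      by move=> /orP[/eqP|].
    right; apply: (index_inj_in zg); rewrite ib; move: sz; rewrite (adj_h M') // sg0.
    by move=> /orP[/eqP|].
  - apply: (@link_trans _ _ t).
      by apply: (link_suffix T) => // w wh iw; apply: h_gt0; rewrite // (leq_trans _ iw) ?ia.
    by rewrite link_sym; apply: (link_suffix T') => // w wg iw; apply: g_gt0; rewrite // (leq_trans _ iw) ?ib.
  have tR : t \in R.
    apply: (conn_cut (K := [set z in h | z \notin g]) cR RX aR bR); rewrite ?inE ?ah ?bg ?andbF //.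
    move=> k z; rewrite inE => /andP[kh kg] _ zX zK kz.
    have zs : z != s by move: zX; rewrite inX => /andP[].
    have [zg|zg] := boolP (z \in g); last first.
      by move: zX zK; rewrite inX inE (negPf zg) orbF andbT => /andP[_ ->].
    have [zh|zh] := boolP (z \in h).
      by case: (both_ends T zh zg) => // e; rewrite e eqxx in zs.
    have /existsPn/(_ z) := none k; by rewrite /chord kh kg zg zh kz.
  have e : s = t.
    apply: (PF hR (c := x)); rewrite ?inE ?eqxx ?tR ?orbT // negb_or.
    rewrite (contraNneq _ xJ) => [|->]; last exact: (memh_J T sh).
    apply: contra xJ => /(subsetP RX); rewrite inX => /andP[_ /orP[]]; [exact: (memh_J T)|exact: (memh_J T')].
  by have := st; rewrite e eqxx.
case: (@arg_minnP _ y0 (fun c => [exists d, chord h g c d]) (fun c => index c h) Py0) => y /existsP[y' ch] min.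
(* The chord that comes first on [h] also comes first on [g], by [chord_mono]. *)
have first c c' : chord h g c c' -> (index y h <= index c h) && (index y' g <= index c' g).
  move=> cc'; have le : index y h <= index c h by apply: min; apply/existsP; exists c'.
  rewrite le /=; have /and5P[yh yg y'g y'h yy'] := ch; have /and5P[cH cg c'g c'h ac] := cc'.
  rewrite leq_eqVlt in le; case/orP: le => [/eqP e|lt]; last exact/ltnW/(chord_mono M ch cc').
  have ec := index_inj_in yh e; subst c.
  by rewrite (one_h M' yg (memh_nx T yh) c'g y'g ac yy').
have /and5P[yh yg y'g y'h yy'] := ch.
have [ys yt] := g_inner M yg; have [y's y't] := g_inner M' y'h.
apply/existsP; exists y; apply/existsP; exists y'; rewrite (memh_J T yh) (memh_J T' y'g) yy' ys yt y's y't /=.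
apply/negP=> lst.
pose W := trace h g; pose S : {set G} := [set c | before h g y y' c]; pose Q : {set G} := [set c | after h g y y' c].
pose U : {set G} := [set z | [exists c in S, adj z c]]; pose V : {set G} := [set z | [exists c in Q, adj z c]].
have y'0 := in_h_gt0 T' y'g y'h; have y0' := in_h_gt0 T yh yg.
have ytl := in_h_lt_t T yh yg; have y'tl := in_h_lt_t T' y'g y'h.
have sS : s \in S by rewrite inE /before sh sh0 y0'.
have tQ : t \in Q by rewrite inE /after th ytl.
have SW z : z \in S -> z \in W by rewrite inE in_trace => /orP[] /andP[-> _]; rewrite ?orbT.
have QW z : z \in Q -> z \in W by rewrite inE in_trace => /orP[] /andP[-> _]; rewrite ?orbT.
have SQ z : z \in S -> z \in Q -> False.
  rewrite !inE /before /after => /orP[] /andP[z1 i1] /orP[] /andP[z2 i2]; try by natlia.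
    by case: (both_ends T z1 z2) => e; subst z; rewrite ?sg0 in i2; natlia.
  by case: (both_ends T z2 z1) => e; subst z; rewrite ?sh0 in i2; natlia.
have Wcases z : z \in W -> [\/ z \in S, z \in Q, z = y | z = y'].
  rewrite in_trace !inE /before /after; case/orP=> zz.
    case: (ltngtP (index z h) (index y h)) => [lt|lt|e]; first by apply: Or41; rewrite zz.
      by apply: Or42; rewrite zz.
    by apply: Or43; apply: (index_inj_in zz).
  case: (ltngtP (index z g) (index y' g)) => [lt|lt|e]; first by apply: Or41; rewrite zz orbT.
    by apply: Or42; rewrite zz orbT.
  by apply: Or44; apply: (index_inj_in zz).
(* Inside the trace the only passages from [S] to [Q] are [y] and [y']: an edge between the paths
   away from their common ends is a chord, and no chord has an end before the first one. *)
have nSQ c d : c \in S -> d \in Q -> adj c d -> False.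
  move=> cS dQ cd; have := cS; have := dQ; rewrite !inE /before /after.
  have inner_c : c \in h -> c \in g -> c = s.
    move=> c1 c2; case: (both_ends T c1 c2) => // e; subst c.
    by case: (SQ _ cS tQ).
  have inner_d : d \in h -> d \in g -> d = t.
    move=> c1 c2; case: (both_ends T c1 c2) => // e; subst d.
    by case: (SQ _ sS dQ).
  case/orP=> /andP[d1 i1] /orP[] /andP[c1 i2].
  - by move: cd; rewrite (adj_h M) // => /orP[] /eqP; natlia.
  - have [ch'|ch'] := boolP (c \in h).
      have e := inner_c ch' c1; subst c.
      by move: cd; rewrite (adj_h M) // sh0 => /orP[] /eqP; natlia.
    have [dg|dg] := boolP (d \in g).
      have e := inner_d d1 dg; subst d.
      by move: cd; rewrite (adj_h M') // => /orP[] /eqP; natlia.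
    have := first d c; rewrite /chord d1 dg c1 ch' adjC cd => /(_ isT) /andP[_].
    by natlia.
  - have [cg'|cg'] := boolP (c \in g).
      have e := inner_c c1 cg'; subst c.
      by move: cd; rewrite (adj_h M') // sg0 => /orP[] /eqP; natlia.
    have [dh|dh] := boolP (d \in h).
      have e := inner_d dh d1; subst d.
      by move: cd; rewrite (adj_h M) // => /orP[] /eqP; natlia.
    have := first c d; rewrite /chord c1 cg' d1 dh cd => /(_ isT) /andP[+ _].
    by natlia.
  - by move: cd; rewrite (adj_h M') // => /orP[] /eqP; natlia.
have [a [b [aJ aU bV lab]]] : exists a b, [/\ a \in J :\: W, a \in U, b \in V & link (J :\: W) a b].
  (* [S] together with the components of [J :\: W] that touch it. If none of these touches [Q], the
     set is closed under adjacency in [J] without [y] and [y'], so it would separate [s] from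
     [t]. *)
  pose A := S :|: [set z in J :\: W | [exists a in (J :\: W) :&: U, link (J :\: W) a z]].
  have [/exists_inP[b bA bV]|/exists_inPn no] := boolP [exists b in A :\: S, b \in V].
    move: bA; rewrite in_setD in_setU => /andP[/negPf-> /=]; rewrite inE => /andP[_ /exists_inP[a]].
    by rewrite in_setI => /andP[aJ aU] lab; exists a, b.
  exfalso; have: t \in A.
    apply: link_closed lst _; last by rewrite inE sS.
    move=> c d cA _; rewrite inE in_set2 negb_or => /andP[/andP[dy dy'] dJ] cd.
    have [dS|dS] := boolP (d \in S); first by rewrite inE dS.
    have [dW|dW] := boolP (d \in W).
      case: (Wcases d dW) => [|dQ|e|e]; last 2 first.
      - by rewrite e eqxx in dy.
      - by rewrite e eqxx in dy'.
      - by rewrite (negPf dS).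
      exfalso; have [cS|cS] := boolP (c \in S); first exact: nSQ cS dQ cd.
      have := no c; rewrite in_setD cS cA => /(_ isT)/negP; apply.
      by rewrite inE; apply/exists_inP; exists d.
    have dJW : d \in J :\: W by rewrite inE dW.
    rewrite in_setU; apply/orP; right; rewrite inE dJW /=.
    move: cA; rewrite in_setU => /orP[cS|].
      apply/exists_inP; exists d; last exact: link0.
      by rewrite in_setI dJW inE; apply/exists_inP; exists c; rewrite // adjC.
    rewrite inE => /andP[cJ /exists_inP[a aa lac]]; apply/exists_inP; exists a => //.
    by apply: link_trans lac _; apply: link1.
  rewrite in_setU => /orP[tS|]; first exact: SQ tS tQ.
  by rewrite !inE th.
have [p0 [pk [p [ip pJW p0U pkV hp]]]] := ipath_shortest lab aJ aU bV.
have pJ : {subset p <= J} by move=> z /pJW; rewrite inE => /andP[].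
have pW z : z \in p -> z \notin trace h g by move/pJW; rewrite inE => /andP[].
have p_before z c : z \in p -> before h g y y' c -> adj z c -> z = p0.
  move=> zp cb zc; apply: (hp z zp).1; rewrite inE; apply/exists_inP; exists c => //; by rewrite inE.
have p_after z c : z \in p -> after h g y y' c -> adj z c -> z = pk.
  move=> zp cb zc; apply: (hp z zp).2; rewrite inE; apply/exists_inP; exists c => //; by rewrite inE.
move: p0U pkV; rewrite !inE => /exists_inP[u uS p0u] /exists_inP[v vQ pkv].
rewrite inE in uS; rewrite inE in vQ.
rewrite adjC in p0u; rewrite adjC in pkv.
have befC c : before g h y' y c = before h g y y' c by rewrite /before orbC.
have aftC c : after g h y' y c = after h g y y' c by rewrite /after orbC.
(* The bridge lemmas assume that [u] lies on [h]; in the other case the two paths and the ends of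
   the chord are exchanged. *)
case/orP: (uS) => /andP[uu iu].
  exact: (no_bridge M ch first ip pJ pW p_before p_after uu iu p0u vQ pkv).
apply: (@no_bridge g h p y' y p0 pk u v M' _ _ ip pJ _ _ _ uu iu p0u _ pkv).
- by rewrite -chord_sym.
- by move=> c c'; rewrite -chord_sym => /first; rewrite andbC.
- by move=> z /pW; rewrite trace_sym.
- by move=> z c; rewrite befC; apply: p_before.
- by move=> z c; rewrite aftC; apply: p_after.
- by rewrite aftC.
Qed.

Lemma twopaths_edge_cut h g : twopaths h g -> edge_cut.
Proof.
have [n] := ubnP (mu (trace h g)); elim: n h g => // n IH h g le T.
apply: contraT => no; case/negP: (no).
apply: (@minimal_edge_cut h g); split=> // h' g' T'; rewrite leqNgt; apply/negP=> lt.
by case/negP: no; apply: (IH h' g') => //; apply: leq_trans lt _.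
Qed.

End Cut.

(** * Two disjoint paths and cutsets of size two *)

Section TwoPaths.
Variable G : sgraph.
Implicit Types (X Y A B C J : {set G}) (a b c d u v w x y z s t : G).

(** The induction step of Menger's theorem for two paths. One path is prolonged by the edge [z z'].
    The other is followed up to [z'] itself, or up to the vertex [d] where a path from [z'] that
    avoids [z] first meets the trace. *)
Lemma twopaths_step J s z z' h g : twoconn J -> twopaths J s z h g -> s \in J -> z' \in J -> adj z z' ->
  s != z -> z' != s -> exists h' g', twopaths J s z' h' g'.
Proof.
move=> J2 + sJ z'J zz' sz z's.
(* The paths share only [s] and [z], so [z'] lies on at most one of them. *)
wlog away : h g / z' \notin g.
  move=> W T; have [z'g|z'g] := boolP (z' \in g); last exact: (W h g).
  apply: (W g h); last exact: twopaths_sym.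
  apply/negP=> z'h; case: (both_ends T z'h z'g) => e; first by rewrite e eqxx in z's.
  by rewrite e adjxx in zz'.
have ext k l : walk s z k -> uniq k -> {subset k <= J} -> z' \notin k -> walk s z' l -> uniq l ->
    {subset l <= J} -> (forall e, e \in l -> e \in k -> e = s) -> exists h' g', twopaths J s z' h' g'.
  move=> wk uk kJ z'k wl ul lJ dis; exists l, (k ++ [:: z']); split=> //.
  - by apply: walk_cat wk _ zz'; rewrite /= !eqxx.
  - by rewrite cat_uniq uk /= orbF z'k.
  - split=> // e; first by rewrite mem_cat inE => /orP[/kJ//|/eqP->].
    by move=> el; rewrite mem_cat inE => /orP[/(dis e el)|/eqP]; [left|right].
move=> T; have [wh wg uh ug [hJ gJ dis]] := T.
have before_z k d : walk s z k -> uniq k -> d \in k -> d != z -> z \notin take (index d k).+1 k.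
  move=> wk uk dk dz; have [zk iz] := walk_last wk uk; rewrite in_take // -leqNgt.
  have := index_lt dk; rewrite -iz ltnS leq_eqVlt => /orP[/eqP/(index_inj_in dk) e|//].
  by rewrite e eqxx in dz.
have [z'h|z'h] := boolP (z' \in h).
  apply: (ext g (take (index z' h).+1 h)) => //.
  - exact: walk_take wh z'h.
  - exact: take_uniq.
  - by move=> e /mem_take/hJ.
  - move=> e el eg; case: (dis e (mem_take el) eg) => // ez; subst e.
    by have := before_z h z' wh uh z'h; rewrite el eq_sym (adj_neq zz') => /(_ isT).
have sJz : s \in J :\ z by rewrite !inE sz.
have z'Jz : z' \in J :\ z by rewrite !inE z'J eq_sym adj_neq.
have [sh _] := walk_first wh.
have [|| c [d [cA dA cJ dJ [cd lc]]]] := @link_exit G _ (~: trace h g) z' s (J2.2 z _ _ z'Jz sJz).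
- by rewrite in_setC in_trace negb_or z'h.
- by rewrite in_setC in_trace sh.
have z'Y : z' \in (J :\ z) :&: ~: trace h g by rewrite in_setI z'Jz in_setC in_trace negb_or z'h.
have [||c0 [d0 [q [[wq uq _] sq /set1P e1 /set1P e2 _]]]] :=
  ipath_shortest (U := [set z']) (V := [set c]) lc z'Y; rewrite ?inE //; subst c0 d0.
have qout e : e \in q -> [/\ e \in J, e \notin h & e \notin g].
  by move/sq; rewrite in_setI in_setC in_trace in_setD1 negb_or => /andP[/andP[_ ->] /andP[-> ->]].
have finish k l : walk s z k -> uniq k -> {subset k <= J} -> walk s z l -> uniq l -> {subset l <= J} ->
    z' \notin l -> (forall e, e \in k -> e \in l -> e = s \/ e = z) ->
    (forall e, e \in q -> [/\ e \in J, e \notin k & e \notin l]) -> d \in k ->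
    exists h' g', twopaths J s z' h' g'.
  move=> wk uk kJ wl ul lJ z'l dkl qkl dk.
  have dz : d != z by move: dJ; rewrite !inE => /andP[].
  apply: (ext l (take (index d k).+1 k ++ rev q)) => //.
  - by apply: walk_cat (walk_take wk dk) (walk_rev wq) _; rewrite adjC.
  - rewrite cat_uniq take_uniq // rev_uniq uq andbT; apply/hasPn=> e.
    by rewrite mem_rev => /qkl[_ ek _]; apply: contra ek => /mem_take.
  - by move=> e; rewrite mem_cat mem_rev => /orP[/mem_take/kJ|/qkl[]].
  - move=> e; rewrite mem_cat mem_rev => /orP[et el|/qkl[_ _ /negPf->] //].
    case: (dkl e (mem_take et) el) => // ez; subst e.
    by have := before_z k d wk uk dk dz; rewrite et.
move: dA; rewrite in_setC in_trace negbK => /orP[dh|dg].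
  exact: (finish h g).
apply: (finish g h) => // e; first by move=> eg eh; apply: dis.
by case/qout.
Qed.

Lemma twoconn_twopaths J s t : twoconn J -> s \in J -> t \in J -> s != t ->
  exists h g, twopaths J s t h g.
Proof.
move=> J2 sJ tJ; have /connectP[p] := twoconn_conn J2 sJ tJ.
elim/last_ind: p t {tJ} => [|p z IH] t /=; first by move=> _ ->; rewrite eqxx.
rewrite rcons_path last_rcons => /andP[pp /and3P[lJ zJ lz]] -> sz.
have [e|ne] := eqVneq s (last s p); last first.
  have [h [g T]] := IH _ pp erefl ne; apply: twopaths_step J2 T sJ zJ lz ne _.
  by rewrite eq_sym.
rewrite -e in lz; exists [:: s; z], [:: s; z].
have sub : {subset [:: s; z] <= J} by move=> y; rewrite !inE => /orP[] /eqP->.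
have uq : uniq [:: s; z] by rewrite /= inE sz.
split=> //; try by rewrite /= eqxx lz eqxx.
by split=> // y; rewrite !inE => /orP[] /eqP->; [left|right].
Qed.

(** The last condition makes [A] a union of components of [X] without [a] and [b]. Neither side has
    to be connected, and both may be empty. *)
Definition cutpair X A a b :=
  [/\ a \in X, b \in X, a != b, A \subset X :\: [set a; b] &
   forall c d, c \in A -> d \in X -> adj c d -> [\/ d \in A, d = a | d = b]].

Definition far X A a b : {set G} := X :\: (A :|: [set a; b]).

Lemma in_far X A a b z : (z \in far X A a b) = [&& z \in X, z \notin A, z != a & z != b].
Proof. by rewrite !inE !negb_or andbC. Qed.

Lemma cutpairP X A a b : cutpair X A a b -> [/\ {subset A <= X}, a \notin A, b \notin A,
  (forall z, z \in X -> [\/ z \in A, z \in far X A a b, z = a | z = b]) &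
  forall c d, c \in A -> d \in far X A a b -> ~~ adj c d].
Proof.
case=> aX bX ab sA hA; have inA z : z \in A -> [/\ z \in X, z != a & z != b].
  by move/(subsetP sA); rewrite !inE negb_or => /andP[/andP[]].
split=> [z /inA[]//||||].
- by apply/negP=> /inA[_]; rewrite eqxx.
- by apply/negP=> /inA[_ _]; rewrite eqxx.
- move=> z zX; have [zA|zA] := boolP (z \in A); first exact: Or41.
  have [->|za] := eqVneq z a; first exact: Or43.
  have [->|zb] := eqVneq z b; first exact: Or44.
  by apply: Or42; rewrite in_far zX zA za zb.
- move=> c d cA; rewrite in_far => /and4P[dX dA da db]; apply/negP=> cd.
  by case: (hA c d cA dX cd) => [|/eqP|/eqP]; [apply/negP|apply/negP|apply/negP].
Qed.

Lemma cutpair_far X A a b : cutpair X A a b -> cutpair X (far X A a b) a b.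
Proof.
move=> C; have [sA aA bA cs no] := cutpairP C; have [aX bX ab _ _] := C; split=> //.
  by apply/subsetP=> z; rewrite in_far !inE negb_or => /and4P[-> _ -> ->].
move=> c d cB dX cd; case: (cs d dX) => [dA|dB|->|->]; [|exact: Or31|exact: Or32|exact: Or33].
by have := no d c dA cB; rewrite adjC cd.
Qed.

Lemma far_far X A a b : cutpair X A a b -> far X (far X A a b) a b = A.
Proof.
move=> C; have [sA aA bA cs no] := cutpairP C; apply/setP=> z; rewrite in_far in_far.
have [zA|zA] := boolP (z \in A); rewrite /= ?andbF ?andbT.
  by rewrite (sA z zA) /= (contraNneq _ aA) => [|<- //]; rewrite (contraNneq _ bA) => [|<- //].
by case: (z \in X) => //=; case: (z != a) => //=; rewrite andNb.
Qed.

(** [X] without [v] is connected, so [z] reaches a vertex of [[set a; b]] other than [v], and a walk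
    can leave [A] only there. *)
Lemma cut_exit X A a b z v : twoconn X -> cutpair X A a b -> z \in A -> z != v ->
  exists e c, [/\ e \in [set a; b], e != v, c \in A, adj c e & link (A :\ v) z c].
Proof.
move=> X2 C zA zv; have [sA aA bA cs no] := cutpairP C; have [aX bX ab _ hA] := C.
have [e [eS ev eA eX]] : exists e, [/\ e \in [set a; b], e != v, e \notin A & e \in X].
  have [av|av] := eqVneq a v; last by exists a; rewrite !inE eqxx.
  by exists b; rewrite !inE eqxx orbT -av eq_sym.
have zX : z \in X :\ v by rewrite !inE zv sA.
have eXv : e \in X :\ v by rewrite !inE ev eX.
have [c [d [cA dA cX dX [cd lc]]]] := link_exit (X2.2 v _ _ zX eXv) zA eA.
move: dX; rewrite in_setD1 => /andP[dv dX].
exists d, c; split=> //.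
  by case: (hA c d cA dX cd) => [dA'|->|->]; rewrite ?inE ?eqxx ?orbT //; rewrite dA' in dA.
by apply: linkS lc; apply/subsetP=> w; rewrite !inE => /andP[/andP[-> _] ->].
Qed.

(** [Q] is a shortest path through the far side from the neighbours of [a] to those of [b]; it may
    be a single vertex. Only its ends see [a] and [b], so all its vertices get degree 2. *)
Lemma block X A a b : twoconn X -> cutpair X A a b -> A != set0 -> far X A a b != set0 ->
  exists Q : {set G}, let X' := A :|: [set a; b] :|: Q in
  [/\ Q \subset far X A a b, twoconn X', Q \subset deg2 X', conn Q &
   forall e, e \in [set a; b] -> exists2 q, q \in Q & adj e q].
Proof.
move=> X2 C /set0Pn[z0 z0A] /set0Pn[b0 b0B]; have C' := cutpair_far C.
have [sA aA bA cs no] := cutpairP C; have [aX bX ab _ hA] := C.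
have [sB aB bB _ _] := cutpairP C'; set B := far X A a b in b0B C' sB aB bB cs no *.
have reach e f : e \in [set a; b] -> f \in [set a; b] -> e != f -> exists c, [/\ c \in B, adj c e & link B b0 c].
  move=> eS fS ef; have fB : f \notin B by move: fS; rewrite !in_set2 => /orP[] /eqP->.
  have b0f : b0 != f by apply: contraNneq fB => <-.
  have [e' [c [e'S e'f cB ce' lc]]] := cut_exit X2 C' b0B b0f.
  have -> : e = e'.
    move: eS fS e'S ef e'f; rewrite !in_set2 => /orP[] /eqP-> /orP[] /eqP-> /orP[] /eqP-> //; by rewrite eqxx.
  by exists c; split=> //; apply: linkS lc; apply: subsetDl.
have aS : a \in [set a; b] by rewrite !inE eqxx.
have bS : b \in [set a; b] by rewrite !inE eqxx orbT.
have [c [cB ca lc]] := reach a b aS bS ab.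
have [d [dB db ld]] : exists d, [/\ d \in B, adj d b & link B b0 d] by apply: (reach b a); rewrite // eq_sym.
have lcd : link B c d by apply: link_trans ld; rewrite link_sym.
have [||q0 [qn [q [iq sq q0U qnV hq]]]] := ipath_shortest (U := nbr B a) (V := nbr B b) lcd cB;
  rewrite ?in_nbr ?cB ?dB 1?adjC //.
move: q0U qnV; rewrite !in_nbr => /andP[q0B aq0] /andP[qnB bqn].
have [wq uq _] := iq; have [q0q i0] := walk_first wq; have [qnq iqn] := walk_last wq uq.
have q_a z : z \in q -> adj z a -> z = q0.
  by move=> zq za; apply: (hq z zq).1; rewrite in_nbr sq // adjC.
have q_b z : z \in q -> adj z b -> z = qn.
  by move=> zq zb; apply: (hq z zq).2; rewrite in_nbr sq // adjC.
pose Q : {set G} := [set z in q]; exists Q => X'.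
have inX' z : (z \in X') = [|| z \in A, z == a, z == b | z \in q] by rewrite !inE -!orbA.
have nA z w : z \in q -> w \in A -> ~~ adj z w.
  by move=> /sq zB wA; rewrite adjC; apply: no.
have qX' z : z \in q -> z \in X' by move=> zq; rewrite inX' zq !orbT.
have aX' : a \in X' by rewrite inX' eqxx orbT.
have bX' : b \in X' by rewrite inX' eqxx !orbT.
have qa z : z \in q -> z != a by move=> /sq zB; apply: contraNneq aB => <-.
have qb z : z \in q -> z != b by move=> /sq zB; apply: contraNneq bB => <-.
have qA z : z \in q -> z \notin A.
  by move=> /sq; rewrite in_far => /and4P[].
have cases z w : z \in q -> w \in X' -> adj z w -> [\/ w = a /\ z = q0, w = b /\ z = qn |
    w \in q /\ (((index z q).+1 == index w q) || ((index w q).+1 == index z q))].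
  move=> zq; rewrite inX' => /or4P[wA|/eqP->|/eqP->|wq'] zw.
  - by have := nA z w zq wA; rewrite zw.
  - by apply: Or31; split=> //; apply: q_a.
  - by apply: Or32; split=> //; apply: q_b.
  - by apply: Or33; rewrite -(ipath_adj iq).
have deg z : z \in q -> #|nbr X' z| = 2.
  move=> zq; have za := qa z zq; have zb := qb z zq.
  have [e0|n0] := eqVneq z q0; have [en|nn] := eqVneq z qn.
  - apply: (card_nbr2 aX' bX') => //; rewrite ?e0 1?adjC //; first by rewrite -e0 en.
    move=> w wX' zw; rewrite -e0 in zw; case: (cases z w zq wX' zw) => [[]|[]|]; try by [left|right].
    case=> wq'; have := index_lt wq'; have iz : index z q = 0 by rewrite e0.
    by move: iqn; rewrite -en iz; clear; lia.
  - have [w wq' [iw zw]] := walk_next wq uq zq nn.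
    apply: (card_nbr2 aX' (qX' w wq')) => //; first by rewrite e0 adjC.
      by rewrite eq_sym qa.
    move=> v vX' zv; case: (cases z v zq vX' zv) => [[]|[_ e]|[vq iv]]; [by left|by rewrite e eqxx in nn|].
    right; apply: (index_inj_in vq); rewrite iw e0 i0 in iv *.
    by case/orP: iv => /eqP.
  - have [w wq' [iw zw]] := walk_prev wq uq zq n0.
    apply: (card_nbr2 bX' (qX' w wq')) => //; first by rewrite en adjC.
      by rewrite eq_sym qb.
    move=> v vX' zv; case: (cases z v zq vX' zv) => [[_ e]|[]|[vq iv]]; [by rewrite e eqxx in n0|by left|].
    right; apply: (index_inj_in vq); have := index_lt vq; move: iw iv iqn; rewrite en; clear; lia.
  - have [w wq' [iw zw]] := walk_prev wq uq zq n0; have [v vq [iv zv]] := walk_next wq uq zq nn.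
    apply: (card_nbr2 (qX' w wq') (qX' v vq)) => //.
      by apply/eqP=> e; subst v; natlia.
    move=> y yX' zy; case: (cases z y zq yX' zy) => [[_ e]|[_ e]|[yq iy]].
    + by rewrite e eqxx in n0.
    + by rewrite e eqxx in nn.
    + by case/orP: iy => /eqP e; [right|left]; apply: (index_inj_in yq); natlia.
split=> //.
- by apply/subsetP=> z; rewrite inE => /sq.
- split; first by apply: (card_ge3 aX' bX' (qX' q0 q0q) ab); rewrite eq_sym ?qa ?qb.
  move=> v; have exitA z : z \in A -> z != v -> exists2 e, e \in [set a; b] & e != v /\ link (X' :\ v) z e.
    move=> zA zv; have [e [k [eS ev kA ke lk]]] := cut_exit X2 C zA zv; exists e => //; split=> //.
    have sAv : A :\ v \subset X' :\ v.
      by apply/subsetP=> w; rewrite !in_setD1 inX' => /andP[-> ->].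
    apply: link_trans (linkS sAv lk) _; apply: link1 => //.
      by apply: (link_in (linkS sAv lk)); rewrite in_setD1 zv inX' zA.
    by rewrite in_setD1 ev inX'; move: eS; rewrite in_set2 => /orP[->|->]; rewrite ?orbT.
  (* If [v] lies on [Q], then [a] and [b] are still linked through [A], and the remaining pieces of
     [Q] hang on them. Otherwise [Q] is intact and links everything. *)
  have [vq|vq] := boolP (v \in q).
    have av : a != v by rewrite eq_sym qa.
    have bv : b != v by rewrite eq_sym qb.
    have lab : link (X' :\ v) a b.
      have lz f e : f \in [set a; b] -> e \in [set a; b] -> e != f -> link (X' :\ v) z0 e.
        move=> fS eS ef; have z0f : z0 != f by move: fS; rewrite !in_set2 => /orP[] /eqP->;
          [apply: contraNneq aA => <-|apply: contraNneq bA => <-].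
        have [e' [k [e'S e'f kA ke' lk]]] := cut_exit X2 C z0A z0f.
        have -> : e = e'.
          move: eS fS e'S ef e'f; rewrite !in_set2 => /orP[] /eqP-> /orP[] /eqP-> /orP[] /eqP-> //; by rewrite eqxx.
        have sAv : A :\ f \subset X' :\ v.
          apply/subsetP=> w; rewrite !in_setD1 inX' => /andP[_ wA]; rewrite wA andbT.
          by apply: contraTneq wA => ->; apply: qA.
        apply: link_trans (linkS sAv lk) _; apply: link1 => //.
          by apply: (link_in (linkS sAv lk)); rewrite in_setD1 inX' z0A andbT; apply: contraTneq z0A => ->; apply: qA.
        by rewrite in_setD1 inX'; move: e'S; rewrite !in_set2 => /orP[] /eqP->; rewrite eqxx ?orbT andbT.
      by apply: link_trans (lz a b aS bS _); rewrite 1?link_sym ?(lz b a) // eq_sym.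
    apply: (@conn_hub _ _ a) => z; rewrite in_setD1 inX' => /andP[zv /or4P[zA|/eqP->|/eqP->|zq]].
    + have [e + [ev lz]] := exitA z zA zv; rewrite in_set2 => /orP[] /eqP ee; subst e; first by rewrite link_sym.
      by apply: link_trans lab _; rewrite link_sym.
    + exact: link0.
    + exact: lab.
    + have [lt|gt|e] := ltngtP (index z q) (index v q).
      * apply: (@link_trans _ _ q0); first by apply: link1; rewrite ?in_setD1 ?aX' ?qX' ?andbT //;
          apply/eqP=> e; rewrite -e i0 in lt.
        apply: (walk_segment wq uq) => // [|w wq' iw]; first by rewrite i0.
        rewrite in_setD1 qX' // andbT; apply/eqP=> e; rewrite e in iw; move: iw lt; clear; lia.
      * apply: link_trans lab _; rewrite link_sym; apply: (@link_trans _ _ qn); last first.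
          apply: link1; rewrite 1?adjC ?in_setD1 ?bX' ?qX' ?andbT //.
          by apply/eqP=> e; have := index_lt zq; move: gt; rewrite -e -iqn; clear; lia.
        apply: (walk_segment wq uq) => // [|w wq' iw]; first by have := index_lt zq; rewrite -iqn.
        rewrite in_setD1 qX' // andbT; apply/eqP=> e; rewrite e in iw; move: iw gt; clear; lia.
      * by have e' := index_inj_in zq e; rewrite e' eqxx in zv.
  have sQ z : z \in q -> z \in X' :\ v.
    by move=> zq; rewrite in_setD1 qX' // andbT; apply: contraNneq vq => <-.
  have lQ z : z \in q -> link (X' :\ v) q0 z by apply: walk_link wq _.
  have lS e : e \in [set a; b] -> e != v -> link (X' :\ v) q0 e.
    rewrite !in_set2 => /orP[] /eqP-> ev.
      by apply: link1; [exact: sQ | rewrite in_setD1 ev | rewrite adjC].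
    by apply: link_trans (lQ qn qnq) _; apply: link1; [exact: sQ | rewrite in_setD1 ev | rewrite adjC].
  apply: (@conn_hub _ _ q0) => z; rewrite in_setD1 inX' => /andP[zv /or4P[zA|/eqP ez|/eqP ez|]].
  + have [e eS [ev lz]] := exitA z zA zv; apply: link_trans (lS e eS ev) _; by rewrite link_sym.
  + by rewrite ez in zv *; apply: lS.
  + by rewrite ez in zv *; apply: lS.
  + exact: lQ.
- by apply/subsetP=> z; rewrite inE => zq; rewrite /deg2 in_set qX' // deg.
- exact: walk_conn wq.
- by move=> e; rewrite !in_set2 => /orP[] /eqP->; [exists q0|exists qn]; rewrite ?inE.
Qed.

End TwoPaths.

(** * The minimal counterexample *)

Section Counterexample.
Variable G : sgraph.
Implicit Types (A B C Q : {set G}) (a b c d u v w x y z s t : G).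

Lemma deg2P (X : {set G}) v : reflect (v \in X /\ #|nbr X v| = 2) (v \in deg2 X).
Proof. by rewrite inE; apply: (iffP andP) => -[vX /eqP]. Qed.

Lemma deg2_two (X : {set G}) v a b d : v \in deg2 X -> a \in X -> b \in X -> adj v a -> adj v b -> a != b ->
  d \in X -> adj v d -> d = a \/ d = b.
Proof.
move=> /deg2P[_ n2] aX bX va vb ab dX vd.
have [//|da] := eqVneq d a; first by left.
have [//|db] := eqVneq d b; first by right.
have : 2 < #|nbr X v| by apply: (@card_ge3 _ _ d a b); rewrite ?in_nbr ?dX ?aX ?bX.
by rewrite n2.
Qed.

(** [Q] is connected and of degree 2, so at most one of two unlinked flat edges is linked to it. The
    other one lies in [A], because [a] and [b] are adjacent to [Q]. *)
Lemma block_flat A Q a b : let X' := A :|: [set a; b] :|: Q in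
  Q \subset deg2 X' -> conn Q -> (forall e, e \in [set a; b] -> exists2 q, q \in Q & adj e q) ->
  flat2 X' -> exists u w, [/\ u \in A, w \in A, adj u w, u \in deg2 X' /\ w \in deg2 X' &
    forall q, q \in Q -> ~~ link (deg2 X') u q].
Proof.
move=> X' sQ cQ hQ [u1 [w1 [u2 [w2 [/and4P[u1D w1D u2D w2D] uw1 uw2 nl]]]]].
have from u w : u \in deg2 X' -> w \in deg2 X' -> adj u w -> ~~ [exists q in Q, link (deg2 X') u q] ->
    exists u w, [/\ u \in A, w \in A, adj u w, u \in deg2 X' /\ w \in deg2 X' &
    forall q, q \in Q -> ~~ link (deg2 X') u q].
  move=> uD wD uw /exists_inPn no; exists u, w.
  have inA z : z \in deg2 X' -> link (deg2 X') u z -> z \in A.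
    move=> zD lz; have /deg2P[zX _] := zD; move: zX; rewrite 2!in_setU -orbA => /or3P[//|zS|zQ].
      have [q qQ zq] := hQ z zS; have := no q qQ.
      by rewrite (link_trans lz) // link1 // (subsetP sQ).
    by have := no z zQ; rewrite lz.
  split=> //; [by apply: inA; rewrite ?link0 | by apply: inA => //; apply: link1].
have [/exists_inP[q1 q1Q l1]|no] := boolP [exists q in Q, link (deg2 X') u1 q]; last exact: (from u1 w1).
have [/exists_inP[q2 q2Q l2]|no] := boolP [exists q in Q, link (deg2 X') u2 q]; last exact: (from u2 w2).
case/negP: nl; apply: link_trans l1 _; rewrite link_sym in l2.
by apply: link_trans l2; apply: linkS sQ _; apply: cQ.
Qed.

Hypothesis PF : forall C c a b, hole C -> c \notin C -> a \in C -> b \in C -> adj c a -> adj c b -> a = b.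
Variable X : {set G}.
Hypothesis X2 : twoconn X.
Hypothesis branching : exists2 v, v \in X & #|nbr X v| != 2.
Hypothesis nflat : ~ flat2 X.
Hypothesis IH : forall Y : {set G}, #|Y| < #|X| -> twoconn Y -> (forall v, v \in Y -> #|nbr Y v| = 2) \/ flat2 Y.

Lemma deg_ge3 v : v \in X -> v \notin deg2 X -> 2 < #|nbr X v|.
Proof.
move=> vX; rewrite inE vX /= => ne; rewrite ltn_neqAle eq_sym ne.
exact: twoconn_deg.
Qed.

Lemma card_X : 3 < #|X|.
Proof.
have [v vX ne] := branching.
have h : 2 < #|nbr X v| by apply: deg_ge3; rewrite // inE vX.
rewrite (cardsD1 v) vX; apply: leq_ltn_trans h _.
rewrite ltnS; apply/subset_leq_card/subsetP=> z; rewrite in_nbr !inE => /andP[-> vz].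
by rewrite andbT eq_sym adj_neq.
Qed.

(** There is a fourth vertex, so a path outside the triangle joins neighbours of two of its
    vertices, [e1] and [e2]. With the edge [e1 e2] it closes to a hole for which the third vertex is
    a center. *)
Lemma no_triangle a b c : a \in X -> b \in X -> c \in X -> adj a b -> adj b c -> adj a c -> False.
Proof.
move=> aX bX cX ab bc ac; pose S : {set G} := [set a; b; c].
have inS z : (z \in S) = [|| z == a, z == b | z == c] by rewrite !inE orbA.
have SX z : z \in S -> z \in X by rewrite inS => /or3P[] /eqP->.
have adjS e f : e \in S -> f \in S -> e != f -> adj e f.
  rewrite !inS => /or3P[] /eqP-> /or3P[] /eqP-> //; rewrite ?eqxx // => _; by rewrite adjC.
have cS : 2 < #|S|.
  by apply: (@card_ge3 _ _ a b c); rewrite ?inS ?eqxx ?orbT // adj_neq.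
have [z zD] : exists z, z \in X :\: S.
  apply/set0Pn; apply: contraTneq card_X => e; rewrite -leqNgt.
  have : X \subset S by rewrite -setD_eq0 e.
  move/subset_leq_card/leq_trans; apply; rewrite /S -setUA cardsU1 cards2.
  by case: (a \notin _) => /=; case: (b != c).
have out f : f \in S -> exists e k, [/\ e \in S, e != f, k \in X :\: S, adj k e & link (X :\: S) z k].
  move=> fS; have [g [gS gf _]] := card_other f f cS.
  have gX : g \in X :\ f by rewrite in_setD1 gf SX.
  have zX : z \in X :\ f.
    move: zD; rewrite in_setD in_setD1 => /andP[zS ->]; rewrite andbT.
    by apply: contraNneq zS => ->.
  have gD : g \notin X :\: S by rewrite in_setD gS.
  have [k [e [kD eD kX eX [ke lk]]]] := link_exit (X2.2 f _ _ zX gX) zD gD.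
  move: eX eD; rewrite in_setD1 in_setD => /andP[ef ->]; rewrite andbT negbK => eS.
  by exists e, k; split=> //; apply: linkS lk; apply: subsetIr.
have aS : a \in S by rewrite inS eqxx.
have [e1 [k1 [e1S _ k1D ke1 l1]]] := out a aS.
have [e2 [k2 [e2S e21 k2D ke2 l2]]] := out e1 e1S.
have [f [fS fe1 fe2]] := card_other e1 e2 cS.
have l12 : link (X :\: S) k1 k2 by apply: link_trans l2; rewrite link_sym.
have [||q0 [qn [q [[wq uq _] sq q0U /set1P eqn hq]]]] :=
  ipath_shortest (U := nbr (X :\: S) e1) (V := [set k2]) l12 k1D; rewrite ?in_nbr ?k1D ?inE // 1?adjC //.
subst qn; have [q0q _] := walk_first wq; have [k2q _] := walk_last wq uq.
have qS z' : z' \in q -> z' \notin S by move/sq; rewrite in_setD => /andP[].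
pose Y := e2 |: [set z in q].
have inY w : (w \in Y) = (w == e2) || (w \in q) by rewrite !inE.
have e1Y : e1 \notin Y.
  by rewrite inY eq_sym (negPf e21) /=; apply/negP=> /qS; rewrite e1S.
have [|||||||R [RY _ _ e2R hR]] := @hole_through G Y e1 q0 e2 e1Y.
- by rewrite inY q0q orbT.
- by rewrite inY eqxx.
- by apply: contraNneq (qS q0 q0q) => ->.
- by move: q0U; rewrite in_nbr => /andP[].
- by apply: adjS; rewrite // eq_sym.
- move=> w; rewrite inY => /predU1P[->|wq' e1w]; first by right.
  by left; apply: (hq w wq').1; rewrite in_nbr sq.
- apply: (@link_trans _ _ k2); last by apply: link1; rewrite ?inY ?eqxx ?k2q ?orbT.
  by apply: walk_link wq _ k2q => w wq'; rewrite inY wq' orbT.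
have : e1 = e2.
  apply: (PF hR (c := f)); rewrite ?in_setU1 ?eqxx ?e2R ?orbT //; try exact: adjS.
  rewrite negb_or fe1; apply/negP=> /(subsetP RY); rewrite inY (negPf fe2) /= => /qS.
  by rewrite fS.
by move=> e; rewrite e eqxx in e21.
Qed.

(** Exchanging the far side for a path gives a smaller set, because the far side is not made of
    degree-2 vertices only. A vertex of [A] whose degree is not 2 keeps the result from being a
    cycle, so the induction hypothesis gives flat edges. *)
Lemma cut_flat A a b : cutpair X A a b -> far X A a b != set0 -> ~~ (A \subset deg2 X) ->
  ~~ (far X A a b \subset deg2 X) ->
  exists u w, [/\ u \in A, w \in A, adj u w, u \in deg2 X /\ w \in deg2 X &
    forall z, link (deg2 X) u z -> z \in A].
Proof.
move=> C B0 /subsetPn[v vA vD] /subsetPn[d dB dD].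
have A0 : A != set0 by apply/set0Pn; exists v.
have [Q [sQB X'2 sQ cQ hQ]] := block X2 C A0 B0; set X' := A :|: _ :|: Q in X'2 sQ.
have [sA aA bA cs no] := cutpairP C; have [aX bX ab _ hA] := C.
have sX' : X' \subset X.
  apply/subsetP=> z; rewrite 2!in_setU in_set2 => /orP[/orP[/sA//|/orP[] /eqP->]//|/(subsetP sQB)].
  by rewrite in_far => /and4P[].
have nbrA z : z \in A -> nbr X' z = nbr X z.
  move=> zA; apply/eqP; rewrite eqEsubset nbrS //=; apply/subsetP=> w; rewrite !in_nbr => /andP[wX zw].
  by rewrite zw andbT 2!in_setU in_set2; case: (hA z w zA wX zw) => ->; rewrite ?eqxx ?orbT.
have AX' z : z \in A -> z \in X' by move=> zA; rewrite 2!in_setU zA.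
have degA z : z \in A -> (z \in deg2 X') = (z \in deg2 X).
  by move=> zA; apply/deg2P/deg2P => -[_]; rewrite nbrA // => n2; split=> //; [exact: sA|exact: AX'].
have lt : #|X'| < #|X|.
  apply: proper_card; rewrite properEneq sX' andbT; apply: contra dD => /eqP e.
  rewrite -e; apply: (subsetP sQ); have : d \in X' by rewrite e; move: dB; rewrite in_far => /and4P[].
  move: dB; rewrite in_far => /and4P[_ dA da db].
  by rewrite 2!in_setU in_set2 (negPf dA) (negPf da) (negPf db).
case: (IH lt X'2) => [all2|/(block_flat sQ cQ hQ)].
  have := all2 v (AX' v vA); rewrite nbrA // => e.
  by move: vD; rewrite inE sA // e.
move=> [u [w [uA wA uw [uD wD] nl]]]; exists u, w; split=> //; first by rewrite -!degA.
(* A path of degree-2 vertices that leaves [A] passes [a] or [b]. This vertex has degree 2 in the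
   smaller set too and is adjacent to [Q] there, so the flat edge would be linked to [Q]. *)
move=> z lz; apply: contraT => zA.
have [c [e [cA eA cD eD [ce lc]]]] := link_exit lz uA zA.
have eX : e \in X by case/deg2P: eD.
have eS : e \in [set a; b].
  by rewrite in_set2; case: (hA c e cA eX ce) => [eA'|->|->]; rewrite ?eqxx ?orbT //; rewrite eA' in eA.
have eX' : e \in X' by rewrite 2!in_setU eS orbT.
have eD' : e \in deg2 X'.
  apply/deg2P; split=> //; apply/eqP; rewrite eqn_leq (twoconn_deg X'2) // andbT.
  by case/deg2P: eD => _ <-; apply/subset_leq_card/nbrS.
have cD' : c \in deg2 X' by rewrite degA.
have [q qQ eq] := hQ e eS; have qD := subsetP sQ q qQ.
case/negP: (nl q qQ); apply: (@link_trans _ _ c).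
  by apply: linkS lc; apply/subsetP=> y; rewrite in_setI => /andP[yD yA]; rewrite degA.
by apply: link_trans (link1 cD' eD' ce) _; apply: link1.
Qed.

(** Otherwise each side contains a flat edge, and the one in [A] is linked to nothing outside
    [A]. *)
Lemma two_sided A a b : cutpair X A a b -> far X A a b != set0 -> A != set0 ->
  (A \subset deg2 X) || (far X A a b \subset deg2 X).
Proof.
move=> C B0 A0; apply: contraT; rewrite negb_or => /andP[nA nB]; case: nflat.
have C' := cutpair_far C; have eA := far_far C.
have [u [w [uA wA uw [uD wD] hu]]] := cut_flat C B0 nA nB.
have [||u' [w' [uA' wA' uw' [uD' wD'] _]]] := cut_flat C' _ nB _; rewrite ?eA //.
exists u, w, u', w'; split=> //; first by rewrite uD wD uD' wD'.
by apply/negP=> /hu uA2; move: uA'; rewrite in_far uA2 andbF.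
Qed.

(* A cutset [v], [z] has a side inside [deg2 X], to which [v] is not adjacent; so [z]
   alone is a cutset. *)
Lemma del_twoconn v : v \in X -> (forall z, z \in deg2 X -> ~~ adj v z) -> twoconn (X :\ v).
Proof.
move=> vX nv; split; first by have := card_X; rewrite (cardsD1 v) vX.
move=> z a b aX bX; have [zX|zX] := boolP (z \in X :\ v); last first.
  have e : X :\ v :\ z = X :\ v.
    by apply/setP=> w; rewrite !inE; case: eqP => // ->; move: zX; rewrite !inE => /negPf->.
  by rewrite e in aX bX *; apply: X2.2.
apply: contraT => nl.
have [|A [B [A0 B0 eAB dAB nAB]]] := @not_conn_part G (X :\ v :\ z).
  by move=> c; case/negP: nl; apply: c.
have inAB w : (w \in A) || (w \in B) = [&& w != z, w != v & w \in X] by rewrite -in_setU eAB !inE.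
move: zX; rewrite in_setD1 => /andP[zv zX].
have C : cutpair X A v z.
  split=> //; first by rewrite eq_sym.
    apply/subsetP=> w wA; have := inAB w; rewrite wA /= => /esym/and3P[wz wv wX].
    by rewrite !inE negb_or wv wz.
  move=> c d cA dX cd; have [->|dv] := eqVneq d v; first exact: Or32.
  have [->|dz] := eqVneq d z; first exact: Or33.
  have := inAB d; rewrite dv dz dX => /orP[dA|dB]; first exact: Or31.
  by have := nAB c d cA dB; rewrite cd.
have eB : far X A v z = B.
  apply/setP=> w; rewrite in_far; have := inAB w; have := disjointFr dAB (x := w).
  case: (w \in A) => [->//|_] /=; first by rewrite andbF.
  by move=> ->; rewrite andbCA andbA [RHS]andbC -!andbA.
have C' := cutpair_far C; rewrite eB in C'.
have side S : cutpair X S v z -> S != set0 -> S \subset deg2 X -> False.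
  move=> CS /set0Pn[s sS] SD; have [sSX _ zS _ _] := cutpairP CS.
  have sz : s != z by apply: contraNneq zS => <-.
  have [e [c [eS ez cS ce _]]] := cut_exit X2 CS sS sz.
  move: eS; rewrite in_set2 (negPf ez) orbF => /eqP ee; subst e.
  by have := nv c (subsetP SD c cS); rewrite adjC ce.
have B0' : far X A v z != set0 by rewrite eB.
by case/orP: (two_sided C B0' A0); rewrite ?eB => /side; case.
Qed.

Lemma deg2_del v a : v \in X -> a \in X :\ v -> ~~ adj v a -> (a \in deg2 (X :\ v)) = (a \in deg2 X).
Proof.
move=> vX; rewrite in_setD1 => /andP[av aX] nva.
have e : nbr (X :\ v) a = nbr X a.
  apply/setP=> z; rewrite !in_nbr in_setD1; have [->|//] := eqVneq z v.
  by rewrite adjC (negPf nva) !andbF.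
by apply/deg2P/deg2P => -[_]; rewrite e => n2; split=> //; rewrite in_setD1 av.
Qed.

(** In [X :\ v] a flat edge may have an end whose degree has just dropped to 2. By [no_triangle] its
    other end is not adjacent to [v], so every flat edge is linked to the connected set [deg2 X],
    and any two are linked. If [X :\ v] is a hole, then [v] is a center. *)
Lemma del_false v : v \in X -> v \notin deg2 X -> (forall z, z \in deg2 X -> ~~ adj v z) ->
  conn (deg2 X) -> False.
Proof.
move=> vX vD nv cD; have v2 := del_twoconn vX nv.
have ltX : #|X :\ v| < #|X| by rewrite [ltnRHS](cardsD1 v) vX.
have nbrs := deg_ge3 vX vD.
have DD a : a \in deg2 X -> a \in deg2 (X :\ v).
  move=> aD; have /deg2P[aX _] := aD; rewrite deg2_del // ?nv // in_setD1 aX andbT.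
  by apply: contraNneq vD => <-.
have sDD : deg2 X \subset deg2 (X :\ v) by apply/subsetP.
case: (IH ltX v2) => [all2|[a [b [c [d [/and4P[aD bD cD' dD] ab cd nl]]]]]].
  have hX : hole (X :\ v).
    split=> //; last exact: twoconn_conn.
    by rewrite -card_gt0; case: v2 => h _; apply: leq_trans h.
  have [a [ aX va _]] := twoconn_nbr2 v X2 vX.
  have [b [bX vb ba]] := twoconn_nbr2 a X2 vX.
  have : b = a; last by move=> e; rewrite e eqxx in ba.
  by apply: (PF hX (c := v)); rewrite ?in_setD1 ?eqxx ?aX ?bX ?andbT // eq_sym adj_neq.
have pick e f : e \in deg2 (X :\ v) -> f \in deg2 (X :\ v) -> adj e f ->
    exists2 g, g \in deg2 X & link (deg2 (X :\ v)) e g.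
  move=> eD fD ef; have /deg2P[eX _] := eD; have /deg2P[fX _] := fD.
  have [ve|ve] := boolP (adj v e); last first.
    by exists e; [rewrite -(deg2_del vX eX ve) | rewrite link0].
  have [vf|vf] := boolP (adj v f).
    exfalso; move: eX fX; rewrite !in_setD1 => /andP[_ eX] /andP[_ fX].
    exact: (no_triangle vX eX fX).
  by exists f; [rewrite -(deg2_del vX fX vf) | apply: link1].
have [g gD lg] := pick a b aD bD ab; have [g' g'D lg'] := pick c d cD' dD cd.
case/negP: nl; apply: link_trans lg _; rewrite link_sym in lg'; apply: link_trans lg'.
exact: linkS sDD (cD _ _ gD g'D).
Qed.

(* A connected set of degree-2 vertices is a path, so only two edges leave it. *)
Lemma two_exits k1 a1 k2 a2 k3 a3 : conn (deg2 X) ->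
  k1 \in deg2 X -> k2 \in deg2 X -> k3 \in deg2 X ->
  a1 \in X :\: deg2 X -> a2 \in X :\: deg2 X -> a3 \in X :\: deg2 X ->
  adj k1 a1 -> adj k2 a2 -> adj k3 a3 -> (k1, a1) != (k2, a2) ->
  (k3 = k1 /\ a3 = a1) \/ (k3 = k2 /\ a3 = a2).
Proof.
move=> cK k1D k2D k3D a1N a2N a3N ka1 ka2 ka3 ne.
have DX k : k \in deg2 X -> k \in X by case/deg2P.
have NX a : a \in X :\: deg2 X -> a \in X by rewrite in_setD => /andP[].
have nD a k : a \in X :\: deg2 X -> k \in deg2 X -> k <> a.
  by move=> aN kD e; move: aN; rewrite -e in_setD kD.
have [ek|nk] := eqVneq k1 k2.
  subst k2; have a12 : a1 != a2 by apply: contra ne => /eqP->.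
  have two d : d \in X -> adj k1 d -> d = a1 \/ d = a2.
    by apply: deg2_two; rewrite ?NX.
  have : k3 \in [set k1].
    apply: (link_closed _ (cK _ _ k1D k3D)); last by rewrite inE.
    move=> c d; rewrite inE => /eqP-> _ dD kd.
    by case: (two d (DX d dD) kd) => e; case: (nD _ _ _ dD e).
  rewrite inE => /eqP e; subst k3; case: (two a3 (NX _ a3N) ka3) => ->; [by left|by right].
have [||c0 [d0 [q [iq sq /set1P e1 /set1P e2 _]]]] :=
  ipath_shortest (U := [set k1]) (V := [set k2]) (cK _ _ k1D k2D) k1D; rewrite ?inE //; subst c0 d0.
have [wq uq _] := iq; have [k1q _] := walk_first wq; have [k2q _] := walk_last wq uq.
have key c d : c \in q -> d \in X -> adj c d -> [\/ d \in q, c = k1 /\ d = a1 | c = k2 /\ d = a2].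
  move=> cq dX cd; have cD := sq c cq.
  have inq e f : e \in X -> f \in X -> adj c e -> adj c f -> e != f -> d = e \/ d = f.
    by move=> eX fX ce cf ef; apply: (deg2_two cD).
  have [c1|c1] := eqVneq c k1; have [c2|c2] := eqVneq c k2.
  - by rewrite -c1 c2 eqxx in nk.
  - have [e eq [_ ce]] := walk_next wq uq cq c2; have eD := sq e eq.
    subst c; case: (inq e a1 (DX _ eD) (NX _ a1N) ce ka1) => [|->|->].
    + by apply/eqP; apply: nD.
    + exact: Or31.
    + exact: Or32.
  - have [e eq [_ ce]] := walk_prev wq uq cq c1; have eD := sq e eq.
    subst c; case: (inq e a2 (DX _ eD) (NX _ a2N) ce ka2) => [|->|->].
    + by apply/eqP; apply: nD.
    + exact: Or31.
    + exact: Or33.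
  - have [e eq [ie ce]] := walk_prev wq uq cq c1; have [f fq [jf cf]] := walk_next wq uq cq c2.
    case: (inq e f (DX _ (sq e eq)) (DX _ (sq f fq)) ce cf) => [|->|->]; try exact: Or31.
    by apply/eqP=> ef; subst f; natlia.
have : k3 \in [set z in q].
  apply: (link_closed _ (cK _ _ k1D k3D)); last by rewrite inE.
  move=> c d; rewrite !(in_set (fun z => z \in q)) => cq _ dD cd.
  case: (key c d cq (DX d dD) cd) => [//|[_ e]|[_ e]]; [case: (nD _ _ a1N dD e)|case: (nD _ _ a2N dD e)].
rewrite inE => k3q; case: (key k3 a3 k3q (NX _ a3N) ka3) => [a3q|[-> ->]|[-> ->]]; [|by left|by right].
by case: (nD _ _ a3N (sq _ a3q)).
Qed.

(** Otherwise every vertex of degree 2 is on a flat edge, so [deg2 X] is connected and has only two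
    exits. By [del_false] every other vertex is reached by one of them, and this leaves at most two
    neighbours for [v]. *)
Lemma ex_isolated : exists2 x, x \in deg2 X & forall z, z \in deg2 X -> ~~ adj x z.
Proof.
have [/exists_inP[x xD /forall_inP h]|no] := boolP [exists x in deg2 X, [forall z in deg2 X, ~~ adj x z]].
  by exists x.
exfalso; have mate a : a \in deg2 X -> exists2 b, b \in deg2 X & adj a b.
  move=> aD; move/exists_inPn: no => /(_ a aD) /forall_inPn[b bD]; rewrite negbK => ab.
  by exists b.
have cK : conn (deg2 X).
  move=> a c aD cD; apply: contraT => nl; case: nflat.
  have [b bD ab] := mate a aD; have [d dD cd] := mate c cD.
  by exists a, b, c, d; rewrite aD bD cD dD.
have [v vX vn] := branching.
have vD : v \notin deg2 X by rewrite inE vX (negPf vn).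
have touch w : w \in X -> w \notin deg2 X -> exists2 k, k \in deg2 X & adj k w.
  move=> wX wD; have [/exists_inP[k kD kw]|/exists_inPn h] := boolP [exists k in deg2 X, adj k w].
    by exists k.
  by case: (del_false wX wD _ cK) => z zD; rewrite adjC; apply: h.
have vN : v \in X :\: deg2 X by rewrite in_setD vD.
have [k0 k0D k0v] := touch v vX vD.
(* A second exit, obtained from another neighbour [w] of [v]: from [w] to [v] if [w] has degree 2,
   and otherwise an exit that ends in [w]. *)
have [k1 [a1 [k1D a1N ka1 ne]]] : exists k1 a1, [/\ k1 \in deg2 X, a1 \in X :\: deg2 X, adj k1 a1 & (k0, v) != (k1, a1)].
  have [w [wX vw wk0]] := twoconn_nbr2 k0 X2 vX.
  have [wD|wD] := boolP (w \in deg2 X).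
    exists w, v; split=> //; first by rewrite adjC.
    by rewrite xpair_eqE eq_sym (negPf wk0).
  have [k kD kw] := touch w wX wD; exists k, w; rewrite in_setD wD; split=> //.
  by rewrite xpair_eqE (negPf (adj_neq vw)) andbF.
have exits k a : k \in deg2 X -> a \in X :\: deg2 X -> adj k a -> (k = k0 /\ a = v) \/ (k = k1 /\ a = a1).
  by move=> kD aN ka; apply: (two_exits cK k0D k1D kD vN a1N aN).
have bound w1 w2 : (forall z, z \in X -> adj v z -> z = w1 \/ z = w2) -> False.
  move=> h; have := deg_ge3 vX vD; rewrite ltnNge => /negP; apply.
  apply: (@leq_trans #|[set w1; w2]|); last by rewrite cards2; case: (w1 != w2).
  apply/subset_leq_card/subsetP=> z; rewrite in_nbr in_set2 => /andP[zX vz].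
  by case: (h z zX vz) => ->; rewrite eqxx ?orbT.
have inner z : z \in deg2 X -> adj v z -> z = k0 \/ (z = k1 /\ v = a1).
  by move=> zD vz; case: (exits z v zD vN) => [|[]|[]]; [rewrite adjC|left|right].
have outer z : z \in X -> z \notin deg2 X -> z = v \/ z = a1.
  move=> zX zD; have [k kD kz] := touch z zX zD.
  by case: (exits k z kD _ kz) => [|[]|[]]; rewrite ?in_setD ?zD //; [left|right].
have [e|e] := eqVneq v a1.
  apply: (bound k0 k1) => z zX vz; have [zD|zD] := boolP (z \in deg2 X).
    by case: (inner z zD vz) => [|[]]; [left|right].
  have zv : z = v by case: (outer z zX zD) => // ->.
  by rewrite zv adjxx in vz.
apply: (bound k0 a1) => z zX vz; have [zD|zD] := boolP (z \in deg2 X).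
  by case: (inner z zD vz) => [|[_ e']]; [left|rewrite e' eqxx in e].
case: (outer z zX zD) => [zv|]; last by right.
by rewrite zv adjxx in vz.
Qed.

(** * Edges that separate the neighbours of a degree-2 vertex *)

Definition sep_rest x y y' : {set G} := X :\ x :\: [set y; y'].

Definition icut x s t y y' :=
  [/\ [/\ x \in X, s \in X, t \in X, s \notin deg2 X & t \notin deg2 X],
      [/\ s != t, adj x s, adj x t & forall z, z \in X -> adj x z -> z = s \/ z = t],
      [/\ y \in X, y' \in X, adj y y', y != x & y' != x],
      [/\ y != s, y != t, y' != s & y' != t] &
      ~~ link (sep_rest x y y') s t].

Definition side x s y y' := component (sep_rest x y y') s.

Lemma sep_restC x y y' : sep_rest x y y' = sep_rest x y' y.
Proof. by rewrite /sep_rest setUC. Qed.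

Lemma icut_swap x s t y y' : icut x s t y y' -> icut x t s y y'.
Proof.
case=> -[xX sX tX sD tD] [st xs xt hx] h [h1 h2 h3 h4] nl; split=> //; last by rewrite link_sym.
by split=> //; [rewrite eq_sym | move=> z zX xz; case: (hx z zX xz); [right|left]].
Qed.

Lemma icut_swap' x s t y y' : icut x s t y y' -> icut x s t y' y.
Proof.
case=> h1 h2 [yX y'X yy' yx y'x] [h3 h4 h5 h6] nl; split=> //; last by rewrite sep_restC.
by split=> //; rewrite adjC.
Qed.

Lemma in_sep_rest x y y' z : (z \in sep_rest x y y') = [&& z != y, z != y', z != x & z \in X].
Proof. by rewrite !inE negb_or -!andbA. Qed.

Lemma branch_isolated x s t : x \in X -> adj x s -> adj x t -> s \notin deg2 X -> t \notin deg2 X ->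
  (forall z, z \in X -> adj x z -> z = s \/ z = t) -> twoconn (X :\ x).
Proof.
move=> xX xs xt sD tD hx; apply: del_twoconn => // z zD; have /deg2P[zX _] := zD.
by apply/negP=> xz; case: (hx z zX xz) => e; rewrite -e zD in sD tD.
Qed.

(** [edge_cut] is applied with [J] equal to [X :\ x]; that [s] and [t] are nonadjacent comes from
    [no_triangle]. *)
Lemma isolated_icut x s t : x \in X -> s \in X -> t \in X -> s != t -> adj x s -> adj x t ->
  s \notin deg2 X -> t \notin deg2 X -> (forall z, z \in X -> adj x z -> z = s \/ z = t) ->
  exists y y', icut x s t y y'.
Proof.
move=> xX sX tX st xs xt sD tD hx; have J2 := branch_isolated xX xs xt sD tD hx.
have nst : ~~ adj s t by apply/negP=> ast; apply: (no_triangle xX sX tX).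
have sJ : s \in X :\ x by rewrite in_setD1 sX eq_sym adj_neq.
have tJ : t \in X :\ x by rewrite in_setD1 tX eq_sym adj_neq.
have xJ : x \notin X :\ x by rewrite in_setD1 eqxx.
have nx z : z \in X :\ x -> adj x z -> z = s \/ z = t by rewrite in_setD1 => /andP[_]; apply: hx.
have [h [g T]] := twoconn_twopaths J2 sJ tJ st.
have := twopaths_edge_cut PF xJ st nst xs xt nx T.
move=> /existsP[y /existsP[y' /and5P[yJ y'J yy' ys /and4P[yt y's y't nl]]]].
exists y, y'; move: yJ y'J; rewrite !in_setD1 => /andP[yx yX] /andP[y'x y'X].
by split.
Qed.

Section Icut.
Variables x s t y y' : G.
Hypothesis C : icut x s t y y'.

Let A := side x s y y'.
Let J2 : twoconn (X :\ x).
Proof. by case: C => -[xX sX tX sD tD] [st xs xt hx] _ _ _; apply: (branch_isolated xX xs xt). Qed.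

Lemma s_rest : s \in sep_rest x y y'.
Proof.
case: C => -[xX sX tX sD tD] [st xs xt hx] _ [ys yt y's y't] _.
by rewrite in_sep_rest sX 2![s == _]eq_sym ys y's eq_sym adj_neq.
Qed.

Lemma s_side : s \in A. Proof. by rewrite in_comp link0. Qed.

Lemma t_side : t \notin A. Proof. by rewrite in_comp; case: C. Qed.

Lemma side_rest z : z \in A -> [/\ z != y, z != y', z != x & z \in X].
Proof. by move/(subsetP (compS s_rest)); rewrite in_sep_rest => /and4P. Qed.

Lemma side_exit c d : c \in A -> d \in X -> adj c d -> [\/ d \in A, d = y, d = y' | d = x /\ c = s].
Proof.
move=> cA dX cd; have [->|dy] := eqVneq d y; first exact: Or42.
have [->|dy'] := eqVneq d y'; first exact: Or43.
have [cy cy' cx cX] := side_rest cA.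
have [dx|dx] := eqVneq d x.
  apply: Or44; split=> //; case: C => _ [_ _ _ hx] _ _ _; rewrite dx adjC in cd.
  by case: (hx c cX cd) => // e; have := t_side; rewrite -e cA.
by apply: Or41; apply: comp_closed cA _ _ cd; rewrite in_sep_rest ?cy ?cy' ?cx ?dy ?dy' ?dx.
Qed.

Lemma side_cutpair : cutpair (X :\ x) A y y'.
Proof.
case: C => _ _ [yX y'X yy' yx y'x] _ _; split; rewrite ?in_setD1 ?yx ?y'x ?adj_neq //.
  by rewrite /A; apply: compS s_rest.
move=> c d cA; rewrite in_setD1 => /andP[dx dX] cd.
case: (side_exit cA dX cd) => [?|?|?|[e _]]; [exact: Or31|exact: Or32|exact: Or33|].
by rewrite e eqxx in dx.
Qed.

Lemma t_far : t \in far (X :\ x) A y y'.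
Proof.
case: C => -[xX sX tX sD tD] [st xs xt hx] _ [ys yt y's y't] _.
by rewrite in_far in_setD1 tX t_side 3![t == _]eq_sym (adj_neq xt) yt y't.
Qed.

Lemma side_touch z v : z \in A -> z != v -> exists e c,
  [/\ e \in [set y; y'], e != v, c \in A, adj c e & link (A :\ v) z c].
Proof. exact: cut_exit J2 side_cutpair. Qed.

Lemma far_touch z v : z \in far (X :\ x) A y y' -> z != v -> exists e c,
  [/\ e \in [set y; y'], e != v, c \in far (X :\ x) A y y', adj c e & link (far (X :\ x) A y y' :\ v) z c].
Proof. exact: cut_exit J2 (cutpair_far side_cutpair). Qed.

(** [X :\ x] is 2-connected, so without [y'] both sides are still attached to [y]. Thus [y] has a
    neighbour on each side besides [y']. *)
Lemma y_branch : y \notin deg2 X.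
Proof.
case: C => _ _ [yX y'X yy' yx y'x] [ys yt y's y't] _.
have sy' : s != y' by rewrite eq_sym.
have [e [c [eS ey' cA ce _]]] := side_touch s_side sy'.
have ty' : t != y' by rewrite eq_sym.
have [f [d [fS fy' dB df _]]] := far_touch t_far ty'.
move: eS fS; rewrite !in_set2 (negPf ey') (negPf fy') !orbF => /eqP ee /eqP ef; subst e f.
move: dB; rewrite in_far in_setD1 => /and4P[/andP[_ dX] dA _ dy'].
have [_ cy' _ cX] := side_rest cA.
apply/negP=> /deg2P[_ n2]; have : 2 < #|nbr X y|; last by rewrite n2.
rewrite adjC in ce; rewrite adjC in df.
apply: (@card_ge3 _ _ y' c d); rewrite ?in_nbr ?y'X ?cX ?dX //; try by rewrite eq_sym.
by apply: contraNneq dA => <-.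
Qed.

End Icut.

Lemma y'_branch x s t y y' : icut x s t y y' -> y' \notin deg2 X.
Proof. by move/icut_swap'; apply: y_branch. Qed.

Definition flat_in A := [exists u in A, [exists w in A, [&& u \in deg2 X, w \in deg2 X & adj u w]]].

Lemma flat_inP A : reflect (exists u w, [/\ u \in A, w \in A, u \in deg2 X, w \in deg2 X & adj u w]) (flat_in A).
Proof.
apply: (iffP exists_inP) => [[u uA /exists_inP[w wA /and3P[uD wD uw]]]|[u [w [uA wA uD wD uw]]]].
  by exists u, w.
by exists u => //; apply/exists_inP; exists w => //; rewrite uD wD.
Qed.

(** A path of degree-2 vertices cannot leave a side: the exits are [y] and [y'], which do not have
    degree 2, and [x], which is reached from [s] only. *)
Lemma flat_one_side x s t y y' : icut x s t y y' -> flat_in (side x s y y') -> ~~ flat_in (side x t y y').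
Proof.
move=> C /flat_inP[u [w [uA wA uD wD uw]]]; apply/negP=> /flat_inP[u' [w' [uA' wA' uD' wD' uw']]].
case: nflat; exists u, w, u', w'; split=> //; first by rewrite uD wD uD'.
apply/negP=> l; case: (C) => -[xX sX tX sD tD] _ _ _ /negP; apply.
have uA2 : u' \in side x s y y'.
  apply: link_closed l uA => c d cA cD dD cd; have /deg2P[dX _] := dD.
  case: (side_exit C cA dX cd) => [//|e|e|[_ e]].
  - by have := y_branch C; rewrite -e dD.
  - by have := y'_branch C; rewrite -e dD.
  - by rewrite -e cD in sD.
move: uA' uA2; rewrite !in_comp => lt ls; apply: link_trans ls _; by rewrite link_sym.
Qed.

Lemma icut_center x s t y y' : icut x s t y y' -> x \in deg2 X.
Proof.
by case=> -[xX sX tX _ _] [st xs xt hx] _ _ _; apply/deg2P; split=> //; apply: (card_nbr2 sX tX).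
Qed.

Lemma icut_branches x s t y y' : icut x s t y y' ->
  [/\ x \in X, s \in X, t \in X & [/\ s \notin deg2 X, t \notin deg2 X, adj x s & adj x t]].
Proof. by case=> -[xX sX tX sD tD] [_ xs xt _] _ _ _. Qed.

Lemma in_far_side x s t y y' z : icut x s t y y' -> z \in far (X :\ x) (side x s y y') y y' ->
  [/\ z \in X, z != x, z \notin side x s y y' & z != y /\ z != y'].
Proof. by move=> C; rewrite in_far in_setD1 => /and4P[/andP[-> ->] -> -> ->]. Qed.

(** * Cuts that arise from a vertex inside one side *)

Section Shrink.
Variables x s t y y' m a : G.
Hypothesis C : icut x s t y y'.
Let A := side x s y y'.
Let T := far (X :\ x) A y y'.
Hypothesis mA : m \in A.
Hypothesis ms : m != s.
Hypothesis ma : adj m a.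

Lemma a_place : a \in X -> [\/ a \in A, a = y | a = y'].
Proof.
move=> aX; case: (side_exit C mA aX ma) => [?|?|?|[_ e]]; [exact: Or31|exact: Or32|exact: Or33|].
by have := ms; rewrite e eqxx.
Qed.

Lemma T_exit c d : c \in T -> d \in X -> d != x -> adj c d -> [\/ d \in T, d = y | d = y'].
Proof.
move=> cT dX dx cd; have [_ _ _ _ h] := cutpair_far (side_cutpair C).
by apply: h cd; rewrite // in_setD1 dx.
Qed.

(* Every hole through [x] that avoids [y'] contains both [y] and [v], which are
   neighbours of [y']. *)
Lemma cut_through_y' v : icut m s a v y' -> v \in T -> False.
Proof.
move=> C2 vT; have nl : ~~ link (sep_rest m v y') s a by case: C2.
set Z := sep_rest m v y' in nl.
have inZ z : z \in Z = [&& z != v, z != y', z != m & z \in X] by rewrite in_sep_rest.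
have [xX sX tX [sD tD xs xt]] := icut_branches C; have [mX _ aX [_ aD _ _]] := icut_branches C2.
have [vX vx vA [vy vy']] := in_far_side C vT.
have [_ [st _ _ hx] [yX y'X yy' yx y'x] [ys yt y's y't] _] := C.
have sA := s_side x s y y'; have tA := t_side C.
have yA : y \notin A by apply/negP=> /(side_rest C)[]; rewrite eqxx.
have y'A : y' \notin A by apply/negP=> /(side_rest C)[_]; rewrite eqxx.
have mx : m != x by case: (side_rest C mA).
have AZ z : z \in A -> z != m -> z \in Z.
  move=> zA zm; rewrite inZ zm; have [_ -> _ ->] := side_rest C zA.
  by rewrite !andbT; apply: contraNneq vA => <-.
have yZ : y \in Z.
  rewrite inZ eq_sym vy (adj_neq yy') yX andbT /=.
  by apply: contraNneq yA => ->.
have sZ : s \in Z by apply: AZ => //; rewrite eq_sym.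
have aZ : a \in Z by have := s_rest (icut_swap C2).
have xZ : x \in Z.
  by rewrite inZ xX andbT eq_sym vx eq_sym y'x eq_sym.
have lay : link Z a y.
  case: (a_place aX) => [aA|->|e]; [|exact: link0|by move: aZ; rewrite inZ e eqxx andbF].
  pose E := component (A :\ m) a.
  have am : a \in A :\ m by rewrite in_setD1 aA eq_sym adj_neq.
  have EA z : z \in E -> z \in A /\ z != m.
    by move/(subsetP (compS am)); rewrite in_setD1 => /andP[].
  have lE z : z \in E -> link Z a z.
    rewrite in_comp; apply: linkS; apply/subsetP=> w; rewrite in_setD1 => /andP[wm wA].
    exact: AZ.
  have [/exists_inP[c cE cy]|/exists_inPn no] := boolP [exists c in E, adj c y].
    by apply: link_trans (lE c cE) _; apply: link1 => //; apply: AZ; case: (EA c cE).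
  (* If the component [E] of [a] misses [y], then [m] and [y'] cut it off from [t]. Both sides
     contain a vertex that is not of degree 2, against [two_sided]. *)
  exfalso; have CE : cutpair X E m y'.
    split=> //; first by apply: contraNneq y'A => <-.
      apply/subsetP=> z zE; have [zA zm] := EA z zE; have [_ zy' _ zX] := side_rest C zA.
      by rewrite in_setD in_set2 negb_or zm zy'.
    move=> c d cE dX cd; have [cA cm] := EA c cE.
    case: (side_exit C cA dX cd) => [dA|e|e|[_ e]].
    - have [dm|dm] := eqVneq d m; first exact: Or32.
      by apply: Or31; apply: comp_closed cE _ _ cd; rewrite in_setD1 ?cm ?dm.
    - by have := no c cE; rewrite -e cd.
    - exact: Or33.
    - by case/negP: nl; rewrite link_sym -e; apply: lE.
  have tF : t \in far X E m y'.
    rewrite in_far tX [t == y']eq_sym y't andbT /=; apply/andP; split.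
      by apply: contra tA => /EA[].
    by apply: contraNneq tA => ->.
  have aE : a \in E by rewrite in_comp link0.
  have F0 : far X E m y' != set0 by apply/set0Pn; exists t.
  have E0 : E != set0 by apply/set0Pn; exists a.
  case/orP: (two_sided CE F0 E0) => /subsetP sub; [have := sub a aE | have := sub t tF]; exact/negP.
have J2 : twoconn (X :\ x) by apply: (branch_isolated xX xs xt).
pose Y := X :\ x :\ y'.
have inY z : z \in Y = [&& z != y', z != x & z \in X] by rewrite !in_setD1.
have sY : s \in Y by rewrite inY sX eq_sym y's eq_sym adj_neq.
have tY : t \in Y by rewrite inY tX eq_sym y't eq_sym adj_neq.
have xY : x \notin Y by rewrite inY eqxx andbF.
have [||R [RY cR sR tR hR]] := @hole_through G Y x s t xY sY tY st xs xt.
- by move=> z; rewrite inY => /and3P[_ _ zX]; apply: hx.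
- exact: J2.2.
have RYn z : z \in R -> [/\ z != y', z != x & z \in X].
  by move/(subsetP RY); rewrite inY => /and3P.
have yR : y \in R.
  apply: (conn_cut cR RY sR tR sA tA) => k z kA _ zY zA kz.
  move: zY; rewrite inY => /and3P[zy' zx zX].
  case: (side_exit C kA zX kz) => [zA'|//|e|[e _]]; first by rewrite zA' in zA.
    by rewrite e eqxx in zy'.
  by rewrite e eqxx in zx.
have yT : y \notin T by apply/negP=> /(in_far_side C)[_ _ _ []]; rewrite eqxx.
(* A hole that misses [v] would link [t] to [y] within the far side, and then [s], [x], [t], [y],
   [a] would be linked around the new cut. *)
have vR : v \in R.
  apply: contraT => vR; have [c [d [cT dT cR' dR [cd lc]]]] := link_exit (cR _ _ tR yR) (t_far C) yT.
  have [dy' dx dX] := RYn d dR.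
  have ed : d = y.
    case: (T_exit cT dX dx cd) => // [dT'|e]; first by have := dT; rewrite -/T dT'.
    by rewrite e eqxx in dy'.
  have sRZ : R :&: T \subset Z.
    apply/subsetP=> z; rewrite in_setI => /andP[zR zT]; have [zy' zx zX] := RYn z zR.
    rewrite inZ zy' zX andbT /=; apply/andP; split; first by apply: contraNneq vR => <-.
    by have [_ _ zA _] := in_far_side C zT; apply: contraNneq zA => ->.
  have tZ : t \in Z by apply: (subsetP sRZ); rewrite in_setI tR (t_far C).
  have cZ : c \in Z by apply: (subsetP sRZ); rewrite in_setI cR' cT.
  case/negP: nl; apply: (@link_trans _ _ x); first by apply: link1; rewrite // adjC.
  apply: (@link_trans _ _ t); first exact: link1.
  apply: (@link_trans _ _ c); first exact: linkS sRZ lc.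
  apply: (@link_trans _ _ y); first by apply: link1; rewrite // -ed.
  by rewrite link_sym.
have e : y = v.
  apply: (PF hR (c := y')); rewrite ?in_setU1 ?yR ?vR ?orbT //; last 2 first.
  - by rewrite adjC.
  - by case: C2 => _ _ [_ _ + _ _]; rewrite adjC.
  by rewrite negb_or y'x; apply/negP=> /RYn[]; rewrite eqxx.
by rewrite e eqxx in vy.
Qed.

End Shrink.

(** If [v] is on the far side, then [v'] is [y], [y'] or on the far side too. [cut_through_y']
    excludes the first two cases. In the third, all of [A] except [m] stays linked to the edge
    [y y'], so [s] and [a] are not separated. *)
Lemma cut_outside x s t y y' m a v v' : icut x s t y y' -> m \in side x s y y' -> m != s -> adj m a ->
  icut m s a v v' -> v \notin far (X :\ x) (side x s y y') y y'.
Proof.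
move=> C mA ms ma C2; apply/negP=> vT.
have [xX sX tX [sD tD xs xt]] := icut_branches C; have [mX _ aX [_ aD _ _]] := icut_branches C2.
have [vX vx vA [vy vy']] := in_far_side C vT.
have [_ _ [_ v'X vv' _ _] _ nl] := C2.
have v'x : v' != x by apply/eqP=> e; have := y'_branch C2; rewrite e (icut_center C).
case: (T_exit C vT v'X v'x vv') => [v'T|e|e]; last 2 first.
- subst v'; have eS : side x s y' y = side x s y y' by rewrite /side sep_restC.
  apply: (cut_through_y' (icut_swap' C) _ ms ma C2); rewrite eS // /far [[set y'; y]]setUC.
  exact: vT.
- by subst v'; apply: (cut_through_y' C mA ms ma C2).
have [_ _ v'A [v'y v'y']] := in_far_side C v'T.
have [_ _ [yX y'X yy' yx y'x] _ _] := C.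
set Z := sep_rest m v v' in nl.
have inZ z : z \in Z = [&& z != v, z != v', z != m & z \in X] by rewrite in_sep_rest.
have AZ z : z \in side x s y y' -> z != m -> z \in Z.
  move=> zA zm; rewrite inZ zm; have [_ _ _ ->] := side_rest C zA.
  by rewrite !andbT; apply/andP; split; [apply: contraNneq vA => <-|apply: contraNneq v'A => <-].
have eZ e : e \in [set y; y'] -> e \in Z.
  move=> eS; have eA : e \notin side x s y y'.
    apply/negP=> /(side_rest C)[ey ey' _ _]; move: eS; by rewrite in_set2 (negPf ey) (negPf ey').
  rewrite inZ; have em : e != m by apply: contraNneq eA => ->.
  rewrite em; move: eS; rewrite in_set2 => /orP[] /eqP->.
    by rewrite yX eq_sym vy eq_sym v'y.
  by rewrite y'X eq_sym vy' eq_sym v'y'.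
have yS : y \in [set y; y'] by rewrite in_set2 eqxx.
have y'S : y' \in [set y; y'] by rewrite in_set2 eqxx orbT.
have leY e : e \in [set y; y'] -> link Z e y.
  rewrite in_set2 => /orP[] /eqP->; first exact: link0.
  by apply: link1; [exact: eZ | exact: eZ | rewrite adjC].
have lA z : z \in side x s y y' -> z != m -> link Z z y.
  move=> zA zm; have [e [c [eS em cA ce lc]]] := side_touch C zA zm.
  have sAZ : side x s y y' :\ m \subset Z.
    by apply/subsetP=> w; rewrite in_setD1 => /andP[wm wA]; apply: AZ.
  have cZ : c \in Z by apply: (link_in (linkS sAZ lc)); apply: AZ.
  by apply: link_trans (linkS sAZ lc) _; apply: link_trans (leY e eS); apply: link1; rewrite // eZ.
case/negP: nl; apply: (@link_trans _ _ y); first by apply: lA; rewrite ?(s_side x s y y') // eq_sym.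
rewrite link_sym; case: (a_place C mA ms ma aX) => [aA|->|->]; [|exact: leY|exact: leY].
by apply: lA; rewrite // eq_sym adj_neq.
Qed.

(** The new edge avoids the far side, so [x], [t] and those of [y] and [y'] that are not on the new
    edge remain linked to [s]. The component of [a] could leave [A] only through one of these. *)
Lemma side_shrinks x s t y y' m a v v' : icut x s t y y' -> m \in side x s y y' -> m != s -> adj m a ->
  icut m s a v v' -> side m a v v' \subset side x s y y'.
Proof.
move=> C mA ms ma C2; have vT := cut_outside C mA ms ma C2.
have v'T := cut_outside C mA ms ma (icut_swap' C2).
have [xX sX tX [sD tD xs xt]] := icut_branches C; have [mX _ aX [_ aD _ _]] := icut_branches C2.
have [_ _ [yX y'X yy' yx y'x] [ys yt y's y't] _] := C; have [_ _ _ _ nl] := C2.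
set Z := sep_rest m v v' in nl.
have inZ z : z \in Z = [&& z != v, z != v', z != m & z \in X] by rewrite in_sep_rest.
have sZ : s \in Z := s_rest C2.
have aZ : a \in Z := s_rest (icut_swap C2).
have xD := icut_center C.
have xZ : x \in Z.
  rewrite inZ xX andbT; apply/and3P; split.
  - by apply: contraNneq (y_branch C2) => <-.
  - by apply: contraNneq (y'_branch C2) => <-.
  - by have [_ _ mx _] := side_rest C mA; rewrite eq_sym.
have TZ : far (X :\ x) (side x s y y') y y' \subset Z.
  apply/subsetP=> z zT; have [zX _ zA _] := in_far_side C zT; rewrite inZ zX andbT; apply/and3P; split.
  - by apply: contraNneq vT => <-.
  - by apply: contraNneq v'T => <-.
  - by apply: contraNneq zA => ->.
have tZ : t \in Z by apply: (subsetP TZ); apply: t_far C.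
have lst : link Z s t.
  by apply: (@link_trans _ _ x); apply: link1; rewrite // adjC.
have lse e f : e \in [set y; y'] -> f \in [set y; y'] -> e != f -> t != f -> e \in Z -> link Z s e.
  move=> eS fS ef tf eZ; have [e' [c [e'S e'f cT ce lc]]] := far_touch C (t_far C) tf.
  have ee : e' = e.
    move: eS fS e'S ef e'f; rewrite !in_set2 => /orP[] /eqP-> /orP[] /eqP-> /orP[] /eqP-> //; by rewrite eqxx.
  subst e'; apply: link_trans lst _; apply: (@link_trans _ _ c).
    by apply: linkS lc; apply: subset_trans TZ; apply: subsetDl.
  by apply: link1; rewrite // (subsetP TZ).
have yy'n : y != y' := adj_neq yy'.
have ly : y \in Z -> link Z s y.
  by apply: (lse y y'); rewrite ?in_set2 ?eqxx ?orbT // eq_sym.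
have ly' : y' \in Z -> link Z s y'.
  by apply: (lse y' y); rewrite ?in_set2 ?eqxx ?orbT // eq_sym.
have aA : a \in side x s y y'.
  case: (a_place C mA ms ma aX) => // e; case/negP: nl.
    by rewrite e; apply: ly; rewrite -e.
  by rewrite e; apply: ly'; rewrite -e.
apply/subsetP=> z; rewrite in_comp -/(sep_rest m v v') -/Z => lz.
apply: contraT => zA; have [c [d [cA dA cZ dZ [cd lc]]]] := link_exit lz aA zA.
have dX : d \in X by move: dZ; rewrite inZ => /and4P[].
have lad : link Z a d.
  by apply: link_trans (linkS (subsetIl _ _) lc) _; apply: link1.
case/negP: nl; rewrite link_sym in lad; apply: link_trans lad.
case: (side_exit C cA dX cd) => [dA'|e|e|[e _]].
- by rewrite dA' in dA.
- by subst d; apply: ly.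
- by subst d; apply: ly'.
- by subst d; apply: link1; rewrite // adjC.
Qed.

(** Induction on the size of the side. After the exchange, [s] is the only vertex of [A] that has
    lost a neighbour, namely [x]. So a flat edge found in [A] is flat in [X] or has [s] as an end;
    in the second case its other end [m] is the center of a cut with a smaller side. *)
Lemma icut_false n x s t y y' : #|side x s y y'| < n -> icut x s t y y' -> flat_in (side x s y y').
Proof.
elim: n x s t y y' => // n ind x s t y y' ltn C; apply: contraT => nf.
have [xX sX tX [sD tD xs xt]] := icut_branches C.
have [_ [_ _ _ hx] [yX y'X yy' yx y'x] [ys yt y's y't] _] := C.
set A := side x s y y' in nf ltn.
have J2 : twoconn (X :\ x) by apply: (branch_isolated xX xs xt).
have CP := side_cutpair C.
have A0 : A != set0 by apply/set0Pn; exists s; apply: s_side x s y y'.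
have B0 : far (X :\ x) A y y' != set0 by apply/set0Pn; exists t; apply: t_far C.
have [Q [sQB X'2 sQ cQ hQ]] := block J2 CP A0 B0; set X' := _ :|: Q in X'2 sQ.
have sX' : X' \subset X :\ x.
  apply/subsetP=> z; rewrite 2!in_setU in_set2 in_setD1 => /orP[/orP[/(side_rest C)[_ _ -> ->]|/orP[] /eqP->]|].
  - by [].
  - by rewrite yx.
  - by rewrite y'x.
  - by move/(subsetP sQB)/(in_far_side C) => -[-> ->].
have lt : #|X'| < #|X|.
  by rewrite [ltnRHS](cardsD1 x) xX ltnS subset_leq_card.
have degA z : z \in A -> z != s -> z \in deg2 X' -> z \in deg2 X.
  move=> zA zs /deg2P[zX' n2]; have [_ _ _ zX] := side_rest C zA; apply/deg2P; split=> //.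
  rewrite -n2; congr #|pred_of_set _|; apply/setP=> w; rewrite !in_nbr.
  case zw: (adj z w); rewrite ?andbF // !andbT; apply/idP/idP => [wX|]; last first.
    by move/(subsetP sX'); rewrite in_setD1 => /andP[].
  rewrite 2!in_setU in_set2; case: (side_exit C zA wX zw) => [->|->|->|[_ e]]; rewrite ?eqxx ?orbT //.
  by rewrite e eqxx in zs.
(* [y] is adjacent to [y'], to a vertex of [A] and to a vertex of [Q], so the set is not a cycle. *)
case: (IH lt X'2) => [all2|/(block_flat sQ cQ hQ)].
  have yS : y \in [set y; y'] by rewrite in_set2 eqxx.
  have [q qQ yq] := hQ y yS.
  have sy' : s != y' by rewrite eq_sym.
  have [e [c [eS ey' cA ce _]]] := side_touch C (s_side x s y y') sy'.
  have ee : e = y by move: eS; rewrite in_set2 (negPf ey') orbF => /eqP.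
  subst e; have [_ _ qA [_ qy']] := in_far_side C (subsetP sQB q qQ).
  have [_ cy' _ _] := side_rest C cA.
  have yX' : y \in X' by rewrite 2!in_setU yS orbT.
  have : 2 < #|nbr X' y|; last by rewrite all2.
  apply: (@card_ge3 _ _ y' c q); rewrite ?in_nbr ?yy' ?yq ?andbT //; try by rewrite eq_sym.
  - by rewrite 2!in_setU in_set2 eqxx !orbT.
  - by rewrite adjC ce andbT 2!in_setU; have -> : c \in A by [].
  - by rewrite in_setU qQ orbT.
  - by apply: contraNneq qA => <-.
move=> [u [w [uA wA uw [uD wD] _]]].
have [m [mA sm mD]] : exists m, [/\ m \in A, adj s m & m \in deg2 X'].
  have [us|us] := eqVneq u s; first by exists w; rewrite -us.
  have [ws|ws] := eqVneq w s; first by exists u; rewrite -ws adjC.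
  by case/negP: nf; apply/flat_inP; exists u, w; split=> //; apply: degA.
have ms : m != s by rewrite eq_sym adj_neq.
have {mD} mD := degA m mA ms mD; have /deg2P[mX _] := mD.
have [a [aX ma as']] := twoconn_nbr2 s X2 mX.
have hm z : z \in X -> adj m z -> z = s \/ z = a.
  by apply: (deg2_two mD); rewrite // 1?adjC // eq_sym.
(* Otherwise [a] lies in [A], since [y] and [y'] do not have degree 2, and [m a] is a flat edge of
   [A]. *)
have aD : a \notin deg2 X.
  apply/negP=> aD; case: (a_place C mA ms ma aX) => e.
  - by case/negP: nf; apply/flat_inP; exists m, a.
  - by have := y_branch C; rewrite -e aD.
  - by have := y'_branch C; rewrite -e aD.
rewrite adjC in sm; rewrite eq_sym in as'.
have [v [v' C2]] := isolated_icut mX sX aX as' sm ma sD aD hm.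
have sub := side_shrinks C mA ms ma C2.
case/negP: nf; have /flat_inP[u' [w' [uA' wA' uD' wD' uw']]] : flat_in (side m a v v').
  (* The side of [a] omits [s], hence it is properly smaller than [A]. *)
  apply: ind (icut_swap C2); rewrite ltnS in ltn; apply: leq_trans ltn; apply: proper_card.
  apply/properP; split=> //; exists s; first exact: s_side x s y y'.
  exact: t_side (icut_swap C2).
by apply/flat_inP; exists u', w'; rewrite !(subsetP sub).
Qed.

Lemma no_counterexample : False.
Proof.
have [x xD hx] := ex_isolated; have /deg2P[xX n2] := xD.
have [s [t [sX tX xs xt [st ht]]]] := nbr2P n2.
have sD : s \notin deg2 X by apply/negP=> /hx; rewrite xs.
have tD : t \notin deg2 X by apply/negP=> /hx; rewrite xt.
have [y [y' C]] := isolated_icut xX sX tX st xs xt sD tD ht.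
have /negP[] := flat_one_side C (icut_false (ltnSn _) C).
exact: icut_false (ltnSn _) (icut_swap C).
Qed.

End Counterexample.

Lemma flat2P (G : sgraph) (X : {set G}) : reflect (flat2 X)
  [exists a in deg2 X, exists b in deg2 X, exists c in deg2 X, exists d in deg2 X,
     [&& adj a b, adj c d & ~~ link (deg2 X) a c]].
Proof.
apply: (iffP exists_inP).
  move=> [a aD /exists_inP[b bD /exists_inP[c cD /exists_inP[d dD /and3P[ab cd nl]]]]].
  by exists a, b, c, d; rewrite aD bD cD dD.
move=> [a [b [c [d [/and4P[aD bD cD dD] ab cd nl]]]]].
exists a => //; apply/exists_inP; exists b => //; apply/exists_inP; exists c => //.
by apply/exists_inP; exists d => //; rewrite ab cd.
Qed.

Lemma twoconn_flat (G : sgraph) (X : {set G}) : propeller_free G -> twoconn X ->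
  (forall v, v \in X -> #|nbr X v| = 2) \/ flat2 X.
Proof.
move=> GP; have [n] := ubnP #|X|; elim: n X => // n IH X le X2.
have [f|nf] := flat2P X; [by right | left=> v vX; apply/eqP; apply: contraT => ne].
case: (@no_counterexample G (fun C c a b => @propeller_free_hole G C c a b GP) X) => //; first by exists v.
by move=> Y lt; apply: IH; apply: leq_trans lt _.
Qed.

Theorem theorem5p3 (G : sgraph) (G2 : two_connected G)
    (GP : propeller_free G) :
  is_chordless_cycle G \/ exists e f : {set G}, flat_pair e f.
Proof.
have T2 := two_connected_setT G2; case: (twoconn_flat GP T2) => [all2|/flat2_flat_pair]; last by right.
left; have hG : hole [set: G].
  split=> //; last exact: twoconn_conn.
  by rewrite -card_gt0; case: T2 => h _; apply: leq_trans h.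
by have [c inC cc] := hole_cycle hG; exists c; split=> // z; rewrite inC inE.
Qed.
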